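(* Let $G=SU(2)$ or $SO(3)$, and let $(A,\Phi=\phi+\phi_y\,dy)$ be a polyhomogeneous Nahm pole solution to the Kapustin-Witten equations over $X\times\mathbb{R}^+$, in temporal gauge (so $A$ has no $dy$ component; $\phi$ has no $dy$ component). Then: (1) $(A,\Phi)$ has the following expansions as $y\to0$: $$A\sim \omega+\sum_{i=1}^{\infty}\sum_{p=0}^{i}a_{2i,p}\,y^{2i}(\log y)^p,\quad \phi\sim y^{-1}e+\sum_{i=1}^{\infty}\sum_{p=0}^{i} b_{2i-1,p}\,y^{2i-1}(\log y)^p,\quad \phi_y\sim \sum_{i=1}^{\infty}\sum_{p=0}^{i}(\phi_y)_{2i,p}\, y^{2i}(\log y)^p,$$ where $e$ is the vierbein form and $\omega$, under the pullback by $e$, is the Levi-Civita connection of $X$. (So the expansions of $A$ and $\phi_y$ contain only even powers of $y$ and the expansion of $\phi$ only odd powers of $y$.) (2) If $X$ is an Einstein 3-manifold, then $(A,\Phi=\phi+\phi_y\,dy)$ has the expansions $$A\sim \omega+\sum_{i=1}^{\infty}a_{2i}\,y^{2i},\quad \phi\sim y^{-1}e+\sum_{i=1}^{\infty} b_{2i-1}\,y^{2i-1},\quad \phi_y\sim \sum_{i=1}^{\infty}(\phi_y)_{2i}\,y^{2i}.$$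
   Context: $X$ is a smooth 3-manifold with a Riemannian metric and volume form $\mathrm{Vol}_X$; ''Einstein'' means that this metric is Einstein. $\mathbb{R}^+=(0,+\infty)$ with coordinate $y$; $X\times\mathbb{R}^+$ carries the product metric and volume form $\mathrm{Vol}_X\wedge dy$. $P$ is a principal $G$-bundle over $X\times\mathbb{R}^+$, $\mathfrak{g}_P$ its adjoint bundle. The Kapustin-Witten equations for a connection $A$ on $P$ and a $\mathfrak{g}_P$-valued 1-form $\Phi$ are $F_A-\Phi\wedge\Phi+\star_4 d_A\Phi=0$, $d_A^{\star_4}\Phi=0$, where $\star_4$ is the 4-dimensional Hodge star and $d_A^{\star_4}$ is the formal adjoint of $d_A$. Nahm pole: the vierbein form is $e=\sum_{i=1}^3\mathfrak{t}_i\mathfrak{e}_i$, where $\{\mathfrak{e}_i\}$ is a local orthonormal basis of $T^\star X$ and $\mathfrak{t}_i$ are sections of $\mathfrak{g}_P$ with $[\mathfrak{t}_a,\mathfrak{t}_b]=\epsilon_{abc}\mathfrak{t}_c$. A solution is a Nahm pole solution if near each point of $X$, for such a choice, $A\sim\mathcal{O}(y^{-1+\epsilon})$ and $\Phi\sim y^{-1}e+\mathcal{O}(y^{-1+\epsilon})$ as $y\to0$ for some $\epsilon>0$. The connection $\omega$ is the ($y$-independent) leading term of $A$. Writing $A=\omega+a$, $\Phi=y^{-1}e+b+\phi_y\,dy$, it is a standing assumption (from known regularity theory) that $a,b,\phi_y$ have expansions as $y\to0$ in terms $y^i(\log y)^p$ with integers $i\ge1$, $p\ge0$ and finitely many $p$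 for each $i$. Polyhomogeneous: a form $\alpha$ is conormal if for all $j\ge0$ and multi-indices $\vec k$, $\sup|(y\partial_y)^j\partial_{\vec x}^{\vec k}\alpha|<\infty$ near the boundary $y=0$; it is polyhomogeneous if it is conormal and $\alpha\sim\sum y^{\gamma_j}(\log y)^p\alpha_{jp}(\vec x)$, with $\mathrm{Re}\,\gamma_j\to\infty$, finitely many nonnegative integer powers $p$ for each $\gamma_j$, where $\sim$ means that the difference from each partial sum is bounded by $y^{\mathrm{Re}\,\gamma_{N+1}}(\log y)^q$ for some $q$, and likewise after any finite number of differentiations. The coefficients are forms on $X$, independent of $y$ and smooth in $x$. *)

(* Defs.v *)
From HB Require Import structures.
From mathcomp Require Import all_boot all_order all_algebra.
From mathcomp Require Import complex.
From mathcomp Require Import all_classical all_reals all_analysis.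
Set Implicit Arguments.
Unset Strict Implicit.
Unset Printing Implicit Defensive.
Import Order.TTheory GRing.Theory Num.Theory.
Import numFieldNormedType.Exports.
Local Open Scope classical_set_scope.
Local Open Scope ring_scope.

(* Everything is expressed in coordinates.  A tensor field is a family, indexed
   by the charts, of component functions of the chart coordinates, subject to
   the usual transformation rule on overlaps; only its values on the image of
   the chart (resp. the image of the chart times R^+) are meaningful. *)

Section Calculus.
Context {R : realType}.

Definition partial n (mu : 'I_n) (f : 'rV[R]_n -> R) : 'rV[R]_n -> R :=
  'D_(delta_mx 0 mu) f.

Definition partials n (s : seq 'I_n) (f : 'rV[R]_n -> R) : 'rV[R]_n -> R :=
  foldr (@partial n) f s.

(* C^oo: all iterated partial derivatives exist and are continuous. *)
Definition smooth_on n (U : set 'rV[R]_n) (f : 'rV[R]_n -> R) : Prop :=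
  forall (s : seq 'I_n) (x : 'rV[R]_n), U x ->
    {for x, continuous (partials s f)} /\
    forall mu : 'I_n, derivable (partials s f) x (delta_mx 0 mu).

Definition smooth_mx n m p (U : set 'rV[R]_n) (f : 'rV[R]_n -> 'M[R]_(m, p)) :=
  forall r s, smooth_on U (fun x => f x r s).

Definition partial_mx n m p (mu : 'I_n) (f : 'rV[R]_n -> 'M[R]_(m, p))
    (x : 'rV[R]_n) : 'M[R]_(m, p) :=
  \matrix_(r, s) partial mu (fun w => f w r s) x.

Definition jac n (f : 'rV[R]_n -> 'rV[R]_n) (x : 'rV[R]_n) : 'M[R]_n :=
  \matrix_(k, l) partial k (fun w => f w 0 l) x.

(* The Levi-Civita symbol epsilon_{t_0 ... t_(n-1)}. *)
Definition levi n (t : n.-tuple 'I_n) : R :=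
  \det (\matrix_(i < n, j < n) ((tnth t i == j)%:R : R)).

End Calculus.

Section RiemannianCoordinates.
Context {R : realType} {n : nat}.
Variable h : 'rV[R]_n -> 'M[R]_n.

Definition christoffel (m k l : 'I_n) (x : 'rV[R]_n) : R :=
  2^-1 * \sum_(p < n) invmx (h x) m p *
    (partial k (fun w => h w l p) x + partial l (fun w => h w k p) x
     - partial p (fun w => h w k l) x).

Definition ricci (x : 'rV[R]_n) : 'M[R]_n :=
  \matrix_(j, k) \sum_(i < n)
    (partial i (christoffel i k j) x - partial k (christoffel i i j) x
     + \sum_(p < n) (christoffel i i p x * christoffel p k j x
                     - christoffel i k p x * christoffel p i j x)).

(* The component W^l of the Levi-Civita derivative of W along d/dx_k. *)
Definition nabla (k : 'I_n) (W : 'rV[R]_n -> 'rV[R]_n) (x : 'rV[R]_n) :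
    'rV[R]_n :=
  \row_l (partial k (fun w => W w 0 l) x
          + \sum_(m < n) christoffel l k m x * W x 0 m).

Definition vol (x : 'rV[R]_n) : R := Num.sqrt (\det (h x)).

End RiemannianCoordinates.

Section GaugeCoordinates.
Context {R : realType} {n m : nat}.
Implicit Types (A Phi : 'I_n -> 'rV[R]_n -> 'M[R]_m) (x : 'rV[R]_n).

Definition bracket (a b : 'M[R]_m) : 'M[R]_m := a *m b - b *m a.

Definition covD A (mu : 'I_n) (s : 'rV[R]_n -> 'M[R]_m) x : 'M[R]_m :=
  partial_mx mu s x + bracket (A mu x) (s x).

Definition curvature A (mu nu : 'I_n) x : 'M[R]_m :=
  partial_mx mu (A nu) x - partial_mx nu (A mu) x + bracket (A mu x) (A nu x).

(* (Phi /\ Phi)(u, v) = Phi(u) Phi(v) - Phi(v) Phi(u) *)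
Definition wedge_sq Phi (mu nu : 'I_n) x : 'M[R]_m :=
  bracket (Phi mu x) (Phi nu x).

Definition dA A Phi (mu nu : 'I_n) x : 'M[R]_m :=
  covD A mu (Phi nu) x - covD A nu (Phi mu) x.

(* The formal adjoint of s |-> d_A s for the metric h; see codiff_adjoint. *)
Definition flux (h : 'rV[R]_n -> 'M[R]_n) Phi (mu : 'I_n) x : 'M[R]_m :=
  vol h x *: \sum_(nu < n) invmx (h x) mu nu *: Phi nu x.

Definition codiff (h : 'rV[R]_n -> 'M[R]_n) A Phi x : 'M[R]_m :=
  - (vol h x)^-1 *: \sum_(mu < n) covD A mu (flux h Phi mu) x.

End GaugeCoordinates.

(* For the invariant pairing tr(ab),
   <d_A s, Phi> Vol - <s, codiff Phi> Vol is an exact divergence. *)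
Lemma codiff_adjoint (R : realType) (n m : nat) (h : 'rV[R]_n -> 'M[R]_n)
    (A Phi : 'I_n -> 'rV[R]_n -> 'M[R]_m) (s : 'rV[R]_n -> 'M[R]_m)
    (x : 'rV[R]_n) :
  vol h x != 0 ->
  (forall mu r t, derivable (fun w => s w r t) x (delta_mx 0 mu)) ->
  (forall mu r t, derivable (fun w => flux h Phi mu w r t) x (delta_mx 0 mu)) ->
  vol h x * (\sum_(mu < n) \sum_(nu < n)
               invmx (h x) mu nu * \tr (covD A mu s x *m Phi nu x))
  - vol h x * \tr (s x *m codiff h A Phi x)
  = \sum_(mu < n) partial mu (fun w => \tr (s w *m flux h Phi mu w)) x.
Proof.
move=> vol0 ds dF.
pose F := flux h Phi.
have Fx mu : F mu x = vol h x *: \sum_(nu < n) invmx (h x) mu nu *: Phi nu x by [].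
have prodE mu : partial mu (fun w => \tr (s w *m F mu w)) x =
    \tr (partial_mx mu s x *m F mu x) + \tr (s x *m partial_mx mu (F mu) x).
  rewrite /partial.
  have -> : (fun w => \tr (s w *m F mu w)) =
      \sum_(r < m) \sum_(t < m) ((fun w => s w r t) * (fun w => F mu w t r)).
    apply/funext => w; rewrite fct_sumE /mxtrace; apply: eq_bigr => r _.
    by rewrite fct_sumE mxE.
  rewrite derive_sum; last first.
    move=> r; apply: derivable_sum => t; apply: derivableM; [exact: ds|exact: dF].
  rewrite /mxtrace -big_split /=; apply: eq_bigr => r _.
  rewrite derive_sum; last first.
    by move=> t; apply: derivableM; [exact: ds|exact: dF].
  rewrite !mxE -big_split /=; apply: eq_bigr => t _.
  rewrite deriveM; [|exact: ds|exact: dF].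
  by rewrite !mxE addrC; congr (_ + _); exact: mulrC.
have -> : \sum_(mu < n) partial mu (fun w => \tr (s w *m flux h Phi mu w)) x =
    \sum_(mu < n) (\tr (covD A mu s x *m F mu x)
                   + \tr (s x *m covD A mu (F mu) x)).
  apply: eq_bigr => mu _; rewrite prodE /covD /bracket.
  rewrite !(mulmxDl, mulmxDr, mulNmx, mulmxN) !raddfD /= !raddfN /= !mulmxA.
  rewrite [in RHS](mxtrace_mulC _ (A mu x)) !mulmxA addrACA.
  by rewrite subrKA subrr addr0.
rewrite big_split /=; congr (_ + _).
  rewrite mulr_sumr; apply: eq_bigr => mu _.
  rewrite Fx -scalemxAr mxtraceZ; congr (_ * _).
  rewrite mulmx_sumr raddf_sum /=; apply: eq_bigr => nu _.
  by rewrite -scalemxAr mxtraceZ.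
rewrite /codiff scaleNr mulmxN raddfN /= mulrN opprK -scalemxAr mxtraceZ mulrA.
by rewrite divff // mul1r mulmx_sumr raddf_sum.
Qed.

(* Hodge star on 2-forms in dimension 4, for the orientation dx0 dx1 dx2 dx3. *)
Definition hodge2 {R : realType} {m : nat} (h : 'rV[R]_4 -> 'M[R]_4)
    (beta : 'I_4 -> 'I_4 -> 'rV[R]_4 -> 'M[R]_m) (mu nu : 'I_4)
    (x : 'rV[R]_4) : 'M[R]_m :=
  (2^-1 * vol h x) *:
    \sum_(a < 4) \sum_(b < 4) \sum_(c < 4) \sum_(d < 4)
      (invmx (h x) a c * invmx (h x) b d * levi [tuple a; b; mu; nu])
        *: beta c d x.

Section Group.
Context {R : realType}.

Inductive gauge_group := SU2 | SO3.

(* C^2 is identified with R^4: SU(2) acts there by real 4 x 4 matrices. *)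
Definition gdim (G : gauge_group) : nat :=
  match G with SU2 => 4 | SO3 => 3 end.

Definition realify (U : 'M[R[i]]_2) : 'M[R]_(2 + 2) :=
  block_mx (map_mx (@complex.Re R) U) (- map_mx (@complex.Im R) U)
           (map_mx (@complex.Im R) U) (map_mx (@complex.Re R) U).

Definition adjmx (U : 'M[R[i]]_2) : 'M[R[i]]_2 := (map_mx (@conjc R) U)^T.

Definition group_carrier (G : gauge_group) : set 'M[R]_(gdim G) :=
  match G return set 'M[R]_(gdim G) with
  | SU2 => [set M | exists U : 'M[R[i]]_2,
               [/\ M = realify U, adjmx U *m U = 1%:M & \det U = 1]]
  | SO3 => [set M | M^T *m M = 1%:M /\ \det M = 1]
  end.

Definition lie_carrier (G : gauge_group) : set 'M[R]_(gdim G) :=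
  match G return set 'M[R]_(gdim G) with
  | SU2 => [set M | exists U : 'M[R[i]]_2,
               [/\ M = realify U, adjmx U = - U & \tr U = 0]]
  | SO3 => [set M | M^T = - M]
  end.

End Group.

(* An oriented smooth 3-manifold, by an atlas of charts chart i : dom i -> cod i
   with inverses cinv i. *)
Record manifold3 (R : realType) := Manifold3 {
  point : topologicalType;
  idx : Type;
  dom : idx -> set point;
  cod : idx -> set 'rV[R]_3;
  chart : idx -> point -> 'rV[R]_3;
  cinv : idx -> 'rV[R]_3 -> point;
  _ : hausdorff_space point;
  _ : @second_countable point;
  _ : forall p, exists i, dom i p;
  _ : forall i, open (dom i);
  _ : forall i, open (cod i);
  _ : forall i p, dom i p -> cod i (chart i p) /\ cinv i (chart i p) = p;
  _ : forall i x, cod i x -> dom i (cinv i x) /\ chart i (cinv i x) = x;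
  _ : forall i p, dom i p -> {for p, continuous (chart i)};
  _ : forall i x, cod i x -> {for x, continuous (cinv i)};
  _ : forall i j, smooth_mx [set x | cod i x /\ dom j (cinv i x)]
                            (fun x => chart j (cinv i x));
  _ : forall i j x, cod i x -> dom j (cinv i x) ->
        0 < \det (jac (fun w => chart j (cinv i w)) x)
}.

Section Geometry.
Context {R : realType} (X : manifold3 R).

Definition overlap (i j : idx X) : set 'rV[R]_3 :=
  [set x | cod i x /\ dom j (cinv i x)].

Definition tau (i j : idx X) (x : 'rV[R]_3) : 'rV[R]_3 := chart j (cinv i x).

Record riemannian := Riemannian {
  metric : idx X -> 'rV[R]_3 -> 'M[R]_3;
  _ : forall i, smooth_mx (cod i) (metric i);
  _ : forall i x, cod i x -> (metric i x)^T = metric i x;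
  _ : forall i x (v : 'rV[R]_3), cod i x -> v != 0 ->
        0 < (v *m metric i x *m v^T) 0 0;
  _ : forall i j x, overlap i j x ->
        metric i x = jac (tau i j) x *m metric j (tau i j x)
                     *m (jac (tau i j) x)^T
}.

Definition einstein (g : riemannian) : Prop :=
  exists lambda : R, forall i x, cod i x ->
    ricci (metric g i) x = lambda *: metric g i x.

(* Coordinates (x, y) on X x R^+. *)
Definition xpart (z : 'rV[R]_(3 + 1)) : 'rV[R]_3 := lsubmx z.
Definition ypart (z : 'rV[R]_(3 + 1)) : R := rsubmx z 0 0.
Definition xy (x : 'rV[R]_3) (y : R) : 'rV[R]_(3 + 1) := row_mx x y%:M.
Definition xdir (k : 'I_3) : 'I_(3 + 1) := lshift 1 k.
Definition ydir : 'I_(3 + 1) := rshift 3 ord0.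

Definition cyl (U : set 'rV[R]_3) : set 'rV[R]_(3 + 1) :=
  [set z | U (xpart z) /\ 0 < ypart z].

Definition tau4 (i j : idx X) (z : 'rV[R]_(3 + 1)) : 'rV[R]_(3 + 1) :=
  xy (tau i j (xpart z)) (ypart z).

Definition metric4 (g : riemannian) (i : idx X) (z : 'rV[R]_(3 + 1)) :
    'M[R]_(3 + 1) :=
  block_mx (metric g i (xpart z)) 0 0 1%:M.

(* A principal G-bundle over X x R^+, by its transition functions with respect
   to trivialisations over dom i x R^+; on overlaps the local sections satisfy
   s_j = s_i * trans i j. *)
Record bundle (G : gauge_group) := Bundle {
  trans : idx X -> idx X -> 'rV[R]_(3 + 1) -> 'M[R]_(gdim G);
  _ : forall i j, smooth_mx (cyl (overlap i j)) (trans i j);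
  _ : forall i j z, cyl (overlap i j) z -> group_carrier (trans i j z);
  _ : forall i j k z, cyl (overlap i j `&` overlap i k) z ->
        trans i j z *m trans j k (tau4 i j z) = trans i k z
}.

Definition sec4 (G : gauge_group) :=
  idx X -> 'rV[R]_(3 + 1) -> 'M[R]_(gdim G).
Definition form4 (G : gauge_group) :=
  idx X -> 'I_(3 + 1) -> 'rV[R]_(3 + 1) -> 'M[R]_(gdim G).
Definition secX (G : gauge_group) :=
  idx X -> 'rV[R]_3 -> 'M[R]_(gdim G).
Definition formX (G : gauge_group) :=
  idx X -> 'I_3 -> 'rV[R]_3 -> 'M[R]_(gdim G).

Section Forms.
Context {G : gauge_group} (P : bundle G).

Definition is_section (s : sec4 G) : Prop :=
  (forall i, smooth_mx (cyl (cod i)) (s i)) /\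
  (forall i z, cyl (cod i) z -> lie_carrier (s i z)) /\
  (forall i j z, cyl (overlap i j) z ->
     s j (tau4 i j z) = invmx (trans P i j z) *m s i z *m trans P i j z).

Definition is_form1 (alpha : form4 G) : Prop :=
  (forall i mu, smooth_mx (cyl (cod i)) (alpha i mu)) /\
  (forall i mu z, cyl (cod i) z -> lie_carrier (alpha i mu z)) /\
  (forall i j mu z, cyl (overlap i j) z ->
     \sum_(nu < 3 + 1) jac (tau4 i j) z mu nu *: alpha j nu (tau4 i j z)
     = invmx (trans P i j z) *m alpha i mu z *m trans P i j z).

Definition is_connection (A : form4 G) : Prop :=
  (forall i mu, smooth_mx (cyl (cod i)) (A i mu)) /\
  (forall i mu z, cyl (cod i) z -> lie_carrier (A i mu z)) /\
  (forall i j mu z, cyl (overlap i j) z ->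
     \sum_(nu < 3 + 1) jac (tau4 i j) z mu nu *: A j nu (tau4 i j z)
     = invmx (trans P i j z) *m A i mu z *m trans P i j z
       + invmx (trans P i j z) *m partial_mx mu (trans P i j) z).

(* Objects on X are regarded as y-independent objects on X x R^+ without dy
   component. *)
Definition lift0 (s : secX G) : sec4 G := fun i z => s i (xpart z).

Definition lift1 (alpha : formX G) : form4 G := fun i mu z =>
  match fintype.split mu with inl k => alpha i k (xpart z) | inr _ => 0 end.

Definition temporal_gauge (A : form4 G) : Prop :=
  forall i z, cyl (cod i) z -> A i ydir z = 0.

Definition dy_part (Phi : form4 G) : sec4 G := fun i z => Phi i ydir z.

Definition kapustin_witten (g : riemannian) (A Phi : form4 G) : Prop :=
  forall i z, cyl (cod i) z ->
    (forall mu nu : 'I_(3 + 1),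
       curvature (A i) mu nu z - wedge_sq (Phi i) mu nu z
       + hodge2 (metric4 g i) (dA (A i) (Phi i)) mu nu z = 0) /\
    codiff (metric4 g i) (A i) (Phi i) z = 0.

(* Near each point, e = \sum_a t_a theta_a with theta a local orthonormal
   coframe and t_a local sections, so that e is injective on tangent vectors:
   the t_a do not vanish, the zero triple being excluded. *)
Definition vierbein (g : riemannian) (e : formX G) : Prop :=
  forall i x0, cod i x0 ->
  exists (U : set 'rV[R]_3) (theta : 'I_3 -> 'I_3 -> 'rV[R]_3 -> R)
         (t : 'I_3 -> 'rV[R]_3 -> 'M[R]_(gdim G)),
    (open U /\ U x0 /\ U `<=` cod i) /\
    (forall a k, smooth_on U (theta a k)) /\
    (forall a, smooth_mx U (t a)) /\
    forall x, U x ->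
      [/\ forall a b, \sum_(k < 3) \sum_(l < 3)
            invmx (metric g i x) k l * theta a k x * theta b l x = (a == b)%:R,
          forall a, lie_carrier (t a x) /\ t a x != 0,
          forall a b, bracket (t a x) (t b x)
                      = \sum_(c < 3) levi [tuple a; b; c] *: t c x &
          forall k, e i k x = \sum_(a < 3) theta a k x *: t a x].

Definition nahm_pole (g : riemannian) (A Phi : form4 G) (e : formX G) : Prop :=
  vierbein g e /\
  forall i x0, cod i x0 -> exists eps C delta : R, 0 < eps /\ 0 < delta /\
    \forall x \near x0, forall y : R, 0 < y < delta -> forall mu r s,
      `| A i mu (xy x y) r s | <= C * y `^ (eps - 1) /\
      `| Phi i mu (xy x y) r s - y^-1 * lift1 e i mu (xy x y) r s |
        <= C * y `^ (eps - 1).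

(* For every vector field W, the derivative of e(W) with respect to w is
   e applied to the Levi-Civita derivative of W. *)
Definition pullback_is_levi_civita (g : riemannian) (e w : formX G) : Prop :=
  forall i (W : 'rV[R]_3 -> 'rV[R]_3), smooth_mx (cod i) W ->
  forall (k : 'I_3) x, cod i x ->
    covD (w i) k (fun u => \sum_(l < 3) W u 0 l *: e i l u) x
    = \sum_(l < 3) nabla (metric g i) k W x 0 l *: e i l x.

End Forms.
End Geometry.

Section Asymptotics.
Context {R : realType}.
Implicit Types (U : set 'rV[R]_3) (f : 'rV[R]_(3 + 1) -> R).

Definition ydy f : 'rV[R]_(3 + 1) -> R := fun z => ypart z * partial ydir f z.

(* (y d_y)^j d_x^ks *)
Definition bderiv (j : nat) (ks : seq 'I_3) f : 'rV[R]_(3 + 1) -> R :=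
  iter j ydy (partials (map xdir ks) f).

Definition conormal U f : Prop :=
  forall (j : nat) (ks : seq 'I_3) x0, U x0 ->
  exists C delta : R, 0 < delta /\
    \forall x \near x0, forall y : R, 0 < y < delta ->
      `| bderiv j ks f (xy x y) | <= C.

Definition psum (gam dep : nat -> nat) (c : nat -> nat -> 'rV[R]_3 -> R)
    (N : nat) (z : 'rV[R]_(3 + 1)) : R :=
  \sum_(n < N) \sum_(p < (dep n).+1)
    c n p (xpart z) * ypart z ^+ gam n * ln (ypart z) ^+ p.

(* f ~ \sum_n \sum_(p <= dep n) c_(n,p)(x) y^(gam n) (log y)^p as y -> 0,
   locally uniformly in x and with all derivatives. *)
Definition expansion U f (gam dep : nat -> nat)
    (c : nat -> nat -> 'rV[R]_3 -> R) : Prop :=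
  forall (N j : nat) (ks : seq 'I_3) x0, U x0 ->
  exists (q : nat) (C delta : R), 0 < delta /\
    \forall x \near x0, forall y : R, 0 < y < delta ->
      `| bderiv j ks (fun z => f z - psum gam dep c N z) (xy x y) |
        <= C * y ^+ gam N * `| ln y | ^+ q.

Context {X : manifold3 R} {G : gauge_group} (P : bundle X G).

Definition expands0 (s : sec4 X G) (gam dep : nat -> nat)
    (c : nat -> nat -> secX X G) : Prop :=
  (forall n p, is_section P (lift0 (c n p))) /\
  forall i r t, expansion (cod i) (fun z => s i z r t) gam dep
                          (fun n p x => c n p i x r t).

Definition expands1 (alpha : form4 X G) (gam dep : nat -> nat)
    (c : nat -> nat -> formX X G) : Prop :=
  (forall n p, is_form1 P (lift1 (c n p))) /\
  forall i k r t, expansion (cod i) (fun z => alpha i (xdir k) z r t) gam dep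
                            (fun n p x => c n p i k x r t).

Definition minus_lead (A : form4 X G) (w : formX X G) : form4 X G :=
  fun i mu z => A i mu z - lift1 w i mu z.

Definition minus_pole (Phi : form4 X G) (e : formX X G) : form4 X G :=
  fun i mu z => Phi i mu z - (ypart z)^-1 *: lift1 e i mu z.

(* A = w + a and Phi = y^-1 e + b + phi_y dy with a, b, phi_y polyhomogeneous
   with exponents 1, 2, 3, ...; w is a connection, e a g_P-valued form on X. *)
Definition polyhomogeneous (A Phi : form4 X G) (e w : formX X G) : Prop :=
  is_connection P (lift1 w) /\ is_form1 P (lift1 e) /\
  (forall i k r t,
     conormal (cod i) (fun z => minus_lead A w i (xdir k) z r t) /\
     conormal (cod i) (fun z => minus_pole Phi e i (xdir k) z r t) /\
     conormal (cod i) (fun z => dy_part Phi i z r t)) /\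
  exists (dep : nat -> nat) (a b : nat -> nat -> formX X G)
         (f : nat -> nat -> secX X G),
    [/\ expands1 (minus_lead A w) succn dep a,
        expands1 (minus_pole Phi e) succn dep b &
        expands0 (dy_part Phi) succn dep f].

End Asymptotics.

(* Main.v *)
Require Import Defs.
From mathcomp Require Import all_boot all_order all_algebra.
From mathcomp Require Import complex ring lra zify.
From mathcomp Require Import all_classical all_reals all_analysis.
Set Implicit Arguments.
Unset Strict Implicit.
Unset Printing Implicit Defensive.
Import Order.TTheory GRing.Theory Num.Theory.
Import numFieldNormedType.Exports.
Local Open Scope classical_set_scope.
Local Open Scope ring_scope.

(** In a chart, identify the Lie algebra with R^3 so that the bracket is the
    cross product, and read the equations in the orthonormal frame given by
    the vierbein. With Psi = y phi they become a system in y d/dy,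
    [frame_eqs], whose solution has an expansion in powers of y with
    coefficients polynomial in log y. Expansions are unique
    ([asym_unique]), so the system holds coefficient by coefficient. On a term
    y^n P(log y) the operator y d/dy acts as P |-> n P + P'.

    The leading terms say that the vierbein is positively oriented
    ([orientation]) and that omega is torsion free ([torsion_free]); as omega
    also rotates the frame, it is the Levi-Civita connection
    ([levi_civita]). At order n the top coefficients solve a linear equation
    L P + P' = S whose source S only involves lower orders and their
    x-derivatives. For Psi_n the eigenvalues of L are n + 1, n and n - 2, the
    last on traceless symmetric matrices ([indicialB]); for A_n and
    (phi_y)_n together they are n + 1 and n - 2 ([indicialA]). When n is not 2
    the equation has one solution, with no more powers of log y than the source
    ([size_ode]). The system is even: every term of a source of odd order
    has a factor of odd order, so all odd orders vanish by induction.
    This gives the parity statement, since phi = Psi / y.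

    At n = 2 a logarithm may appear. The source of Psi_2 is the curvature
    of omega, so its traceless symmetric part gives Psi_2 a term linear in
    log y ([order2_log]). For A_2 and (phi_y)_2 the resonant components of the
    source are the trace of the curl of Psi_2, and the axial vector of that
    curl minus the divergence. At the top power of log y the coefficient of
    Psi_2 is symmetric with constant trace, and both components vanish
    ([no_resonance]); so order 2 carries at most log y to the first power,
    and by the superadditivity of n / 2 order n carries at most
    (log y)^(n / 2) ([chart_expansion]).

    On an Einstein manifold of dimension 3 the Ricci tensor determines the
    curvature ([einstein_curvature]), which is therefore isotropic: its
    traceless symmetric part vanishes, Psi_2 has no logarithm
    ([order2_einstein]) and none is ever created
    ([chart_expansion_einstein]). *)

(** * Expansions in powers of y and log y *)

Section LogSeries.
Context {R : realType}.
Implicit Types (u v : R -> R) (P : {poly R}) (p : {poly {poly R}})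
  (s t : nat -> {poly R}).

Definition bigO (N : nat) u := exists (q : nat) (C : R),
  \forall y \near 0^'+, `|u y| <= C * (y ^+ N * `|ln y| ^+ q).

Lemma near_small (d : R) : 0 < d -> \forall y \near 0^'+, 0 < y < d.
Proof.
by move=> d0; near=> y; apply/andP; split; near: y; [exact: nbhs_right_gt|
  exact: nbhs_right_lt].
Unshelve. all: by end_near. Qed.

Lemma near_ln_ge (K : R) : \forall y \near 0^'+, 0 < y < 1 /\ K <= `|ln y|.
Proof.
have := near_small (expR_gt0 (- `|K|)); apply: filterS => y /andP[y0 yK].
have y1 : y < 1 by rewrite (lt_le_trans yK)// -expR0 ler_expR oppr_le0.
split; first by rewrite y0.
rewrite ltr0_norm; last by rewrite ln_lt0// y0.
rewrite lerNr; apply: (@le_trans _ _ (- `|K|)); last by rewrite lerN2 ler_norm.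
by rewrite -(expRK (- `|K|)) ler_ln ?posrE ?expR_gt0// ltW.
Qed.

(** The exponential dominates each of its Taylor monomials. *)
Lemma y_log_bounded (q : nat) :
  \forall y \near 0^'+, y * `|ln y| ^+ q.+1 <= q.+1`!%:R :> R.
Proof.
have := near_ln_ge 1; apply: filterS => y [/andP[y0 y1] _].
have l0 : ln y < 0 by rewrite ln_lt0// y0.
have := @expR_ge1Dxn R (- ln y) q; rewrite oppr_ge0 ltW// expRN lnK ?posrE//.
move=> /(_ isT) h; rewrite ltr0_norm// mulrC -ler_pdivlMr//.
rewrite mulrC -ler_pdivrMr ?ltr0n ?fact_gt0//.
by apply: le_trans h; rewrite lerDr.
Qed.

Lemma bigO_near N u v : (\forall y \near 0^'+, u y = v y) -> bigO N u -> bigO N v.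
Proof.
move=> uv [q [C h]]; exists q, C.
by apply: filterS2 uv h => y ->.
Qed.

Lemma bigO_gt0 N u v : (forall y, 0 < y -> u y = v y) -> bigO N u -> bigO N v.
Proof.
move=> uv; apply: bigO_near; have := near_small ltr01.
by apply: filterS => y /andP[y0 _]; exact: uv.
Qed.

Lemma bigOC N u (c : R) : bigO N u -> bigO N (fun y => c * u y).
Proof.
move=> [q [C h]]; exists q, (`|c| * C); apply: filterS h => y h.
by rewrite normrM -mulrA ler_wpM2l.
Qed.

(** Puts two bounds over a common power of log y; powers of |log y| increase
    with the exponent only once |log y| >= 1. *)
Lemma bigO_raise N u : bigO N u -> exists q0 (C : R), 0 <= C /\ forall q,
  (q0 <= q)%N ->
  \forall y \near 0^'+, `|u y| <= C * (y ^+ N * `|ln y| ^+ q).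
Proof.
move=> [q0 [C h]]; exists q0, `|C|; split => // q q0q.
apply: filterS2 h (near_ln_ge 1) => y h [/andP[y0 y1] l1].
apply: (le_trans h); apply: (@le_trans _ _ (`|C| * (y ^+ N * `|ln y| ^+ q0))).
  by apply: ler_wpM2r; rewrite ?ler_norm// mulr_ge0 ?exprn_ge0// ltW.
by rewrite !ler_wpM2l ?exprn_ge0// ?(ltW y0)// ler_weXn2l.
Qed.

Lemma bigOD N u v : bigO N u -> bigO N v -> bigO N (fun y => u y + v y).
Proof.
move=> /bigO_raise[q1 [C1 [_ h1]]] /bigO_raise[q2 [C2 [_ h2]]].
exists (q1 + q2)%N, (C1 + C2).
apply: filterS2 (h1 _ (leq_addr q2 q1)) (h2 _ (leq_addl q1 q2)) => y {}h1 {}h2.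
by rewrite (le_trans (ler_normD _ _))// mulrDl lerD.
Qed.

Lemma bigOM N M u v : bigO N u -> bigO M v -> bigO (N + M) (fun y => u y * v y).
Proof.
move=> [q1 [C1 h1]] [q2 [C2 h2]].
exists (q1 + q2)%N, (C1 * C2); apply: filterS2 h1 h2 => y h1 h2.
rewrite normrM !exprD.
have -> : C1 * C2 * (y ^+ N * y ^+ M * (`|ln y| ^+ q1 * `|ln y| ^+ q2)) =
  (C1 * (y ^+ N * `|ln y| ^+ q1)) * (C2 * (y ^+ M * `|ln y| ^+ q2)) by ring.
by rewrite ler_pM.
Qed.

Lemma bigO_le N M u : (M <= N)%N -> bigO N u -> bigO M u.
Proof.
move=> MN /bigO_raise[q [C [C0 /(_ q (leqnn _)) h]]]; exists q, C.
apply: filterS2 h (near_ln_ge 1) => y h [/andP[y0 y1] _].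
apply: (le_trans h); apply: ler_wpM2l => //; apply: ler_wpM2r.
  by rewrite exprn_ge0.
by rewrite ler_wiXn2l// ltW.
Qed.

Lemma bigO_cst (c : R) : bigO 0 (fun=> c).
Proof. by exists 0%N, `|c|; near=> y; rewrite !expr0 !mulr1. Unshelve. all: by end_near. Qed.

Lemma bigO_ln : bigO 0 (fun y => ln y).
Proof. by exists 1%N, 1; near=> y; rewrite mul1r expr0 mul1r expr1. Unshelve. all: by end_near. Qed.

Lemma bigO_poly P : bigO 0 (fun y => P.[ln y]).
Proof.
elim/poly_ind: P => [|P c ih].
  by apply: (@bigO_gt0 _ (fun=> 0)); [move=> y _; rewrite horner0|exact: bigO_cst].
apply: (@bigO_gt0 _ (fun y => P.[ln y] * ln y + c)).
  by move=> y _; rewrite hornerMXaddC.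
apply: bigOD; last exact: bigO_cst.
exact: (bigOM ih bigO_ln).
Qed.

Lemma bigO_y : bigO 1 (fun y => y).
Proof.
exists 0%N, 1; have := near_small ltr01; apply: filterS => y /andP[y0 _].
by rewrite mul1r expr1 expr0 mulr1 gtr0_norm.
Qed.

Lemma bigO_yn n : bigO n (fun y => y ^+ n).
Proof.
elim: n => [|n ih]; first exact: bigO_cst.
apply: (@bigO_gt0 _ (fun y => y * y ^+ n)); first by move=> y _; rewrite exprS.
exact: (bigOM bigO_y ih).
Qed.

Lemma bigO0 N : bigO N (fun=> 0).
Proof. by exists 0%N, 0; near=> y; rewrite normr0 mul0r. Unshelve. all: by end_near. Qed.

Lemma bigO_sum N n (F : 'I_n -> R -> R) : (forall i, bigO N (F i)) ->
  bigO N (fun y => \sum_(i < n) F i y).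
Proof.
elim: n F => [|n ih] F h.
  by apply: (@bigO_gt0 _ (fun=> 0)) (bigO0 _) => y _; rewrite big_ord0.
apply: (@bigO_gt0 _ (fun y => \sum_(i < n) F (widen_ord (leqnSn n) i) y
   + F ord_max y)); first by move=> y _; rewrite big_ord_recr.
by apply: bigOD => //; apply: ih.
Qed.

Lemma horner2E p (y l : R) : p.[y, l] = \sum_(n < size p) y ^+ n * (p`_n).[l].
Proof.
rewrite (horner_coef p) horner_sum; apply: eq_bigr => n _.
by rewrite -polyC_exp hornerM hornerC mulrC.
Qed.

Lemma bigO_horner2 N p : (forall n, (n < N)%N -> p`_n = 0) ->
  bigO N (fun y => p.[y, ln y]).
Proof.
move=> p0; apply: (@bigO_gt0 _
  (fun y => \sum_(n < size p) y ^+ n * (p`_n).[ln y])).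
  by move=> y _; rewrite horner2E.
apply: bigO_sum => n; have [nN|Nn] := ltnP n N.
  by apply: bigO_gt0 (bigO0 _) => y _; rewrite p0// horner0 mulr0.
apply: (bigO_le Nn).
by have := bigOM (bigO_yn n) (bigO_poly p`_n); rewrite addn0.
Qed.

(** Since y |log y|^q is bounded for each q, a bound O(y |log y|^q) on a
    nonzero polynomial in log y would let its leading term bound |log y|. *)
Lemma poly_log_eq0 P : bigO 1 (fun y => P.[ln y]) -> P = 0.
Proof.
move=> [q [C h]]; apply/eqP; apply: contraT => P0; exfalso.
have [d dP] : exists d, size P = d.+1.
  by exists (size P).-1; rewrite prednK// lt0n size_poly_eq0.
pose K := `|C| * q.+1`!%:R + \sum_(i < d) `|P`_i|.
have c0 : 0 < `|P`_d| by rewrite normr_gt0 -[d]/(d.+1.-1) -dP -lead_coefE lead_coef_eq0.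
suff : \forall y \near (0 : R)^'+, (False : Prop).
  by move=> /filter_ex[].
apply: filterS3 h (y_log_bounded q) (near_ln_ge (`|P`_d|^-1 * K + 1)).
move=> y h yq [/andP[y0 y1] lK].
set l := `|ln y| in h yq lK *.
have K0 : 0 <= K.
  by rewrite addr_ge0 ?mulr_ge0// sumr_ge0.
have l1 : 1 <= l.
  by apply: le_trans lK; rewrite lerDr mulr_ge0// invr_ge0.
have l0 : 0 <= l by rewrite (le_trans ler01).
have hP : l * `|P.[ln y]| <= `|C| * q.+1`!%:R.
  apply: (@le_trans _ _ (`|C| * (y * l ^+ q.+1))); last by rewrite ler_wpM2l.
  rewrite exprS [y * _]mulrCA [_ * (l * _)]mulrCA ler_wpM2l//.
  rewrite (le_trans h)// expr1 ler_wpM2r ?ler_norm//.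
  by rewrite mulr_ge0 ?exprn_ge0// ltW.
have hc : `|P`_d| * l ^+ d * l <= K * l ^+ d.
  have -> : `|P`_d| * l ^+ d = `|P.[ln y] - \sum_(i < d) P`_i * ln y ^+ i|.
    by rewrite horner_coef dP big_ord_recr/= addrAC subrr add0r normrM normrX.
  rewrite mulrC; apply: (@le_trans _ _ (l * (`|P.[ln y]| + \sum_(i < d) `|P`_i| * l ^+ i))).
    rewrite ler_wpM2l// (le_trans (ler_normB _ _))// lerD2l.
    rewrite (le_trans (ler_norm_sum _ _ _))// ler_sum// => i _.
    by rewrite normrM normrX.
  rewrite mulrDr mulrDl lerD//.
    by rewrite (le_trans hP)// ler_peMr ?mulr_ge0// exprn_ege1.
  rewrite mulr_sumr mulr_suml ler_sum// => i _.
  rewrite mulrCA -exprS ler_wpM2l// ler_weXn2l//.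
move: hc; rewrite mulrAC ler_pM2r ?exprn_gt0 ?(lt_le_trans ltr01)//.
rewrite -ler_pdivlMl// => /(le_trans lK).
by rewrite gerDl ler10.
Qed.

(** By induction on n: once the lower coefficients vanish, division by y^n
    leaves the n-th coefficient with an error O(y), and [poly_log_eq0]
    applies. *)
Lemma horner2_coef0 N p : bigO N (fun y => p.[y, ln y]) ->
  forall n, (n < N)%N -> p`_n = 0.
Proof.
move=> h n; elim/ltn_ind: n => n ih nN.
have ihn k : (k < n)%N -> p`_k = 0.
  by move=> kn; apply: ih => //; exact: ltn_trans nN.
have {}h : bigO n.+1 (fun y => p.[y, ln y]) by exact: bigO_le h.
have h2 : bigO n.+1 (fun y => (p - (p`_n)%:P * 'X^n).[y, ln y]).
  apply: bigO_horner2 => k; rewrite ltnS coefB coefCM coefXn leq_eqVlt.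
  by case/orP => [/eqP->|kn]; rewrite ?eqxx ?mulr1 ?subrr// ltn_eqF// mulr0 ihn ?subr0.
apply: poly_log_eq0; have := bigOD h (bigOC (-1) h2).
move=> [q [C {}h]]; exists q, C; apply: filterS2 h (near_small ltr01).
move=> y h /andP[y0 _]; move: h.
rewrite mulN1r hornerD hornerN hornerM hornerC hornerXn.
rewrite -polyC_exp hornerD hornerN hornerM hornerC opprB addrC subrK.
rewrite normrM normrX (gtr0_norm y0) => h.
rewrite expr1 -(ler_pM2r (exprn_gt0 n y0)) (le_trans h)// exprS.
by rewrite le_eqVlt; apply/orP; left; apply/eqP; ring.
Qed.

(** In {poly {poly R}} the outer variable stands for y and the inner one for
    log y, so that s n is the coefficient, itself polynomial in log y, of
    y^n. *)
Definition asym u s := forall N,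
  bigO N (fun y => u y - (\poly_(n < N) s n).[y, ln y]).

Definition conv s t n : {poly R} := \sum_(j < n.+1) s j * t (n - j)%N.
(** The effect of y d/dy on a series: y d/dy (y^n P(log y)) = y^n (n P +
    P')(log y). *)
Definition theta s n : {poly R} := s n *+ n + (s n)^`().
Definition shift2 s n : {poly R} := if n is n'.+2 then s n' else 0.
Definition cser (c : R) n : {poly R} := if n == 0%N then c%:P else 0.

Lemma asym_gt0 u v s : (forall y, 0 < y -> u y = v y) -> asym u s -> asym v s.
Proof. by move=> uv h N; apply: bigO_gt0 (h N) => y /uv ->. Qed.

Lemma asym_ext u s t : (forall n, s n = t n) -> asym u s -> asym u t.
Proof.
move=> st h N; apply: bigO_gt0 (h N) => y _.
by congr (_ - _.[_].[_]); apply/polyP => n; rewrite !coef_poly st.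
Qed.

(** Uniqueness of expansions turns every identity between fields into
    identities between coefficients. *)
Lemma asym_unique u s t : asym u s -> asym u t -> forall n, s n = t n.
Proof.
move=> hs ht n; apply/eqP; rewrite -subr_eq0; apply/eqP.
have h : bigO n.+1 (fun y => (\poly_(k < n.+1) s k - \poly_(k < n.+1) t k).[y, ln y]).
  apply: bigO_gt0 (bigOD (ht n.+1) (bigOC (-1) (hs n.+1))) => y _.
  by rewrite !hornerD !hornerN; ring.
by have := horner2_coef0 h (ltnSn n); rewrite coefB !coef_poly ltnSn.
Qed.

Lemma asym_eq u v s t : asym u s -> asym v t -> (forall y, 0 < y -> u y = v y) ->
  forall n, s n = t n.
Proof. by move=> hs ht uv; apply: (asym_unique _ ht); exact: asym_gt0 hs. Qed.

Lemma asymD u v s t : asym u s -> asym v t ->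
  asym (fun y => u y + v y) (fun n => s n + t n).
Proof.
move=> hs ht N; apply: bigO_gt0 (bigOD (hs N) (ht N)) => y _.
have -> : \poly_(n < N) (s n + t n) = \poly_(n < N) s n + \poly_(n < N) t n.
  by apply/polyP => n; rewrite coefD !coef_poly; case: ifP; rewrite ?addr0.
by rewrite !hornerD; ring.
Qed.

Lemma asymZ (c : R) u s : asym u s -> asym (fun y => c * u y) (fun n => c *: s n).
Proof.
move=> hs N; apply: bigO_gt0 (bigOC c (hs N)) => y _.
have -> : \poly_(n < N) (c *: s n) = c%:P *: \poly_(n < N) s n.
  apply/polyP => n; rewrite coefZ !coef_poly; case: ifP; rewrite ?mulr0//.
  by rewrite -mul_polyC.
by rewrite hornerZ hornerM hornerC; ring.
Qed.

Lemma asymN u s : asym u s -> asym (fun y => - u y) (fun n => - s n).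
Proof.
move=> /(asymZ (-1)) h; apply: asym_gt0 (asym_ext _ h).
  by move=> y _; rewrite mulN1r.
by move=> n; rewrite scaleN1r.
Qed.

Lemma asymB u v s t : asym u s -> asym v t ->
  asym (fun y => u y - v y) (fun n => s n - t n).
Proof. by move=> hs /asymN; exact: asymD. Qed.

Lemma asym_sum m (F : 'I_m -> R -> R) (S : 'I_m -> nat -> {poly R}) :
  (forall i, asym (F i) (S i)) ->
  asym (fun y => \sum_i F i y) (fun n => \sum_i S i n).
Proof.
elim: m F S => [|m ih] F S h N.
  apply: bigO_gt0 (bigO0 _) => y _; rewrite big_ord0.
  have -> : \poly_(n < N) (\sum_i S i n) = 0.
    by apply/polyP => n; rewrite coef_poly big_ord0 coef0 if_same.
  by rewrite !horner0 subr0.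
have := asymD (ih _ _ (fun i => h (widen_ord (leqnSn m) i))) (h ord_max).
move=> h'; apply: (asym_gt0 _ (asym_ext _ h')).
  by move=> y _; rewrite big_ord_recr.
by move=> n; rewrite big_ord_recr.
Qed.

Lemma asym_cst (c : R) : asym (fun=> c) (cser c).
Proof.
case=> [|N].
  apply: bigO_gt0 (bigO_cst c) => y _.
  suff -> : \poly_(n < 0) cser c n = 0 by rewrite !horner0 subr0.
  by apply/polyP => n; rewrite coef_poly coef0.
apply: bigO_gt0 (bigO0 _) => y _.
suff -> : \poly_(n < N.+1) cser c n = c%:P%:P by rewrite !hornerC subrr.
apply/polyP => n; rewrite coef_poly coefC /cser.
by case: n => [|n] //=; rewrite if_same.
Qed.

Lemma asymM u v s t : asym u s -> asym v t ->
  asym (fun y => u y * v y) (conv s t).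
Proof.
move=> hs ht N.
pose S := \poly_(n < N) s n; pose T := \poly_(n < N) t n.
have bp (p : {poly {poly R}}) : bigO 0 (fun y => p.[y, ln y]) by exact: bigO_horner2.
have b1 : bigO N (fun y => (u y - S.[y, ln y]) * (v y - T.[y, ln y])).
  by apply: (@bigO_le (N + N)) (bigOM (hs N) (ht N)); rewrite leq_addr.
have b2 : bigO N (fun y => (u y - S.[y, ln y]) * T.[y, ln y]).
  by have := bigOM (hs N) (bp T); rewrite addn0.
have b3 := bigOM (bp S) (ht N); rewrite add0n in b3.
have b4 : bigO N (fun y => (S * T - \poly_(n < N) conv s t n).[y, ln y]).
  apply: bigO_horner2 => n nN; rewrite coefB coef_poly nN coefM.
  apply/eqP; rewrite subr_eq0; apply/eqP; apply: eq_bigr => j _.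
  rewrite !coef_poly (leq_ltn_trans (leq_subr _ _) nN).
  by rewrite (leq_ltn_trans _ nN)// -ltnS.
apply: bigO_gt0 (bigOD (bigOD b1 b2) (bigOD b3 b4)) => y _.
by rewrite !hornerD !hornerN !hornerM; ring.
Qed.

Definition ser1 s n : {poly R} := if n is n'.+1 then s n' else 0.

Lemma asym_y u s : asym u s -> asym (fun y => y * u y) (ser1 s).
Proof.
move=> hs [|N].
  apply: bigO_gt0 (bigO_le (leq0n 1) (bigOM bigO_y (hs 0%N))) => y _.
  by rewrite !horner_poly !big_ord0 !horner0 !subr0.
apply: bigO_gt0 (bigOM bigO_y (hs N)) => y _.
have -> : \poly_(n < N.+1) ser1 s n = 'X * \poly_(n < N) s n.
  by apply/polyP => n; rewrite coefXM !coef_poly; case: n.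
by rewrite hornerM hornerX hornerM hornerC; ring.
Qed.

Lemma asym_y2 u s : asym u s -> asym (fun y => y ^+ 2 * u y) (shift2 s).
Proof.
move=> /asym_y/asym_y h; apply: asym_gt0 (asym_ext _ h).
  by move=> y _; rewrite mulrA -expr2.
by case=> [|[|n]].
Qed.

End LogSeries.

(** * Linear algebra of the indicial operators *)

Definition i0 : 'I_3 := @Ordinal 3 0 isT.
Definition i1 : 'I_3 := @Ordinal 3 1 isT.
Definition i2 : 'I_3 := @Ordinal 3 2 isT.

(** Cyclic successors: with them the Levi-Civita symbol never has to be
    written, eps_(abc) x_b y_c being x (n1 a) y (n2 a) - x (n2 a) y (n1 a). *)
Definition n1 (a : 'I_3) : 'I_3 := match val a with 0 => i1 | 1 => i2 | _ => i0 end.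
Definition n2 (a : 'I_3) : 'I_3 := match val a with 0 => i2 | 1 => i0 | _ => i1 end.

Lemma ord3P (P : 'I_3 -> Prop) : P i0 -> P i1 -> P i2 -> forall a, P a.
Proof.
move=> h0 h1 h2 [[|[|[|//]]] h].
- by rewrite (_ : Ordinal h = i0)//; exact: val_inj.
- by rewrite (_ : Ordinal h = i1)//; exact: val_inj.
- by rewrite (_ : Ordinal h = i2)//; exact: val_inj.
Qed.

Lemma sum3 (V : nmodType) (F : 'I_3 -> V) : \sum_a F a = F i0 + F i1 + F i2.
Proof.
rewrite !big_ord_recr big_ord0 /= add0r.
by congr (F _ + F _ + F _); exact: val_inj.
Qed.

Definition cr {T : pzRingType} (u v : 'I_3 -> T) (c : 'I_3) : T :=
  u (n1 c) * v (n2 c) - u (n2 c) * v (n1 c).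

Section Indicial.
Context {R : realType}.
Implicit Types (p : {poly R}) (B S al U : 'I_3 -> 'I_3 -> {poly R})
  (f T : 'I_3 -> {poly R}) (n : nat).

(** P |-> c P + P' is c times a unipotent map, so with c <> 0 solving for P
    creates no logarithm; with c = 0 the solution gains one power of log y. *)
Lemma size_ode (c : R) p : c != 0 -> size (c%:P * p + p^`()) = size p.
Proof.
move=> c0; have [->|p0] := eqVneq p 0; first by rewrite deriv0 mulr0 addr0.
by rewrite size_polyDl mul_polyC size_scale// lt_size_deriv.
Qed.

Lemma size_deriv_le p k : (size p^`() <= k)%N -> (size p <= k.+1)%N.
Proof. by rewrite polyorder.size_deriv; case: (size p). Qed.

Definition trB B := B i0 i0 + B i1 i1 + B i2 i2.

(** The linear part of the equation of Psi at order n is diagonal on the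
    trace, the antisymmetric part and the traceless symmetric part, with
    eigenvalues n + 1, n and n - 2. *)
Lemma indicialB n B S :
  (forall a c, (n%:R - 1) * B a c + (B a c)^`() =
     B c a - (if a == c then trB B else 0) + S a c) ->
  [/\ (n%:R + 1) * trB B + (trB B)^`() = trB S,
      forall a c, n%:R * (B a c - B c a) + (B a c - B c a)^`() = S a c - S c a,
      forall a c, a != c ->
        (n%:R - 2) * (B a c + B c a) + (B a c + B c a)^`() = S a c + S c a &
      forall a c,
        (n%:R - 2) * (B a a - B c c) + (B a a - B c c)^`() = S a a - S c c].
Proof.
move=> h; split.
- have := h i0 i0; have := h i1 i1; have := h i2 i2; rewrite /= /trB !derivD.
  move=> /(canRL (addKr _))-> /(canRL (addKr _))-> /(canRL (addKr _))->.
  ring.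
- move=> a c; have := h a c; have := h c a; rewrite derivB.
  move=> /(canRL (addKr _))-> /(canRL (addKr _))->; rewrite eq_sym.
  case: ifP => _; ring.
- move=> a c /negbTE ac; have := h a c; have := h c a; rewrite derivD.
  rewrite [c == a]eq_sym ac.
  move=> /(canRL (addKr _))-> /(canRL (addKr _))->; ring.
- move=> a c; have := h a a; have := h c c; rewrite derivB.
  move=> /(canRL (addKr _))-> /(canRL (addKr _))->; rewrite !eqxx; ring.
Qed.

(** The axial vector of the antisymmetric part. *)
Definition vec al c := al (n1 c) (n2 c) - al (n2 c) (n1 c).

(** Likewise for A and phi_y together: eigenvalue n - 2 on the trace of A and
    on the combination vec A + phi_y, and n + 1 on the rest. *)
Lemma indicialA n al f U T :
  (forall a c, n%:R * al a c + (al a c)^`() =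
     cr f (fun d => (d == a)%:R) c + (if a == c then trB al else 0) - al c a
     + U a c) ->
  (forall c, n%:R * f c + (f c)^`() = vec al c + T c) ->
  [/\ (n%:R - 2) * trB al + (trB al)^`() = trB U,
      forall a c, a != c ->
        (n%:R + 1) * (al a c + al c a) + (al a c + al c a)^`() = U a c + U c a,
      forall a c,
        (n%:R + 1) * (al a a - al c c) + (al a a - al c c)^`() = U a a - U c c,
      forall c, (n%:R - 2) * (vec al c + f c) + (vec al c + f c)^`() =
        vec U c + T c &
      forall c, (n%:R + 1) * (vec al c - 2 * f c) + (vec al c - 2 * f c)^`() =
        vec U c - 2 * T c].
Proof.
move=> h hf; split.
- have := h i0 i0; have := h i1 i1; have := h i2 i2; rewrite /= /cr /trB !derivD /=.
  move=> /(canRL (addKr _))-> /(canRL (addKr _))-> /(canRL (addKr _))->.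
  ring.
- move=> a c ac; have := h a c; have := h c a; rewrite derivD.
  move=> /(canRL (addKr _))-> /(canRL (addKr _))->.
  rewrite [c == a]eq_sym (negbTE ac) /cr.
  move: a c ac; apply: ord3P; apply: ord3P => //= _; ring.
- move=> a c; have := h a a; have := h c c; rewrite derivB.
  move=> /(canRL (addKr _))-> /(canRL (addKr _))->; rewrite !eqxx /cr.
  move: a c; apply: ord3P; apply: ord3P => /=; ring.
- move=> c; have := hf c; have := h (n1 c) (n2 c); have := h (n2 c) (n1 c).
  rewrite /vec derivD derivB.
  move=> /(canRL (addKr _))-> /(canRL (addKr _))-> /(canRL (addKr _))->.
  by move: c; rewrite /vec /cr; apply: ord3P => /=; ring.
- move=> c; have := hf c; have := h (n1 c) (n2 c); have := h (n2 c) (n1 c).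
  rewrite /vec derivB derivB derivM (_ : 2%:R^`() = 0) ?mul0r ?add0r; last first.
    by rewrite -polyC_natr derivC.
  move=> /(canRL (addKr _))-> /(canRL (addKr _))-> /(canRL (addKr _))->.
  by move: c; rewrite /vec /cr; apply: ord3P => /=; ring.
Qed.

(** ** Coefficients of a given weight *)

Variable D : nat -> nat.
Hypothesis DD : forall j k, (D j + D k <= D (j + k))%N.

(** The condition propagated by the recursion at the power y^n: odd powers
    are absent, and log y occurs to a power at most D n. As D is
    superadditive, the condition passes to products. *)
Definition good n p := (odd n -> p = 0) /\ (size p <= (D n).+1)%N.

Lemma good0 n : good n 0.
Proof. by split => //; rewrite size_poly0. Qed.

Lemma goodD n p q : good n p -> good n q -> good n (p + q).
Proof.
move=> [p0 sp] [q0 sq]; split=> [on|]; first by rewrite p0// q0// addr0.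
by rewrite (leq_trans (size_polyD _ _))// geq_max sp.
Qed.

Lemma goodC n c p : good n p -> good n (c%:P * p).
Proof.
move=> [p0 sp]; split=> [on|]; first by rewrite p0// mulr0.
by rewrite mul_polyC (leq_trans (size_scale_leq _ _)).
Qed.

Lemma goodN n p : good n p -> good n (- p).
Proof. by rewrite -mulN1r -polyCN; exact: goodC. Qed.

Lemma goodB n p q : good n p -> good n q -> good n (p - q).
Proof. by move=> hp /goodN; exact: goodD. Qed.

Lemma good_sum n m (F : 'I_m -> {poly R}) :
  (forall i, good n (F i)) -> good n (\sum_i F i).
Proof. by move=> h; elim/big_ind: _ => //; [exact: good0|move=> *; exact: goodD]. Qed.

Lemma goodZ n c p : good n p -> good n (c *: p).
Proof. by rewrite -mul_polyC; exact: goodC. Qed.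

Lemma goodM j k p q : good j p -> good k q -> good (j + k) (p * q).
Proof.
move=> [p0 sp] [q0 sq]; split.
  rewrite oddD; case: (boolP (odd j)) => [/p0 -> _|_ /q0 ->]; first by rewrite mul0r.
  by rewrite mulr0.
apply: (leq_trans (size_polyMleq _ _)).
have := leq_add sp sq; rewrite addSn addnS; case: (_ + _)%N => //= m.
by rewrite ltnS => h; rewrite (leq_trans h)// ltnS.
Qed.

Lemma good_ode (c : R) n p : c != 0 -> good n (c%:P * p + p^`()) -> good n p.
Proof.
move=> c0 [h0 hs]; split=> [/h0 h|]; last by rewrite -(size_ode p c0).
by apply/eqP; rewrite -size_poly_eq0 -(size_ode p c0) h size_poly0.
Qed.

Lemma good_half n p q : good n (p + q) -> good n (p - q) -> good n p /\ good n q.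
Proof.
move=> hp hm.
have e : (2^-1 : R)%:P * 2 = 1 by rewrite -polyC_natr -polyCM mulVf ?pnatr_eq0.
split.
  have -> : p = (2^-1)%:P * ((p + q) + (p - q)).
    by rewrite (_ : _ + _ + _ = 2 * p) ?mulrA ?e ?mul1r//; ring.
  exact/goodC/goodD.
have -> : q = (2^-1)%:P * ((p + q) - (p - q)).
  by rewrite (_ : _ + _ - _ = 2 * q) ?mulrA ?e ?mul1r//; ring.
exact/goodC/goodB.
Qed.

(** A matrix is recovered from its trace and from the combinations below. *)
Lemma good_matrix n B : good n (trB B) ->
  (forall a c, a != c -> good n (B a c + B c a)) ->
  (forall a c, good n (B a c - B c a)) ->
  (forall a c, good n (B a a - B c c)) -> forall a c, good n (B a c).
Proof.
move=> ht hs ha hd a c; have [<-|ac] := eqVneq a c; last first.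
  by have [] := good_half (hs a c ac) (ha a c).
have e : (3^-1 : R)%:P * 3 = 1 by rewrite -polyC_natr -polyCM mulVf ?pnatr_eq0.
have -> : B a a = (3^-1)%:P * (trB B + ((B a a - B i0 i0) + (B a a - B i1 i1) +
   (B a a - B i2 i2))).
  by rewrite (_ : trB B + _ = 3 * B a a) ?mulrA ?e ?mul1r// /trB; ring.
by apply: goodC; apply: goodD => //; apply: goodD => //; apply: goodD.
Qed.

Lemma natr_polyC n : n%:R = (n%:R : R)%:P :> {poly R}.
Proof. by rewrite polyC_natr. Qed.

(** For n <> 2 none of the eigenvalues n + 1, n, n - 2 vanishes. *)
Lemma good_indicialB n B S : (0 < n)%N -> n != 2%N ->
  (forall a c, (n%:R - 1) * B a c + (B a c)^`() =
     B c a - (if a == c then trB B else 0) + S a c) ->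
  (forall a c, good n (S a c)) -> forall a c, good n (B a c).
Proof.
move=> n0 n2 /indicialB[h1 h2 h3 h4] hS.
have e1 : n%:R + 1 = ((n%:R + 1) : R)%:P :> {poly R} by rewrite polyCD polyC_natr.
have e2 : n%:R - 2 = ((n%:R - 2) : R)%:P :> {poly R} by rewrite polyCB !polyC_natr.
have c1 : n%:R + 1 != 0 :> R by rewrite natr1 pnatr_eq0.
have c2 : n%:R - 2 != 0 :> R by rewrite subr_eq0 eqr_nat.
have c3 : n%:R != 0 :> R by rewrite pnatr_eq0 -lt0n.
apply: good_matrix.
- by apply: (good_ode c1); rewrite -e1 h1; do 2?apply: goodD.
- by move=> a c ac; apply: (good_ode c2); rewrite -e2 h3//; apply: goodD.
- by move=> a c; apply: (good_ode c3); rewrite polyC_natr h2; apply: goodB.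
- by move=> a c; apply: (good_ode c2); rewrite -e2 h4; apply: goodB.
Qed.

(** At n = 2 the trace and the combination [vec al + f] are resonant: there the
    power of log y rises by one when an equation is solved, so the sources of
    these components must have one power to spare. *)
Lemma good_indicialA n al f U T : (0 < n)%N ->
  (forall a c, n%:R * al a c + (al a c)^`() =
     cr f (fun d => (d == a)%:R) c + (if a == c then trB al else 0) - al c a
     + U a c) ->
  (forall c, n%:R * f c + (f c)^`() = vec al c + T c) ->
  (forall a c, good n (U a c)) -> (forall c, good n (T c)) ->
  (n = 2%N -> (size (trB U) <= D 2)%N /\
     forall c, (size (vec U c + T c)%R <= D 2)%N) ->
  (forall a c, good n (al a c)) /\ forall c, good n (f c).
Proof.
move=> n0 h hf hU hT h2; have [h1 h3 h4 h5 h6] := indicialA h hf.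
have e1 : n%:R + 1 = ((n%:R + 1) : R)%:P :> {poly R} by rewrite polyCD polyC_natr.
have e2 : n%:R - 2 = ((n%:R - 2) : R)%:P :> {poly R} by rewrite polyCB !polyC_natr.
have c1 : n%:R + 1 != 0 :> R by rewrite natr1 pnatr_eq0.
have hvU c : good n (vec U c) by exact: goodB.
have res p s : (n%:R - 2) * p + p^`() = s -> good n s ->
    (n = 2%N -> (size s <= D 2)%N) -> good n p.
  have [n2 hp _ hs|n2 hp hs _] := eqVneq n 2; last first.
    by apply: (@good_ode (n%:R - 2)); rewrite -?e2 ?hp// subr_eq0 eqr_nat.
  subst n; split => //; apply: size_deriv_le.
  by move: hp; rewrite subrr mul0r add0r => ->; exact: hs.
have ht : good n (trB al).
  by apply: (res _ _ h1); [do 2?apply: goodD|move=> /h2[]].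
have hp c : good n (vec al c + f c).
  by apply: (res _ _ (h5 c)); [exact: goodD|move=> /h2[_ +]; exact].
have hm c : good n (vec al c - 2 * f c).
  apply: (good_ode c1); rewrite -e1 h6; apply: goodB => //.
  by rewrite natr_polyC; exact: goodC.
have e : (3^-1 : R)%:P * 3 = 1 by rewrite natr_polyC -polyCM mulVf ?pnatr_eq0.
have gf c : good n (f c).
  have -> : f c = (3^-1)%:P * ((vec al c + f c) - (vec al c - 2 * f c)).
    by rewrite (_ : _ + _ - _ = 3 * f c) ?mulrA ?e ?mul1r//; ring.
  exact/goodC/goodB.
have gv c : good n (vec al c).
  by have := goodB (hp c) (gf c); rewrite addrK.
split => //; apply: good_matrix => //.
- by move=> a c ac; apply: (good_ode c1); rewrite -e1 h3//; apply: goodD.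
- move=> a c; have hz : good n 0 := good0 n.
  have := gv i0; have := gv i1; have := gv i2; rewrite /vec /=.
  move: a c; apply: ord3P; apply: ord3P; rewrite ?subrr//= => g2 g1 g0 //;
    by rewrite -opprB; exact: goodN.
- by move=> a c; apply: (good_ode c1); rewrite -e1 h4; apply: goodB.
Qed.

End Indicial.

(** * The equations in an orthonormal frame, order by order *)

Section Frame.
Context {R : realType}.

(** The expansions of A, of Psi = y phi and of phi_y in the orthonormal frame
    that the vierbein maps to the standard basis of the Lie algebra, whence
    [initPsi] below. The coefficients of their first x-derivatives enter the
    equations at a point as independent data. *)
Record frame_series := FrameSeries {
  sA : 'I_3 -> 'I_3 -> nat -> {poly R};
  sPsi : 'I_3 -> 'I_3 -> nat -> {poly R};
  sf : 'I_3 -> nat -> {poly R};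
  dsA : 'I_3 -> 'I_3 -> 'I_3 -> nat -> {poly R};
  dsPsi : 'I_3 -> 'I_3 -> 'I_3 -> nat -> {poly R};
  dsf : 'I_3 -> 'I_3 -> nat -> {poly R} }.

Definition crs (S T : 'I_3 -> nat -> {poly R}) (c : 'I_3) (n : nat) : {poly R} :=
  conv (S (n1 c)) (T (n2 c)) n - conv (S (n2 c)) (T (n1 c)) n.

(** The Kapustin-Witten equations multiplied by a power of y, so that only y
    d/dy occurs: y d_y A, y^2 d_y phi and y d_y phi_y in terms of the rest.
    The sign sg compares the orientation of the vierbein with that of X; kap
    is the first-order coefficient of the codifferential. *)
Record frame_eqs (sg : R) (kap : 'I_3 -> R) (F : frame_series) : Prop := FrameEqs {
  eqA : forall n a c, theta (sA F a c) n = crs (sf F) (sPsi F a) c n +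
    sg *: (dsPsi F (n1 a) (n2 a) c n - dsPsi F (n2 a) (n1 a) c n +
           (crs (sA F (n1 a)) (sPsi F (n2 a)) c n
            - crs (sA F (n2 a)) (sPsi F (n1 a)) c n));
  eqPsi : forall n a c, theta (sPsi F a c) n - sPsi F a c n =
    shift2 (fun m => dsf F a c m + crs (sA F a) (sf F) c m) n +
    sg *: (shift2 (fun m => dsA F (n1 a) (n2 a) c m - dsA F (n2 a) (n1 a) c m
                            + crs (sA F (n1 a)) (sA F (n2 a)) c m) n
           - crs (sPsi F (n1 a)) (sPsi F (n2 a)) c n);
  eqf : forall n c, theta (sf F c) n =
    - \sum_a (dsPsi F a a c n + crs (sA F a) (sPsi F a) c n
              + kap a *: sPsi F a c n) }.

Record frame_init (w : 'I_3 -> 'I_3 -> R) (dw de : 'I_3 -> 'I_3 -> 'I_3 -> R)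
  (F : frame_series) : Prop := FrameInit {
  initA : forall a c, sA F a c 0%N = (w a c)%:P;
  initPsi : forall a c, sPsi F a c 0%N = (a == c)%:R;
  initf : forall c, sf F c 0%N = 0;
  initdA : forall b a c, dsA F b a c 0%N = (dw b a c)%:P;
  initdPsi : forall b a c, dsPsi F b a c 0%N = (de b a c)%:P;
  initdf : forall b c, dsf F b c 0%N = 0 }.

Lemma conv0 (s t : nat -> {poly R}) : conv s t 0 = s 0%N * t 0%N.
Proof. by rewrite /conv big_ord1 subnn. Qed.

Lemma theta0 (s : nat -> {poly R}) : theta s 0 = (s 0%N)^`().
Proof. by rewrite /theta mulr0n add0r. Qed.

Definition delta (a c : 'I_3) : R := (a == c)%:R.

(** The covariant derivative of the vierbein in its own frame. *)
Definition gam (w : 'I_3 -> 'I_3 -> R) (de : 'I_3 -> 'I_3 -> 'I_3 -> R) b a c : R :=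
  de b a c + cr (w b) (delta a) c.

Section Order0.
Variables (sg : R) (kap : 'I_3 -> R) (F : frame_series).
Variables (w : 'I_3 -> 'I_3 -> R) (dw de : 'I_3 -> 'I_3 -> 'I_3 -> R).
Hypothesis heq : frame_eqs sg kap F.
Hypothesis hini : frame_init w dw de F.

(** The y^-2 terms of the equations hold only if the vierbein is positively
    oriented. *)
Lemma orientation : sg = 1.
Proof.
have := eqPsi heq 0 i0 i0; rewrite theta0 /crs !conv0 !(initPsi hini) /=.
rewrite -[1%:R]/1 -[0%:R]/(0 : {poly R}) derivC !mul0r !subr0 mulr1 sub0r add0r.
move=> /(congr1 (fun p : {poly R} => p`_0)); rewrite coefZ coefN coefC/=.
by rewrite mulrN1 => /oppr_inj.
Qed.

Lemma polyC_natb (b : bool) : b%:R = (b%:R : R)%:P :> {poly R}.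
Proof. by case: b. Qed.

(** The leading order of the equation of A is the first structure equation d
    e + w /\ e = 0. *)
Lemma torsion_free b a c : sg = 1 -> gam w de b a c = gam w de a b c.
Proof.
move=> sg1.
have h x y : gam w de (n1 x) (n2 x) y = gam w de (n2 x) (n1 x) y.
  have := eqA heq 0 x y; rewrite theta0 (initA hini) derivC sg1 scale1r /crs.
  rewrite !conv0 !(initPsi hini) !(initf hini) !(initA hini) !(initdPsi hini).
  rewrite !mul0r subr0 add0r !polyC_natb => /esym h.
  apply/eqP; rewrite -subr_eq0 -polyC_eq0 -{}h /gam /cr /delta.
  by rewrite !(polyCD, polyCB, polyCM, polyCN); apply/eqP; ring.
move: b a; apply: ord3P; apply: ord3P => //.
- exact: (h i2 c).
- by rewrite -(h i1 c).
- by rewrite -(h i2 c).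
- exact: (h i0 c).
- exact: (h i1 c).
- by rewrite -(h i0 c).
Qed.

(** The leading order of the divergence equation. *)
Lemma kap_gam c : kap c = - \sum_a gam w de a a c.
Proof.
have := eqf heq 0 c; rewrite theta0 (initf hini) deriv0 => /esym/eqP.
rewrite oppr_eq0 !sum3 /crs !conv0 !(initPsi hini) !(initA hini) !(initdPsi hini).
rewrite !polyC_natb -!mul_polyC => /eqP h.
apply/eqP; rewrite -addr_eq0 -polyC_eq0 -{}h /gam /cr /delta; apply/eqP.
by move: c; apply: ord3P => /=; rewrite !(polyCD, polyCB, polyCM, polyCN); ring.
Qed.

End Order0.

(** What is needed of a coefficient of the second order for its curl and
    divergence not to meet the resonance: it is symmetric, and its trace is
    constant to first order. *)
Record trace_const (w : 'I_3 -> 'I_3 -> R) (de : 'I_3 -> 'I_3 -> 'I_3 -> R)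
  (be : 'I_3 -> 'I_3 -> R) (dbe : 'I_3 -> 'I_3 -> 'I_3 -> R) : Prop := TraceConst {
  tc_sym : forall a c, be a c = be c a;
  tc_dsym : forall b a c,
    dbe b a c + cr (w b) (be a) c + \sum_d be a d * gam w de b c d =
    dbe b c a + cr (w b) (be c) a + \sum_d be c d * gam w de b a d;
  tc_dtr : forall b, \sum_c (dbe b c c + cr (w b) (be c) c) =
    \sum_c \sum_d gam w de b c d * be d c }.

Definition curl (D : 'I_3 -> 'I_3 -> 'I_3 -> R) a c :=
  D (n1 a) (n2 a) c - D (n2 a) (n1 a) c.

(** The trace of the curl of a symmetric tensor vanishes, and the axial
    vector of the curl is the divergence minus the gradient of the trace.
    These are exactly the two combinations on which the equations of A and
    phi_y degenerate at n = 2, so at that order no new logarithm is created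
    there. *)
Lemma no_resonance w de be dbe kap : trace_const w de be dbe ->
  (forall b a c, gam w de b a c = gam w de a b c) ->
  (forall c, kap c = - \sum_a gam w de a a c) ->
  let D b a c := dbe b a c + cr (w b) (be a) c in
  curl D i0 i0 + curl D i1 i1 + curl D i2 i2 = 0 /\
  forall c, curl D (n1 c) (n2 c) - curl D (n2 c) (n1 c)
    - \sum_a (D a a c + kap a * be a c) = 0.
Proof.
move=> [hs hds htr] hg hk D.
have {}hds b a c : D b a c + \sum_d be a d * gam w de b c d =
  D b c a + \sum_d be c d * gam w de b a d by exact: hds.
have {}htr b : \sum_c D b c c = \sum_c \sum_d gam w de b c d * be d c by exact: htr.
move: (gam w de) hg hk hds htr => g hg hk hds htr.
split.
  have := hds i0 i1 i2; have := hds i1 i2 i0; have := hds i2 i0 i1.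
  rewrite !sum3 /curl /=.
  rewrite (hs i1 i0) (hs i2 i0) (hs i2 i1) ?(hg i1 i0) ?(hg i2 i0) ?(hg i2 i1).
  by move=> h1 h2 h3; lra.
apply: ord3P; rewrite /curl /n1 /n2 /= sum3 !hk !sum3.
- have := htr i0; have := hds i1 i0 i1; have := hds i2 i0 i2; rewrite !sum3 /=.
  rewrite (hs i1 i0) (hs i2 i0) (hs i2 i1) ?(hg i1 i0) ?(hg i2 i0) ?(hg i2 i1).
  by move=> h1 h2 h3; lra.
- have := htr i1; have := hds i0 i1 i0; have := hds i2 i1 i2; rewrite !sum3 /=.
  rewrite (hs i1 i0) (hs i2 i0) (hs i2 i1) ?(hg i1 i0) ?(hg i2 i0) ?(hg i2 i1).
  by move=> h1 h2 h3; lra.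
- have := htr i2; have := hds i0 i2 i0; have := hds i1 i2 i1; rewrite !sum3 /=.
  rewrite (hs i1 i0) (hs i2 i0) (hs i2 i1) ?(hg i1 i0) ?(hg i2 i0) ?(hg i2 i1).
  by move=> h1 h2 h3; lra.
Qed.

(** ** One step of the recursion *)

Variable D : nat -> nat.
Hypothesis DD : forall j k, (D j + D k <= D (j + k))%N.

(** The part of the Cauchy product at order n that involves only orders
    strictly between 0 and n, hence is known in the recursion. *)
Definition mid (s t : nat -> {poly R}) n := \sum_(j < n.-1) s j.+1 * t (n - j.+1)%N.

Lemma conv_mid (s t : nat -> {poly R}) n : (0 < n)%N ->
  conv s t n = s 0%N * t n + s n * t 0%N + mid s t n.
Proof.
case: n => // n _; rewrite /conv /mid big_ord_recl big_ord_recr /= subn0 subnn.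
by rewrite [X in _ + X]addrC addrA.
Qed.

Lemma good_mid (s t : nat -> {poly R}) n : (forall k, (0 < k < n)%N -> good D k (s k)) ->
  (forall k, (0 < k < n)%N -> good D k (t k)) -> good D n (mid s t n).
Proof.
case: n => [|n] hs ht; first by rewrite /mid big_ord0; exact: good0.
apply: good_sum => j; have jn : (j.+1 < n.+1)%N by rewrite ltnS.
rewrite -[X in good D X](subnKC jn) addSnnS -subSn// subSS.
apply: goodM => //; first exact: hs.
by apply: ht; rewrite subn_gt0 jn ltn_subrL.
Qed.

Lemma good_shift2 (s : nat -> {poly R}) n : (forall k, (k < n)%N -> good D k (s k)) ->
  good D n (shift2 s n).
Proof.
case: n => [|[|n]] h; [exact: good0..|rewrite /shift2].
have [h0 hs] := h n (leqW (leqnn _)); split => [|]; first by rewrite /= negbK.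
by rewrite (leq_trans hs)// ltnS -addn2 (leq_trans _ (DD n 2))// leq_addr.
Qed.

Definition crmid (S T : 'I_3 -> nat -> {poly R}) (c : 'I_3) n :=
  mid (S (n1 c)) (T (n2 c)) n - mid (S (n2 c)) (T (n1 c)) n.

Lemma crs_mid S T c n : (0 < n)%N -> crs S T c n =
  cr (fun d => S d 0%N) (fun d => T d n) c
  + cr (fun d => S d n) (fun d => T d 0%N) c + crmid S T c n.
Proof. by move=> n0; rewrite /crs /cr /crmid !conv_mid//; ring. Qed.

Lemma good_crmid S T c n : (forall d k, (0 < k < n)%N -> good D k (S d k)) ->
  (forall d k, (0 < k < n)%N -> good D k (T d k)) -> good D n (crmid S T c n).
Proof. by move=> hS hT; apply: goodB; apply: good_mid => k; solve [exact: hS|exact: hT]. Qed.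

Lemma good_conv (s t : nat -> {poly R}) n : (forall k, (k <= n)%N -> good D k (s k)) ->
  (forall k, (k <= n)%N -> good D k (t k)) -> good D n (conv s t n).
Proof.
move=> hs ht; apply: good_sum => j; have jn : (j <= n)%N by rewrite -ltnS.
by rewrite -[X in good D X](subnKC jn); apply: goodM => //; [exact: hs|
  apply: ht; exact: leq_subr].
Qed.

Lemma good_crs S T c n : (forall d k, (k <= n)%N -> good D k (S d k)) ->
  (forall d k, (k <= n)%N -> good D k (T d k)) -> good D n (crs S T c n).
Proof. by move=> hS hT; apply: goodB; apply: good_conv => k; solve [exact: hS|exact: hT]. Qed.

(** The derivatives of Psi are absent: they are needed at order n itself,
    which is possible because Psi is found before A and phi_y at each order. *)
Record good_upto n (F : frame_series) : Prop := GoodUpto {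
  gA : forall a c k, (k < n)%N -> good D k (sA F a c k);
  gPsi : forall a c k, (k < n)%N -> good D k (sPsi F a c k);
  gf : forall c k, (k < n)%N -> good D k (sf F c k);
  gdA : forall b a c k, (k < n)%N -> good D k (dsA F b a c k);
  gdf : forall b c k, (k < n)%N -> good D k (dsf F b c k) }.

Section Step.
Variables (kap : 'I_3 -> R) (F : frame_series).
Variables (w : 'I_3 -> 'I_3 -> R) (dw de : 'I_3 -> 'I_3 -> 'I_3 -> R).
Hypothesis heq : frame_eqs 1 kap F.
Hypothesis hini : frame_init w dw de F.

(** The part of order n of the equation of Psi that comes from lower orders. *)
Definition srcPsi n a c : {poly R} :=
  shift2 (fun m => dsf F a c m + crs (sA F a) (sf F) c m) n +
  shift2 (fun m => dsA F (n1 a) (n2 a) c m - dsA F (n2 a) (n1 a) c m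
                   + crs (sA F (n1 a)) (sA F (n2 a)) c m) n
  - crmid (sPsi F (n1 a)) (sPsi F (n2 a)) c n.

Lemma linearPsi n a c : (0 < n)%N ->
  (n%:R - 1) * sPsi F a c n + (sPsi F a c n)^`() =
  sPsi F c a n - (if a == c then trB (fun a c => sPsi F a c n) else 0)
  + srcPsi n a c.
Proof.
move=> n0; have := eqPsi heq n a c; rewrite scale1r crs_mid// /theta /srcPsi.
rewrite -[_ *+ n]mulr_natl => /(canRL (subrK _)) h.
rewrite mulrBl mul1r addrAC h.
rewrite /cr /trB !(initPsi hini); clear h.
by move: a c; apply: ord3P; apply: ord3P => /=; ring.
Qed.

Lemma good_srcPsi n a c : good_upto n F -> good D n (srcPsi n a c).
Proof.
case=> hA hP hf hdA hdf; apply: goodB; first apply: goodD.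
- apply: good_shift2 => k kn; apply: goodD; first exact: hdf.
  by apply: good_crs => d j jk; [apply: hA|apply: hf]; exact: leq_ltn_trans kn.
- apply: good_shift2 => k kn; apply: goodD; first by apply: goodB; exact: hdA.
  by apply: good_crs => d j jk; apply: hA; exact: leq_ltn_trans kn.
- by apply: good_crmid => d k /andP[_ kn]; exact: hP.
Qed.

Lemma stepPsi n : (0 < n)%N -> n != 2%N -> good_upto n F ->
  forall a c, good D n (sPsi F a c n).
Proof.
move=> n0 n2 hn; apply: (good_indicialB n0 n2 (S := srcPsi n)).
  by move=> a c; exact: linearPsi.
by move=> a c; exact: good_srcPsi.
Qed.

Definition srcA n a c : {poly R} :=
  crmid (sf F) (sPsi F a) c n
  + (dsPsi F (n1 a) (n2 a) c n - dsPsi F (n2 a) (n1 a) c n)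
  + (cr (fun d => (w (n1 a) d)%:P) (fun d => sPsi F (n2 a) d n) c
     - cr (fun d => (w (n2 a) d)%:P) (fun d => sPsi F (n1 a) d n) c)
  + (crmid (sA F (n1 a)) (sPsi F (n2 a)) c n
     - crmid (sA F (n2 a)) (sPsi F (n1 a)) c n).

Definition srcf n c : {poly R} :=
  - \sum_a (dsPsi F a a c n
             + cr (fun d => (w a d)%:P) (fun d => sPsi F a d n) c
             + crmid (sA F a) (sPsi F a) c n + kap a *: sPsi F a c n).

Lemma linearA n a c : (0 < n)%N ->
  n%:R * sA F a c n + (sA F a c n)^`() =
  cr (fun d => sf F d n) (fun d => (d == a)%:R) c
  + (if a == c then trB (fun a c => sA F a c n) else 0) - sA F c a n
  + srcA n a c.
Proof.
move=> n0; have := eqA heq n a c; rewrite scale1r !crs_mid// /theta /srcA.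
rewrite -[_ *+ n]mulr_natl => ->.
rewrite /cr /trB !(initPsi hini) !(initA hini) !(initf hini).
by move: a c; apply: ord3P; apply: ord3P => /=; ring.
Qed.

Lemma linearf n c : (0 < n)%N ->
  n%:R * sf F c n + (sf F c n)^`() = vec (fun a c => sA F a c n) c + srcf n c.
Proof.
move=> n0; have := eqf heq n c; rewrite /theta /srcf -[_ *+ n]mulr_natl => ->.
rewrite !sum3 !crs_mid//.
rewrite /cr /vec !(initPsi hini) !(initA hini).
by move: c; apply: ord3P => /=; ring.
Qed.

(** At n = 2 the products of terms of order 1 vanish, and the top power of
    log y in the two resonant components of the source has for coefficient
    the two combinations of [no_resonance], formed with the top coefficient
    of Psi. So these components have one power of log y to spare, as
    [good_indicialA] asks. *)
Lemma stepA n : (0 < n)%N -> good_upto n F ->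
  (forall a c, good D n (sPsi F a c n)) ->
  (forall b a c, good D n (dsPsi F b a c n)) ->
  (n = 2%N -> D 1 = 0%N /\ forall p, p = D 2 ->
     trace_const w de (fun a c => (sPsi F a c 2)`_p)
                      (fun b a c => (dsPsi F b a c 2)`_p)) ->
  (forall a c, good D n (sA F a c n)) /\ forall c, good D n (sf F c n).
Proof.
move=> n0 hn hP hdP htc; have [hA hPk hf hdA hdf] := hn.
have pos k m : (0 < k < m)%N -> (k < m)%N by case/andP.
have gcrw a d c : good D n (cr (fun d => (w a d)%:P) (fun c => sPsi F d c n) c).
  by apply: goodB; exact: goodC.
have gU a c : good D n (srcA n a c).
  apply: goodD; first apply: goodD; first apply: goodD.
  - by apply: good_crmid => d k /pos; [exact: hf|exact: hPk].
  - exact: goodB.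
  - exact: goodB.
  - by apply: goodB; apply: good_crmid => d k /pos; solve [exact: hA|exact: hPk].
have gT c : good D n (srcf n c).
  apply: goodN; apply: good_sum => a; apply: goodD; last exact: goodZ.
  apply: goodD; first exact: goodD.
  by apply: good_crmid => d k /pos; [exact: hA|exact: hPk].
apply: (good_indicialA n0 (U := srcA n) (T := srcf n)) => //.
- by move=> a c; exact: linearA.
- by move=> c; exact: linearf.
move=> nE; have [D1 {}htc] := htc nE.
have odd1 (p : {poly R}) : good D 1 p -> p = 0 by case=> /(_ isT).
have lt12 : (1 < n)%N by rewrite nE.
have mid0 S T c : (forall d, S d 1%N = 0) -> crmid S T c n = 0.
  by move=> S0; rewrite nE /crmid /mid !big_ord1 !S0 !mul0r subrr.
have A1 a d : sA F a d 1%N = 0 by apply: odd1; exact: hA.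
have f1 d : sf F d 1%N = 0 by apply: odd1; exact: hf.
have {}htc := htc _ erefl.
have [r1 r2] := no_resonance htc (fun b a c => torsion_free heq hini b a c erefl)
  (kap_gam heq hini).
have drop (p : {poly R}) : good D n p -> p`_(D 2) = 0 -> (size p <= D 2)%N.
  rewrite nE; case=> _ sp p0; rewrite -ltnS in sp *.
  move: sp; rewrite ltnS leq_eqVlt => /orP[/eqP sp|//].
  have := lead_coef_eq0 p; rewrite lead_coefE sp /= p0 eqxx => /esym/eqP pz.
  by move: sp; rewrite pz size_poly0.
have coefsrc a c : (srcA n a c)`_(D 2) =
  curl (fun b a c => (dsPsi F b a c 2)`_(D 2) +
    cr (w b) (fun d => (sPsi F a d 2)`_(D 2)) c) a c.
  rewrite /srcA !mid0// nE add0r subr0 addr0 /curl /cr.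
  by rewrite !(coefD, coefN, coefCM); ring.
split.
  by apply: drop; [apply: goodD => //; exact: goodD|rewrite /trB coefD (coefD (srcA n i0 i0)) !coefsrc].
move=> c; apply: drop; first by apply: goodD => //; exact: goodB.
rewrite coefD /vec coefB !coefsrc -[RHS](r2 c); congr (_ + _).
rewrite /srcf coefN; congr (- _); rewrite !sum3 !mid0// nE /cr.
by rewrite !(coefD, coefN, coefCM, coefZ, coef0); ring.
Qed.

(** ** The second order *)

(* The Hodge dual of the curvature of w. *)
Definition curvF a c : R := dw (n1 a) (n2 a) c - dw (n2 a) (n1 a) c
  + cr (w (n1 a)) (w (n2 a)) c.

Section Order2.
Hypothesis Psi1 : forall a c, sPsi F a c 1%N = 0.

Lemma srcPsi2 a c : srcPsi 2 a c = (curvF a c)%:P.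
Proof.
rewrite /srcPsi /shift2 /crmid /mid !big_ord1 !Psi1 !mul0r subrr subr0.
rewrite /crs !conv0 !(initf hini) !(initA hini) !(initdA hini) (initdf hini).
by rewrite !mulr0 /curvF /cr !(polyCD, polyCB, polyCM); ring.
Qed.

Let ind2 := @indicialB _ 2 (fun a c => sPsi F a c 2) (srcPsi 2)
  (fun a c => linearPsi a c (isT : (0 < 2)%N)).

Let size_polyC1 (c : R) : (size c%:P <= 1)%N.
Proof. by rewrite size_polyC leq_b1. Qed.

Let three : (2%:R + 1 : {poly R}) = (3%:R)%:P.
Proof. by rewrite polyC_natr natr1. Qed.

Let size_tr : (size (trB (fun a c => sPsi F a c 2)) <= 1)%N.
Proof.
have [h1 _ _ _] := ind2.
have c3 : (3%:R : R) != 0 by rewrite pnatr_eq0.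
rewrite -(size_ode _ c3) -three h1 /trB !srcPsi2.
by rewrite -!polyCD size_polyC1.
Qed.

(** With Psi_1 = 0 the source of Psi_2 is the curvature of w, free of log y.
    The nonresonant parts, trace and antisymmetric part, are then free of log
    y too, and the traceless symmetric part is linear in log y. *)
Lemma order2_log :
  [/\ forall a c, (size (sPsi F a c 2) <= 2)%N,
      forall a c, (sPsi F a c 2)`_1 = (sPsi F c a 2)`_1 &
      (sPsi F i0 i0 2)`_1 + (sPsi F i1 i1 2)`_1 + (sPsi F i2 i2 2)`_1 = 0].
Proof.
have [h1 h2 h3 h4] := ind2.
have c2 : (2%:R : R) != 0 by rewrite pnatr_eq0.
have anti a c : (size (sPsi F a c 2 - sPsi F c a 2)%R <= 1)%N.
  by rewrite -(size_ode _ c2) polyC_natr h2 !srcPsi2 -polyCB size_polyC1.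
split.
- move=> a c; suff [_ +] : good (fun=> 1%N) 2 (sPsi F a c 2) by [].
  move: a c; apply: (@good_matrix _ (fun=> 1%N) 2 (fun a c => sPsi F a c 2)).
  + by split=> //; exact: leq_trans size_tr _.
  + move=> a c ac; split=> //; apply: size_deriv_le.
    by have := h3 a c ac; rewrite subrr mul0r add0r => ->; rewrite !srcPsi2 -polyCD size_polyC1.
  + by move=> a c; split=> //; exact: leq_trans (anti a c) _.
  + move=> a c; split=> //; apply: size_deriv_le.
    by have := h4 a c; rewrite subrr mul0r add0r => ->; rewrite !srcPsi2 -polyCB size_polyC1.
- move=> a c; apply/eqP; rewrite -subr_eq0 -coefB; apply/eqP.
  exact: (leq_sizeP _ _ (anti a c)).
- by rewrite -!coefD; exact: (leq_sizeP _ _ size_tr).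
Qed.

(** An isotropic source has no traceless symmetric part, hence creates no
    logarithm. *)
Lemma order2_einstein mu : (forall a c, curvF a c = if a == c then mu else 0) ->
  [/\ forall a c, (size (sPsi F a c 2) <= 1)%N,
      forall a c, (sPsi F a c 2)`_0 = (sPsi F c a 2)`_0 &
      (sPsi F i0 i0 2)`_0 + (sPsi F i1 i1 2)`_0 + (sPsi F i2 i2 2)`_0 = mu].
Proof.
move=> hmu; have [h1 h2 h3 h4] := ind2.
have c2 : (2%:R : R) != 0 by rewrite pnatr_eq0.
have anti a c : sPsi F a c 2 = sPsi F c a 2.
  apply/eqP; rewrite -subr_eq0 -size_poly_eq0 -(size_ode _ c2) polyC_natr h2.
  by rewrite !srcPsi2 !hmu [c == a]eq_sym subrr size_poly0.
have dz p : p^`() = 0 :> {poly R} -> (size p <= 1)%N.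
  by move=> p0; apply: size_deriv_le; rewrite p0 size_poly0.
split.
- move=> a c; suff [_ +] : good (fun=> 0%N) 2 (sPsi F a c 2) by [].
  move: a c; apply: (@good_matrix _ (fun=> 0%N) 2 (fun a c => sPsi F a c 2)).
  + by split.
  + move=> a c ac; split=> //; apply: dz; have := h3 a c ac.
    rewrite subrr mul0r add0r => ->; rewrite !srcPsi2 !hmu [c == a]eq_sym.
    by rewrite (negbTE ac) addr0.
  + by move=> a c; rewrite (anti a c) subrr; exact: good0.
  + move=> a c; split=> //; apply: dz; have := h4 a c.
    by rewrite subrr mul0r add0r => ->; rewrite !srcPsi2 !hmu !eqxx subrr.
- by move=> a c; rewrite anti.
- have := congr1 (fun p : {poly R} => p`_0) h1; rewrite three.
  have /size1_polyC -> := size_tr; rewrite derivC addr0 coefCM !coefC /=.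
  rewrite /trB !srcPsi2 !hmu /= -!polyCD coefC /= !coefD => h.
  lra.
Qed.

End Order2.

End Step.

End Frame.

(** * Directional derivatives *)

Section Derivatives.
Context {R : realType} {V : normedModType R}.
Implicit Types (f g : V -> R) (x v : V).

Lemma dr_ext f g x v (a : R) : f =1 g -> is_derive x v f a -> is_derive x v g a.
Proof. by move=> /funext ->. Qed.

Lemma dr_near f g x v (a : R) : (\near x, f x = g x) ->
  is_derive x v f a -> is_derive x v g a.
Proof. exact: near_eq_is_derive. Qed.

Lemma dr_cst (c : R) x v : is_derive x v (fun=> c) 0.
Proof. exact: is_derive_cst. Qed.

Lemma drD f g x v (a b : R) : is_derive x v f a -> is_derive x v g b ->
  is_derive x v (fun w => f w + g w) (a + b).
Proof. exact: is_deriveD. Qed.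

Lemma drB f g x v (a b : R) : is_derive x v f a -> is_derive x v g b ->
  is_derive x v (fun w => f w - g w) (a - b).
Proof. exact: is_deriveB. Qed.

Lemma drM f g x v (a b : R) : is_derive x v f a -> is_derive x v g b ->
  is_derive x v (fun w => f w * g w) (a * g x + f x * b).
Proof.
move=> hf hg; have := is_deriveM hf hg; rewrite addrC.
by rewrite [g x *: a]mulrC.
Qed.

Lemma drZ (c : R) f x v (a : R) : is_derive x v f a ->
  is_derive x v (fun w => c * f w) (c * a).
Proof. exact: is_deriveZ. Qed.

Lemma drZr (c : R) f x v (a : R) : is_derive x v f a ->
  is_derive x v (fun w => f w * c) (a * c).
Proof. by move=> /(drZ c) h; rewrite mulrC; apply: dr_ext h => w; rewrite mulrC. Qed.

Lemma dr_sum n (F : 'I_n -> V -> R) x v (a : 'I_n -> R) :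
  (forall i, is_derive x v (F i) (a i)) ->
  is_derive x v (fun w => \sum_i F i w) (\sum_i a i).
Proof.
move=> h; have := is_derive_sum h; apply: dr_ext => w.
by rewrite fct_sumE.
Qed.

Lemma drV f x v (a : R) : f x != 0 -> is_derive x v f a ->
  is_derive x v (fun w => (f w)^-1) (- f x ^- 2 * a).
Proof.
move=> f0 [df <-]; split; first exact: derivableV.
exact: deriveV.
Qed.

Lemma dr_unique f x v (a b : R) : is_derive x v f a -> is_derive x v f b -> a = b.
Proof. by move=> [_ <-] [_ <-]. Qed.

(** Restriction to an affine line, or to a factor of a product. *)
Lemma dr_affine (W : normedModType R) (phi : W -> V) f (x v : W) (u : V) (a : R) :
  (forall h : R, phi (h *: v + x) = h *: u + phi x) ->
  is_derive (phi x) u f a <-> is_derive x v (f \o phi) a.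
Proof.
move=> hphi.
have E : (fun h : R => h^-1 *: (((f \o phi) \o shift x) (h *: v) - (f \o phi) x)) =
         (fun h : R => h^-1 *: ((f \o shift (phi x)) (h *: u) - f (phi x))).
  by apply/funext => h /=; rewrite hphi.
by split=> -[d1 d2]; split; rewrite /derivable /derive ?E -?E//;
  move: d1 d2; rewrite /derivable /derive ?E.
Qed.

Lemma dr_line f x v (t a : R) : is_derive (t *: v + x) v f a ->
  is_derive t 1 (fun s : R => f (s *: v + x)) a.
Proof.
move/(@dr_affine _ (fun s : R => s *: v + x) f t 1 v a); apply => h.
by rewrite scalerDl -scalerA addrA scale1r.
Qed.

End Derivatives.

Section Schwarz.
Context {R : realType} {n : nat}.
Implicit Types (f : 'rV[R]_n -> R) (x v u : 'rV[R]_n) (U : set 'rV[R]_n).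

Lemma smooth_dr U f (s : seq 'I_n) x (mu : 'I_n) : smooth_on U f -> U x ->
  is_derive x (delta_mx 0 mu) (partials s f) (partials (mu :: s) f x).
Proof. by move=> h Ux; have [_ /(_ mu) d] := h s x Ux; split. Qed.

Lemma mvt_line f (df : 'rV[R]_n -> R) x v (h : R) : 0 < h ->
  (forall t, 0 <= t <= h -> is_derive (t *: v + x) v f (df (t *: v + x))) ->
  exists t, 0 < t < h /\ f (h *: v + x) - f x = df (t *: v + x) * h.
Proof.
move=> h0 hd.
have hl t : 0 <= t <= h -> is_derive t 1 (fun s : R => f (s *: v + x)) (df (t *: v + x)).
  by move=> /hd; exact: dr_line.
have [||c] := @MVT R (fun s => f (s *: v + x)) (fun t => df (t *: v + x)) 0 h h0.
- by move=> t; rewrite in_itv/= => /andP[t0 th]; apply: hl; rewrite !ltW.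
- by apply: derivable_within_continuous => t; rewrite in_itv/= => /hl[].
- rewrite in_itv/= scale0r add0r subr0 => ch e; exists c; split => //.
Qed.

(** The mean value theorem applied twice. *)
Lemma second_difference U f x (k l : 'I_n) (h : R) : smooth_on U f -> 0 < h ->
  (forall s t, 0 <= s <= h -> 0 <= t <= h ->
     U (s *: delta_mx 0 k + (t *: delta_mx 0 l + x))) ->
  exists s t, [/\ 0 < s < h, 0 < t < h &
    f (h *: delta_mx 0 k + (h *: delta_mx 0 l + x)) - f (h *: delta_mx 0 k + x)
    - (f (h *: delta_mx 0 l + x) - f x) =
    partial l (partial k f) (s *: delta_mx 0 k + (t *: delta_mx 0 l + x)) * h * h].
Proof.
move=> sf h0 hU; set ek : 'rV[R]_n := delta_mx 0 k; set el : 'rV[R]_n := delta_mx 0 l.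
have hh : 0 <= h <= h by rewrite lexx ltW.
have zh : 0 <= (0 : R) <= h by rewrite lexx ltW.
pose phi w := f (h *: el + w) - f w.
have [s [sh es]] : exists s, 0 < s < h /\ phi (h *: ek + x) - phi x =
    (partial k f (h *: el + (s *: ek + x)) - partial k f (s *: ek + x)) * h.
  apply: (@mvt_line phi (fun w => partial k f (h *: el + w) - partial k f w)) => // t th.
  apply: drB; last first.
    apply: (smooth_dr [::] k sf); have := hU t 0 th zh.
    by rewrite scale0r add0r.
  apply/(@dr_affine _ _ _ (fun w => h *: el + w) f) => [c|]; first by rewrite addrCA.
  apply: (smooth_dr [::] k sf); have := hU t h th hh.
  by rewrite addrCA.
have [t [th et]] : exists t, 0 < t < h /\
    partial k f (h *: el + (s *: ek + x)) - partial k f (s *: ek + x) =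
    partial l (partial k f) (t *: el + (s *: ek + x)) * h.
  apply: mvt_line => // t th; apply: (smooth_dr [:: k] l sf).
  have /andP[/ltW s0 /ltW s1] := sh.
  by rewrite addrCA; apply: hU => //; rewrite s0.
exists s, t; split => //.
move: es; rewrite /phi et [h *: el + (h *: ek + x)]addrCA => ->.
by rewrite [t *: el + _]addrCA.
Qed.

(** Both mixed derivatives are limits of the same second difference. *)
Lemma schwarz U f x (k l : 'I_n) : open U -> U x -> smooth_on U f ->
  partial l (partial k f) x = partial k (partial l f) x.
Proof.
move=> oU Ux sf.
set ek : 'rV[R]_n := delta_mx 0 k; set el : 'rV[R]_n := delta_mx 0 l.
have cont (i j : 'I_n) : {for x, continuous (partial i (partial j f))}.
  by have [] := sf [:: i; j] x Ux.
apply/eqP; rewrite -subr_eq0 -normr_le0; apply/ler_addgt0Pl => e e0.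
rewrite addr0.
have e2 : 0 < e / 2 by rewrite divr_gt0.
have near_x : \forall z \near x, U z /\
    `|partial l (partial k f) x - partial l (partial k f) z| < e / 2 /\
    `|partial k (partial l f) x - partial k (partial l f) z| < e / 2.
  have h1 : nbhs x [set z | `|partial l (partial k f) x - partial l (partial k f) z| < e / 2].
    by apply: (@cvgr_dist_lt _ _ _ _ _ _ _ (cont l k) _ e2).
  have h2 : nbhs x [set z | `|partial k (partial l f) x - partial k (partial l f) z| < e / 2].
    by apply: (@cvgr_dist_lt _ _ _ _ _ _ _ (cont k l) _ e2).
  have h3 : nbhs x U by exact: open_nbhs_nbhs.
  exact: (filterI h3 (filterI h1 h2)).
have /nbhs_ballP[d /= d0 hd] := near_x.
pose M := `|ek| + `|el| + 1.
have M0 : 0 < M by rewrite ltr_wpDl// addr_ge0.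
pose h := d / 2 / M.
have h0 : 0 < h by rewrite !divr_gt0.
have inb s t : 0 <= s <= h -> 0 <= t <= h -> ball x d (s *: ek + (t *: el + x)).
  move=> /andP[s0 sh] /andP[t0 th]; rewrite -ball_normE /ball_ /= addrA opprD.
  rewrite addrCA subrr addr0 normrN (le_lt_trans (ler_normD _ _))// !normrZ.
  rewrite !ger0_norm//; apply: (@le_lt_trans _ _ (h * (`|ek| + `|el|))).
    by rewrite mulrDr lerD// ler_wpM2r.
  apply: (@le_lt_trans _ _ (h * M)); first by rewrite ler_wpM2l ?(ltW h0)// lerDl.
  by rewrite /h divfK ?gt_eqF// ltr_pdivrMr// ltr_pMr// ltr1n.
have [s [t [sh th E1]]] := second_difference sf h0
  (fun s t hs ht => (hd _ (inb s t hs ht)).1).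
have [t' [s' [th' sh' E2]]] : exists t s, [/\ 0 < t < h, 0 < s < h &
    f (h *: ek + (h *: el + x)) - f (h *: el + x) - (f (h *: ek + x) - f x) =
    partial k (partial l f) (s *: ek + (t *: el + x)) * h * h].
  have [|t1 [s1 [h1 h2 h3]]] := @second_difference U f x l k h sf h0.
    move=> s1 t1 hs1 ht1; rewrite (addrCA (s1 *: delta_mx 0 l) (t1 *: delta_mx 0 k) x).
    exact: (hd _ (inb t1 s1 ht1 hs1)).1.
  exists t1, s1; split; [exact: h1|exact: h2|].
  rewrite (addrCA (s1 *: ek) (t1 *: el) x) (addrCA (h *: ek) (h *: el) x).
  exact: h3.
have {E1 E2} E : partial l (partial k f) (s *: ek + (t *: el + x)) =
    partial k (partial l f) (s' *: ek + (t' *: el + x)).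
  have hn0 : h != 0 by rewrite gt_eqF.
  apply: (mulIf hn0); apply: (mulIf hn0).
  have A (a b c c' : R) : a - b - (c - c') = a - c - (b - c') by ring.
  exact: etrans (esym E1) (etrans (A _ _ _ _) E2).
have W a : 0 < a < h -> 0 <= a <= h by case/andP => a0 a1; rewrite !ltW.
have [_ [B1 _]] := hd _ (inb _ _ (W _ sh) (W _ th)).
have [_ [_ B2]] := hd _ (inb _ _ (W _ sh') (W _ th')).
move: E B1 B2.
move: (partial l (partial k f) (s *: ek + (t *: el + x))) => p.
move: (partial k (partial l f) (s' *: ek + (t' *: el + x))) => q.
move: (partial l (partial k f) x) (partial k (partial l f) x) => a b pq B1 B2.
apply: (le_trans (ler_distD q a b)); rewrite [leRHS]splitr -{1}pq.
by apply: lerD; [exact: ltW|rewrite distrC; exact: ltW].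
Qed.

End Schwarz.

(** * From expansions of functions to series at a point *)

Section Slices.
Context {R : realType}.
Implicit Types (f : 'rV[R]_(3 + 1) -> R) (x : 'rV[R]_3) (z : 'rV[R]_(3 + 1)).

Lemma xpart_xy x (y : R) : xpart (xy x y) = x.
Proof. by rewrite /xpart /xy row_mxKl. Qed.

Lemma ypart_xy x (y : R) : ypart (xy x y) = y.
Proof. by rewrite /ypart /xy row_mxKr mxE mulr1n. Qed.

Lemma xdir_xy (k : 'I_3) :
  delta_mx 0 (xdir k) = xy (delta_mx 0 k) 0 :> 'rV[R]_(3 + 1).
Proof.
apply/rowP => j; rewrite /xy /xdir -[j]splitK; case: (fintype.split j) => i /=.
  by rewrite row_mxEl !mxE !eqxx /= (inj_eq (@lshift_inj _ _)).
by rewrite row_mxEr !mxE eqxx eq_sym eq_lrshift /= mul0rn.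
Qed.

Lemma ydir_xy : delta_mx 0 ydir = xy 0 1 :> 'rV[R]_(3 + 1).
Proof.
apply/rowP => j; rewrite /xy /ydir -[j]splitK; case: (fintype.split j) => i /=.
  by rewrite row_mxEl !mxE eqxx /= eq_lrshift.
by rewrite row_mxEr !ord1 !mxE !eqxx.
Qed.

Lemma xyD x x' (y y' : R) : xy x y + xy x' y' = xy (x + x') (y + y').
Proof. by rewrite /xy add_row_mx raddfD. Qed.

Lemma xyZ (c : R) x (y : R) : c *: xy x y = xy (c *: x) (c * y).
Proof. by rewrite /xy scale_row_mx scale_scalar_mx. Qed.

Lemma xy_parts z : z = xy (xpart z) (ypart z).
Proof.
rewrite /xy /xpart /ypart -[LHS]hsubmxK; congr row_mx.
by rewrite [LHS]mx11_scalar.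
Qed.

Lemma dr_x f x (y : R) (k : 'I_3) (a : R) :
  is_derive (xy x y) (delta_mx 0 (xdir k)) f a <->
  is_derive x (delta_mx 0 k) (fun x' => f (xy x' y)) a.
Proof.
apply: (@dr_affine _ _ _ (fun x' => xy x' y)) => h.
by rewrite xdir_xy xyZ xyD mulr0 add0r.
Qed.

Lemma dr_y f x (y a : R) :
  is_derive (xy x y) (delta_mx 0 ydir) f a <->
  is_derive y 1 (fun y' : R => f (xy x y')) a.
Proof.
apply: (@dr_affine _ _ _ (fun y' : R => xy x y')) => h.
by rewrite ydir_xy xyZ xyD scaler0 add0r mulr1 scaler1.
Qed.

(** Functions and forms on X are lifted to X x R^+ through [xpart]. *)
Lemma dr_xpart (g : 'rV[R]_3 -> R) x (y : R) (k : 'I_3) (a : R) :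
  is_derive (xy x y) (delta_mx 0 (xdir k)) (fun z => g (xpart z)) a <->
  is_derive x (delta_mx 0 k) g a.
Proof.
rewrite dr_x; split; apply: dr_ext => x'; by rewrite xpart_xy.
Qed.

Lemma dr_xpart_y (g : 'rV[R]_3 -> R) x (y : R) :
  is_derive (xy x y) (delta_mx 0 ydir) (fun z => g (xpart z)) 0.
Proof.
apply/dr_y; apply: dr_ext (dr_cst (g x) y 1) => y'.
by rewrite xpart_xy.
Qed.

Lemma dr_ylog (n : nat) (P : {poly R}) (y : R) : 0 < y ->
  is_derive y 1 (fun t : R => t ^+ n * P.[ln t])
    (y^-1 * (y ^+ n * (P *+ n + P^`()).[ln y])).
Proof.
move=> y0.
have h1 := is_derive1_comp (is_derive_poly P (ln y)) (is_derive1_ln y0).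
have h2 : is_derive y 1 (fun t : R => t ^+ n) (y^-1 * (y ^+ n *+ n)).
  apply: DeriveDef; first exact: exprn_derivable.
  rewrite exp_derive /GRing.scale /= mulr1 mulr_natl.
  by case: n => [|n]; rewrite ?mulr0n ?mulr0// exprS /= -mulrnAr mulKf ?gt_eqF.
have e : y^-1 * (y ^+ n *+ n) * P.[ln y] + y ^+ n * (P^`().[ln y] / y) =
    y^-1 * (y ^+ n * (P *+ n + P^`()).[ln y]).
  by rewrite hornerD hornerMn -[y ^+ n *+ n]mulr_natr -[P.[_] *+ n]mulr_natr; ring.
by rewrite -e; exact: (drM h2 h1).
Qed.

Definition cpoly (dep : nat -> nat) (c : nat -> nat -> 'rV[R]_3 -> R) x (n : nat) :
  {poly R} := \poly_(p < (dep n).+1) c n p x.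

Lemma ylog_polyE (s : nat -> {poly R}) N (y l : R) :
  (\poly_(n < N) s n).[y, l] = \sum_(n < N) y ^+ n * (s n).[l].
Proof.
rewrite horner_poly horner_sum; apply: eq_bigr => n _.
by rewrite -polyC_exp hornerM hornerC mulrC.
Qed.

Lemma psumE dep c N x (y : R) : psum succn dep c N (xy x y) =
  (\poly_(n < N.+1) ser1 (cpoly dep c x) n).[y, ln y].
Proof.
rewrite ylog_polyE big_ord_recl /= horner0 mulr0 add0r /psum xpart_xy ypart_xy.
apply: eq_bigr => n _; rewrite /cpoly horner_poly mulr_sumr.
by apply: eq_bigr => p _; rewrite /bump /= add1n; ring.
Qed.

(** Expansions here are numbered from y^1, so a truncation of length N is
    accurate to O(y^(N + 1)). *)
Lemma asymS (u : R -> R) (s : nat -> {poly R}) :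
  (forall N, bigO N.+1 (fun y => u y - (\poly_(n < N.+1) s n).[y, ln y])) ->
  s 0%N = 0 -> asym u s.
Proof.
move=> h s0 [|N]; last exact: h.
apply: bigO_gt0 (bigO_le (leq0n 1) (h 0%N)) => y _.
by rewrite !ylog_polyE big_ord_recl !big_ord0 s0 horner0 mulr0 addr0.
Qed.

Section AtPoint.
Variables (U : set 'rV[R]_3) (f : 'rV[R]_(3 + 1) -> R) (dep : nat -> nat)
  (c : nat -> nat -> 'rV[R]_3 -> R) (x : 'rV[R]_3).
Hypothesis hexp : expansion U f succn dep c.
Hypothesis Ux : U x.
Hypothesis hf : forall y mu, 0 < y ->
  is_derive (xy x y) (delta_mx 0 mu) f (partial mu f (xy x y)).
Hypothesis hc : forall n p k,
  is_derive x (delta_mx 0 k) (c n p) (partial k (c n p) x).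

Let bound j ks (v : R -> R) N :
  (forall y, 0 < y -> bderiv j ks (fun z => f z - psum succn dep c N z) (xy x y) = v y) ->
  bigO N.+1 v.
Proof.
move=> hv; have [q [C [d [d0 /nbhs_singleton h]]]] := hexp N j ks Ux.
exists q, C; apply: filterS (near_small d0) => y yd.
have /andP[y0 _] := yd.
by rewrite -hv// mulrA; exact: h.
Qed.

Lemma asym_value : asym (fun y => f (xy x y)) (ser1 (cpoly dep c x)).
Proof.
apply: asymS => // N; apply: (bound (j := 0) (ks := [::])) => y _ /=.
by rewrite psumE.
Qed.

Lemma asym_dx (k : 'I_3) : asym (fun y => partial (xdir k) f (xy x y))
  (ser1 (cpoly dep (fun n p => partial k (c n p)) x)).
Proof.
apply: asymS => // N; apply: (bound (j := 0) (ks := [:: k])) => y y0 /=.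
apply: derive_val; apply: drB; first exact: hf.
apply/dr_x; rewrite -psumE /psum.
apply: (dr_ext (f := fun x' => \sum_(n < N) \sum_(p < (dep n).+1)
  c n p x' * (y ^+ n.+1 * ln y ^+ p))).
  move=> x' /=; rewrite xpart_xy ypart_xy.
  by apply: eq_bigr => n _; apply: eq_bigr => p _; rewrite mulrA.
rewrite xpart_xy ypart_xy; apply: dr_sum => n; apply: dr_sum => p.
by rewrite -mulrA; apply: drZr; exact: hc.
Qed.

Lemma asym_ydy : asym (fun y => y * partial ydir f (xy x y))
  (theta (ser1 (cpoly dep c x))).
Proof.
apply: asymS => [N|]; last by rewrite /theta mulr0n deriv0 addr0.
apply: (bound (j := 1) (ks := [::])) => y y0 /=.
rewrite /ydy ypart_xy /partial.
set T := (\poly_(n < N.+1) _).[_].[_].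
have -> : T = y * (y^-1 * T) by rewrite mulVKf ?gt_eqF.
rewrite -mulrBr; congr (_ * _); apply: derive_val; apply: drB; first exact: hf.
apply/dr_y; rewrite /T ylog_polyE mulr_sumr.
have H : is_derive y 1
    (fun t : R => \sum_(n < N.+1) t ^+ n * (ser1 (cpoly dep c x) n).[ln t])
    (\sum_(n < N.+1) y^-1 * (y ^+ n * (theta (ser1 (cpoly dep c x)) n).[ln y])).
  by apply: dr_sum => n; exact: dr_ylog.
by apply: dr_ext H => t; rewrite psumE ylog_polyE.
Qed.

End AtPoint.

End Slices.

(** * The Lie algebra as R^3 with the cross product *)

Section LieAlgebra.
Context {R : realType}.

Definition hat3 (v : 'I_3 -> R) : 'M[R]_3 := \matrix_(r, s)
  match val r, val s with
  | 0, 1 => - v i2 | 0, 2 => v i1 | 1, 0 => v i2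
  | 1, 2 => - v i0 | 2, 0 => - v i1 | 2, 1 => v i0 | _, _ => 0
  end.

(* The real form of - i / 2 (v_0 sigma_1 + v_1 sigma_2 + v_2 sigma_3). *)
Definition hat4 (v : 'I_3 -> R) : 'M[R]_(2 + 2) := \matrix_(r, s)
  match val r, val s with
  | 0, 1 => - (v i1 / 2) | 0, 2 => v i2 / 2 | 0, 3 => v i0 / 2
  | 1, 0 => v i1 / 2 | 1, 2 => v i0 / 2 | 1, 3 => - (v i2 / 2)
  | 2, 0 => - (v i2 / 2) | 2, 1 => - (v i0 / 2) | 2, 3 => - (v i1 / 2)
  | 3, 0 => - (v i0 / 2) | 3, 1 => v i2 / 2 | 3, 2 => v i1 / 2
  | _, _ => 0
  end.

Definition hat (G : gauge_group) (v : 'I_3 -> R) : 'M[R]_(gdim G) :=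
  match G with SU2 => hat4 v | SO3 => hat3 v end.

Definition corow (G : gauge_group) : 'I_3 -> 'I_(gdim G) :=
  match G with
  | SU2 => fun c => match val c with
      | 0 => @Ordinal 4 0 isT | 1 => @Ordinal 4 1 isT | _ => @Ordinal 4 3 isT end
  | SO3 => n2 end.
Definition cocol (G : gauge_group) : 'I_3 -> 'I_(gdim G) :=
  match G with
  | SU2 => fun c => match val c with
      | 0 => @Ordinal 4 3 isT | 1 => @Ordinal 4 0 isT | _ => @Ordinal 4 1 isT end
  | SO3 => n1 end.
Definition coscale (G : gauge_group) : R := match G with SU2 => 2 | SO3 => 1 end.

(** The coordinates of an element of the Lie algebra are multiples of single
    entries, so they commute with derivatives and limits. *)
Definition co (G : gauge_group) (M : 'M[R]_(gdim G)) (c : 'I_3) : R :=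
  coscale G * M (corow G c) (cocol G c).

Section Linear.
Variable G : gauge_group.
Implicit Types (M N : 'M[R]_(gdim G)).

Lemma coD M N c : co (M + N) c = co M c + co N c.
Proof. by rewrite /co mxE mulrDr. Qed.
Lemma coN M c : co (- M) c = - co M c.
Proof. by rewrite /co mxE mulrN. Qed.
Lemma coB M N c : co (M - N) c = co M c - co N c.
Proof. by rewrite coD coN. Qed.
Lemma coZ a M c : co (a *: M) c = a * co M c.
Proof. by rewrite /co mxE mulrCA. Qed.
Lemma co0 c : co (0 : 'M[R]_(gdim G)) c = 0.
Proof. by rewrite /co mxE mulr0. Qed.
Lemma co_sum n (F : 'I_n -> 'M[R]_(gdim G)) c :
  co (\sum_i F i) c = \sum_i co (F i) c.
Proof. by elim/big_rec2: _ => [|i a b _ <-]; rewrite ?co0 ?coD. Qed.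

End Linear.

Lemma ord4P (P : 'I_4 -> Prop) :
  P (@Ordinal 4 0 isT) -> P (@Ordinal 4 1 isT) ->
  P (@Ordinal 4 2 isT) -> P (@Ordinal 4 3 isT) -> forall a, P a.
Proof.
move=> h0 h1 h2 h3 [[|[|[|[|//]]]] h].
- by rewrite (_ : Ordinal h = @Ordinal 4 0 isT)//; exact: val_inj.
- by rewrite (_ : Ordinal h = @Ordinal 4 1 isT)//; exact: val_inj.
- by rewrite (_ : Ordinal h = @Ordinal 4 2 isT)//; exact: val_inj.
- by rewrite (_ : Ordinal h = @Ordinal 4 3 isT)//; exact: val_inj.
Qed.

Lemma sum4 (V : nmodType) (F : 'I_4 -> V) : \sum_a F a =
  F (@Ordinal 4 0 isT) + F (@Ordinal 4 1 isT) + F (@Ordinal 4 2 isT)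
  + F (@Ordinal 4 3 isT).
Proof.
rewrite !big_ord_recr big_ord0 /= add0r.
by congr (F _ + F _ + F _ + F _); exact: val_inj.
Qed.

(** For SU(2) the conditions on the 2 x 2 complex matrix leave the three real
    parameters of an anti-hermitian traceless matrix. *)
Lemma lie_hat (G : gauge_group) (M : 'M[R]_(gdim G)) :
  lie_carrier M -> M = hat G (co M).
Proof.
case: G M => /= M.
  case=> U [-> hU trU]; apply/matrixP.
  have e (i j : 'I_2) : (complex.Re (U j i) = - complex.Re (U i j)) /\
      complex.Im (U j i) = complex.Im (U i j).
    have /matrixP/(_ i j) := hU; rewrite !mxE.
    by case: (U i j) (U j i) => [a b] [a' b'] [-> /eqP]; rewrite eqr_opp => /eqP ->.
  pose z0 := @Ordinal 2 0 isT; pose z1 := @Ordinal 2 1 isT.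
  have t : complex.Im (U z1 z1) = - complex.Im (U z0 z0).
    move: trU; rewrite /mxtrace !big_ord_recr big_ord0 /= add0r.
    rewrite (_ : widen_ord _ _ = z0); last exact: val_inj.
    rewrite (_ : ord_max = z1); last exact: val_inj.
    case: (U z0 z0) (U z1 z1) => [a b] [a' b'] /= /eqP; rewrite eq_complex /=.
    by case/andP => _; rewrite addrC addr_eq0 => /eqP.
  have d (i : 'I_2) : complex.Re (U i i) = 0 by have [h _] := e i i; lra.
  have [r01 m01] := e z0 z1; have d0 := d z0; have d1 := d z1.
  have l0 : @Ordinal 4 0 isT = lshift 2 z0 by exact: val_inj.
  have l1 : @Ordinal 4 1 isT = lshift 2 z1 by exact: val_inj.
  have l2 : @Ordinal 4 2 isT = rshift 2 z0 by exact: val_inj.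
  have l3 : @Ordinal 4 3 isT = rshift 2 z1 by exact: val_inj.
  have ul i j : realify U (lshift 2 i) (lshift 2 j) = complex.Re (U i j).
    by rewrite /realify block_mxEul mxE.
  have ur i j : realify U (lshift 2 i) (rshift 2 j) = - complex.Im (U i j).
    by rewrite /realify block_mxEur !mxE.
  have dl i j : realify U (rshift 2 i) (lshift 2 j) = complex.Im (U i j).
    by rewrite /realify block_mxEdl mxE.
  have dr i j : realify U (rshift 2 i) (rshift 2 j) = complex.Re (U i j).
    by rewrite /realify block_mxEdr mxE.
  by apply: ord4P; apply: ord4P; rewrite [RHS]mxE /= /co /=
    ?(l0, l1, l2, l3) ?(ul, ur, dl, dr) ?(d0, d1, t, r01, m01); lra.
move=> hM; apply/matrixP.
have e r s : M s r = - M r s by have /matrixP/(_ r s) := hM; rewrite !mxE.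
have d r : M r r = 0 by have := e r r; lra.
by apply: ord3P; apply: ord3P; rewrite [RHS]mxE /= /co /= ?mul1r ?d//; apply: e.
Qed.

Lemma lie_eq0 (G : gauge_group) (M : 'M[R]_(gdim G)) :
  lie_carrier M -> (forall c, co M c = 0) -> M = 0.
Proof.
move=> hM h; rewrite (lie_hat hM) (_ : co M = fun=> 0); last exact/funext.
by case: G M hM h => M _ _; apply/matrixP => r s; rewrite !mxE ?mul0r ?oppr0;
  case: (val r) (val s) => [|[|[|[|?]]]] [|[|[|[|?]]]].
Qed.

Lemma lie_carrier0 (G : gauge_group) : lie_carrier (0 : 'M[R]_(gdim G)).
Proof.
case: G => /=; last by rewrite trmx0 oppr0.
exists 0; split; last by rewrite mxtrace0.
  by rewrite /realify !map_mx0 oppr0 block_mx0.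
by rewrite /adjmx map_mx0 trmx0 oppr0.
Qed.

(** Every entry of an element of the Lie algebra is a multiple of one
    coordinate. *)
Lemma hat_entry (G : gauge_group) r s : exists (kappa : R) c,
  forall v, hat G v r s = kappa * v c.
Proof.
case: G r s => /=.
  { apply: ord4P; apply: ord4P; rewrite /hat4.
  all: try by exists 0, i0 => v; rewrite mxE /= mul0r.
  all: first [by exists 2^-1, i0 => v; rewrite mxE /= mulrC
    | by exists 2^-1, i1 => v; rewrite mxE /= mulrC
    | by exists 2^-1, i2 => v; rewrite mxE /= mulrC
    | by exists (- 2^-1), i0 => v; rewrite mxE /= mulNr mulrC
    | by exists (- 2^-1), i1 => v; rewrite mxE /= mulNr mulrC
    | by exists (- 2^-1), i2 => v; rewrite mxE /= mulNr mulrC]. }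
apply: ord3P; apply: ord3P; rewrite /hat3.
all: try by exists 0, i0 => v; rewrite mxE /= mul0r.
all: first [by exists 1, i0 => v; rewrite mxE /= mul1r
  | by exists 1, i1 => v; rewrite mxE /= mul1r
  | by exists 1, i2 => v; rewrite mxE /= mul1r
  | by exists (- 1), i0 => v; rewrite mxE /= mulN1r
  | by exists (- 1), i1 => v; rewrite mxE /= mulN1r
  | by exists (- 1), i2 => v; rewrite mxE /= mulN1r].
Qed.

(** The generators behind [hat3] and [hat4] satisfy [t_a, t_b] = eps_(abc)
    t_c. *)
Lemma bracket_hat (G : gauge_group) (M N : 'M[R]_(gdim G)) :
  lie_carrier M -> lie_carrier N -> bracket M N = hat G (cr (co M) (co N)).
Proof.
move=> /lie_hat hM /lie_hat hN; rewrite {1}hM {1}hN.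
move: (co M) (co N) => u v {M N hM hN}.
apply/matrixP; case: G => /=.
  by apply: ord4P; apply: ord4P; rewrite /bracket !mxE !sum4 !mxE /= /cr /=; field.
by apply: ord3P; apply: ord3P; rewrite /bracket !mxE !sum3 !mxE /= /cr /=; ring.
Qed.

Lemma co_hat (G : gauge_group) (v : 'I_3 -> R) c : co (hat G v) c = v c.
Proof. by rewrite /co; move: c; case: G; apply: ord3P; rewrite mxE /=; field. Qed.

Lemma co_bracket (G : gauge_group) (M N : 'M[R]_(gdim G)) c :
  lie_carrier M -> lie_carrier N -> co (bracket M N) c = cr (co M) (co N) c.
Proof. by move=> hM hN; rewrite bracket_hat// co_hat. Qed.

End LieAlgebra.

(** * Small determinants, the Levi-Civita symbol and the Hodge star *)

Section Levi.
Context {R : realType}.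
Implicit Types (m : nat -> nat -> R).

Definition d2 m := m 0 0 * m 1 1 - m 0 1 * m 1 0.
Definition d3 m := m 0 0 * (m 1 1 * m 2 2 - m 1 2 * m 2 1)
  - m 0 1 * (m 1 0 * m 2 2 - m 1 2 * m 2 0)
  + m 0 2 * (m 1 0 * m 2 1 - m 1 1 * m 2 0).

Lemma minorE n m (j : 'I_n.+1) :
  row' ord0 (col' j (\matrix_(i < n.+1, k < n.+1) m i k)) =
  \matrix_(i < n, k < n) m i.+1 (bump j k).
Proof. by apply/matrixP => i k; rewrite !mxE. Qed.

Lemma det2E m : \det (\matrix_(i < 2, j < 2) m i j) = d2 m.
Proof.
rewrite (expand_det_row _ ord0) !big_ord_recr big_ord0 /cofactor /= !minorE.
by rewrite !det_mx11 !mxE /= /bump /= /d2; ring.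
Qed.

Lemma det3E m : \det (\matrix_(i < 3, j < 3) m i j) = d3 m.
Proof.
rewrite (expand_det_row _ ord0) !big_ord_recr big_ord0 /cofactor /= !minorE.
rewrite !(det2E (fun i k => m i.+1 (bump _ k))) !mxE /= /bump /= /d2 /d3 /=; ring.
Qed.

Lemma det4E m : \det (\matrix_(i < 4, j < 4) m i j) =
  m 0 0 * d3 (fun i k => m i.+1 (bump 0 k)) - m 0 1 * d3 (fun i k => m i.+1 (bump 1 k))
  + m 0 2 * d3 (fun i k => m i.+1 (bump 2 k)) - m 0 3 * d3 (fun i k => m i.+1 (bump 3 k)).
Proof.
rewrite (expand_det_row _ ord0) !big_ord_recr big_ord0 /cofactor /= !minorE.
rewrite !(det3E (fun i k => m i.+1 (bump _ k))) !mxE /= /bump /= /d3 /=; ring.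
Qed.

Lemma levi3E (a b c : 'I_3) :
  levi [tuple a; b; c] = d3 (fun i j => (nth 0%N [:: val a; val b; val c] i == j)%:R) :> R.
Proof.
rewrite /levi -det3E; congr (\det _); apply/matrixP => i j; rewrite !mxE.
by rewrite (tnth_nth a) -(inj_eq val_inj); move: i; apply: ord3P.
Qed.

Lemma levi4E (a b c d : 'I_4) : levi [tuple a; b; c; d] =
  let m i j := (nth 0%N [:: val a; val b; val c; val d] i == j)%:R : R in
  m 0 0 * d3 (fun i k => m i.+1 (bump 0 k)) - m 0 1 * d3 (fun i k => m i.+1 (bump 1 k))
  + m 0 2 * d3 (fun i k => m i.+1 (bump 2 k)) - m 0 3 * d3 (fun i k => m i.+1 (bump 3 k)).
Proof.
rewrite /= -(det4E (fun i j => (nth 0%N [:: val a; val b; val c; val d] i == j)%:R)).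
rewrite /levi; congr (\det _); apply/matrixP => i j; rewrite !mxE.
by rewrite (tnth_nth a) -(inj_eq val_inj); move: i; apply: ord4P.
Qed.

Definition o0 := @Ordinal 4 0 isT.
Definition o1 := @Ordinal 4 1 isT.
Definition o2 := @Ordinal 4 2 isT.
Definition o3 := @Ordinal 4 3 isT.

Lemma xdir0 : xdir i0 = o0. Proof. exact: val_inj. Qed.
Lemma xdir1 : xdir i1 = o1. Proof. exact: val_inj. Qed.
Lemma xdir2 : xdir i2 = o2. Proof. exact: val_inj. Qed.
Lemma ydir3 : ydir = o3. Proof. exact: val_inj. Qed.

Lemma levi_pair_xx (B : 'I_4 -> 'I_4 -> R) (q : 'I_3) :
  (forall a b, B a b = - B b a) ->
  \sum_(a < 4) \sum_(b < 4) levi [tuple a; b; xdir (n1 q); xdir (n2 q)] * B a b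
  = 2 * B (xdir q) ydir.
Proof.
move=> hB.
have hd a : B a a = 0 by have := hB a a; lra.
rewrite !sum4 -/o0 -/o1 -/o2 -/o3 !hd (hB o1 o0) (hB o2 o0) (hB o2 o1).
rewrite (hB o3 o0) (hB o3 o1) (hB o3 o2) ydir3.
move: q; apply: ord3P; rewrite ?[n1 _]/= ?xdir0 ?xdir1 ?xdir2.
- rewrite !levi4E /d3 /=; ring.
- rewrite !levi4E /d3 /=; ring.
- rewrite !levi4E /d3 /=; ring.
Qed.

Lemma levi_pair_yx (B : 'I_4 -> 'I_4 -> R) (k : 'I_3) :
  (forall a b, B a b = - B b a) ->
  \sum_(a < 4) \sum_(b < 4) levi [tuple a; b; ydir; xdir k] * B a b
  = - 2 * B (xdir (n1 k)) (xdir (n2 k)).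
Proof.
move=> hB.
have hd a : B a a = 0 by have := hB a a; lra.
rewrite !sum4 -/o0 -/o1 -/o2 -/o3 !hd (hB o1 o0) (hB o2 o1).
rewrite (hB o3 o0) (hB o3 o1) (hB o3 o2) ydir3.
move: k; apply: ord3P; rewrite ?xdir0 ?xdir1 ?xdir2.
- rewrite (hB o2 o0) !levi4E /d3 /=; ring.
- rewrite (hB o2 o0) !levi4E /d3 /=; ring.
- rewrite (hB o2 o0) !levi4E /d3 /=; ring.
Qed.

(** The Hodge star of a product metric on X x R^+: mixed components give
    purely spatial ones and conversely. *)
Lemma hodge_scalar (K : 'I_4 -> 'I_4 -> R) (H : 'I_3 -> 'I_3 -> R)
    (b : 'I_4 -> 'I_4 -> R) :
  (forall a c, b a c = - b c a) ->
  (forall k l, K (xdir k) (xdir l) = H k l) ->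
  (forall k, K (xdir k) ydir = 0) -> (forall k, K ydir (xdir k) = 0) ->
  K ydir ydir = 1 ->
  let star mu nu := \sum_(a < 4) \sum_(a' < 4) \sum_(c < 4) \sum_(d < 4)
     (K a c * K a' d * levi [tuple a; a'; mu; nu]) * b c d in
  (forall q, star (xdir (n1 q)) (xdir (n2 q)) =
     - 2 * \sum_p H q p * b ydir (xdir p)) /\
  (forall k, star ydir (xdir k) =
     - 2 * \sum_c \sum_d (H (n1 k) c * H (n2 k) d) * b (xdir c) (xdir d)).
Proof.
move=> hb hxx hxy hyx hyy star.
pose B a a' := \sum_(c < 4) \sum_(d < 4) K a c * K a' d * b c d.
have starE mu nu : star mu nu =
    \sum_(a < 4) \sum_(a' < 4) levi [tuple a; a'; mu; nu] * B a a'.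
  apply: eq_bigr => a _; apply: eq_bigr => a' _.
  rewrite /B mulr_sumr; apply: eq_bigr => c _; rewrite mulr_sumr.
  by apply: eq_bigr => d _; ring.
have hB a a' : B a a' = - B a' a.
  rewrite /B exchange_big -sumrN; apply: eq_bigr => c _.
  by rewrite -sumrN; apply: eq_bigr => d _; rewrite hb; ring.
have s4 (F : 'I_4 -> R) : \sum_a F a = \sum_(k < 3) F (xdir k) + F ydir.
  by rewrite sum4 sum3 xdir0 xdir1 xdir2 ydir3.
split=> q; rewrite starE.
- rewrite levi_pair_xx// mulNr -mulrN; congr (_ * _).
  rewrite /B s4 [X in _ + X](_ : _ = 0) ?addr0; last first.
    by apply: big1 => d _; rewrite hxy !mul0r.
  rewrite -sumrN; apply: eq_bigr => p _; rewrite s4 big1 ?add0r; last first.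
    by move=> d _; rewrite hyx mulr0 mul0r.
  by rewrite hyy hxx mulr1 hb mulrN.
- rewrite levi_pair_yx//; congr (_ * _).
  rewrite /B s4 [X in _ + X](_ : _ = 0) ?addr0; last first.
    by apply: big1 => d _; rewrite hxy !mul0r.
  apply: eq_bigr => c _; rewrite s4 hxy mulr0 mul0r addr0.
  by apply: eq_bigr => d _; rewrite !hxx.
Qed.

End Levi.

(** * Linear algebra of a vierbein *)

Section FrameAlgebra.
Context {R : realType}.
Implicit Types (e : 'I_3 -> 'I_3 -> R).

Definition dete e : R := \sum_c e i0 c * cr (e i1) (e i2) c.
(** By Cramer's rule, the cofactors being cross products of rows. *)
Definition Einv e (a k : 'I_3) : R := cr (e (n1 k)) (e (n2 k)) a / dete e.

Section Fixed.
Variable e : 'I_3 -> 'I_3 -> R.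
Hypothesis e0 : dete e != 0.
Local Notation E := (Einv e).

Let d0 : e i0 i0 * (e i1 i1 * e i2 i2 - e i1 i2 * e i2 i1) +
  e i0 i1 * (e i1 i2 * e i2 i0 - e i1 i0 * e i2 i2) +
  e i0 i2 * (e i1 i0 * e i2 i1 - e i1 i1 * e i2 i0) != 0.
Proof. by move: e0; rewrite /dete sum3. Qed.

Lemma Einv_l a c : \sum_k E a k * e k c = (a == c)%:R.
Proof.
rewrite sum3 /Einv /dete sum3 /cr /=.
by move: a c; apply: ord3P; apply: ord3P => /=; field; move: d0.
Qed.

Lemma Einv_r k l : \sum_a e k a * E a l = (k == l)%:R.
Proof.
rewrite sum3 /Einv /dete sum3 /cr /=.
by move: k l; apply: ord3P; apply: ord3P => /=; field; move: d0.
Qed.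

(** Minors of the inverse matrix are entries of the matrix over the
    determinant. *)
Lemma Einv_minor b q : E (n1 b) (n1 q) * E (n2 b) (n2 q)
  - E (n1 b) (n2 q) * E (n2 b) (n1 q) = e q b / dete e.
Proof.
rewrite /Einv /dete sum3 /cr /=.
by move: b q; apply: ord3P; apply: ord3P => /=; field; move: d0.
Qed.

Definition fr1 (X : 'I_3 -> 'I_3 -> R) a c := \sum_k E a k * X k c.
Definition fr2 (X : 'I_3 -> 'I_3 -> 'I_3 -> R) b a c :=
  \sum_k \sum_l E b k * E a l * X k l c.

Lemma fr2_anti X b a c : (forall k l c, X k l c = - X l k c) ->
  fr2 X b a c = - fr2 X a b c.
Proof.
move=> h; rewrite /fr2 exchange_big -sumrN; apply: eq_bigr => k _.
by rewrite -sumrN; apply: eq_bigr => l _; rewrite (h l k c); ring.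
Qed.

Lemma fr1_e a c : fr1 e a c = (a == c)%:R.
Proof. exact: Einv_l. Qed.

Lemma fr1K X k c : \sum_a e k a * fr1 X a c = X k c.
Proof.
rewrite /fr1; under eq_bigr do rewrite mulr_sumr.
rewrite exchange_big /= (bigD1 k) //= [X in _ + X]big1 => [|l lk].
  under eq_bigr do rewrite mulrA.
  by rewrite -mulr_suml Einv_r eqxx mul1r addr0.
under eq_bigr do rewrite mulrA.
by rewrite -mulr_suml Einv_r eq_sym (negbTE lk) mul0r.
Qed.

Lemma contract_e (v : 'I_3 -> R) c : \sum_l E c l * (\sum_d v d * e l d) = v c.
Proof.
under eq_bigr do rewrite mulr_sumr.
rewrite exchange_big /= (bigD1 c) //= [X in _ + X]big1 => [|d dc].
  rewrite addr0; under eq_bigr do rewrite mulrCA.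
  by rewrite -mulr_sumr Einv_l eqxx mulr1.
under eq_bigr do rewrite mulrCA.
by rewrite -mulr_sumr Einv_l eq_sym (negbTE dc) mulr0.
Qed.

Lemma fr2K X k l c : \sum_b e k b * (\sum_a e l a * fr2 X b a c) = X k l c.
Proof.
have h b : \sum_a e l a * fr2 X b a c = fr1 (fun k c => X k l c) b c.
  rewrite /fr1 /fr2; under eq_bigr do rewrite mulr_sumr.
  rewrite exchange_big /=; apply: eq_bigr => m _.
  rewrite -[in RHS](fr1K (X m) l c) /fr1 mulr_sumr; apply: eq_bigr => a _.
  by rewrite !mulr_sumr; apply: eq_bigr => j _; ring.
by under eq_bigr do rewrite h; rewrite fr1K.
Qed.

Lemma fr1Z (r : R) X a c : fr1 (fun k c => r * X k c) a c = r * fr1 X a c.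
Proof. by rewrite /fr1 mulr_sumr; apply: eq_bigr => k _; rewrite mulrCA. Qed.

Lemma fr2Z (r : R) X b a c : fr2 (fun k l c => r * X k l c) b a c = r * fr2 X b a c.
Proof.
rewrite /fr2 mulr_sumr; apply: eq_bigr => k _; rewrite mulr_sumr.
by apply: eq_bigr => l _; rewrite mulrCA.
Qed.

(** Passing to the frame commutes with the pointwise bracket, hence with the
    five combinations that occur in the equations. *)
Lemma fr1_flowA X Y v a c : fr1 (fun k c => X k c - cr v (Y k) c) a c =
  fr1 X a c - cr v (fr1 Y a) c.
Proof. by rewrite /fr1 /cr !sum3; ring. Qed.

Lemma fr1_flowP X Y Z v a c :
  fr1 (fun k c => X k c - Y k c - cr (Z k) v c) a c =
  fr1 X a c - fr1 Y a c - cr (fr1 Z a) v c.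
Proof. by rewrite /fr1 /cr !sum3; ring. Qed.

Lemma fr2_cov T X Y b a c : fr2 (fun k l c => T k l c + cr (X k) (Y l) c) b a c =
  fr2 T b a c + cr (fr1 X b) (fr1 Y a) c.
Proof. by rewrite /fr2 /fr1 /cr !sum3; ring. Qed.

Lemma fr2_curl T X Y b a c :
  fr2 (fun k l c => T k l c - T l k c + (cr (X k) (Y l) c - cr (X l) (Y k) c)) b a c =
  fr2 T b a c - fr2 T a b c
  + (cr (fr1 X b) (fr1 Y a) c - cr (fr1 X a) (fr1 Y b) c).
Proof. by rewrite /fr2 /fr1 /cr !sum3; ring. Qed.

Lemma fr2_curv T X Y b a c :
  fr2 (fun k l c => T k l c - T l k c + cr (X k) (X l) c - cr (Y k) (Y l) c) b a c =
  fr2 T b a c - fr2 T a b c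
  + cr (fr1 X b) (fr1 X a) c - cr (fr1 Y b) (fr1 Y a) c.
Proof. by rewrite /fr2 /fr1 /cr !sum3; ring. Qed.

Lemma fr2_trace X c : \sum_a fr2 X a a c =
  \sum_k \sum_l (\sum_a E a k * E a l) * X k l c.
Proof.
rewrite /fr2 exchange_big; apply: eq_bigr => k _.
rewrite exchange_big; apply: eq_bigr => l _.
by rewrite mulr_suml.
Qed.

Variables (vol sg : R).
Hypothesis sg2 : sg * sg = 1.
Hypothesis vole : vol = sg * dete e.
Let hinv k l := \sum_a E a k * E a l.

(** A 2-form on X is dual, up to the determinant, to its frame components. *)
Lemma e_area (G : 'I_3 -> 'I_3 -> 'I_3 -> R) b c :
  (forall k l c, G k l c = - G l k c) ->
  \sum_q e q b * G (n1 q) (n2 q) c = dete e * fr2 G (n1 b) (n2 b) c.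
Proof.
move=> hG.
have m q : e q b = dete e * (E (n1 b) (n1 q) * E (n2 b) (n2 q)
    - E (n1 b) (n2 q) * E (n2 b) (n1 q)).
  by rewrite Einv_minor mulrC divfK.
have z k : G k k c = 0 by have := hG k k c; lra.
rewrite /fr2 !sum3 !z (hG i1 i0) (hG i2 i1) (hG i2 i0) (m i0) (m i1) (m i2) /=.
rewrite -[n1 i0]/i1 -[n2 i0]/i2 -[n1 i1]/i2 -[n2 i1]/i0 -[n1 i2]/i0 -[n2 i2]/i1.
by ring.
Qed.

(** In the orthonormal frame the Hodge star of X is eps_(abc) up to the
    orientation: first on 1-forms, then on 2-forms. *)
Lemma frame_star_in (X : 'I_3 -> 'I_3 -> R) G b c :
  (forall k l c, G k l c = - G l k c) ->
  (forall q c, vol * \sum_p hinv q p * X p c = G (n1 q) (n2 q) c) ->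
  fr1 X b c = sg * fr2 G (n1 b) (n2 b) c.
Proof.
move=> hG hX; have := e_area b c hG.
under eq_bigr => q _ do rewrite -hX.
have -> : \sum_q e q b * (vol * \sum_p hinv q p * X p c) = vol * fr1 X b c.
  have -> : fr1 X b c = \sum_a (\sum_q E a q * e q b) * fr1 X a c.
    rewrite (bigD1 b) //= [X in _ + X]big1 => [|a ab]; last first.
      by rewrite Einv_l (negbTE ab) mul0r.
    by rewrite Einv_l eqxx mul1r addr0.
  rewrite mulr_sumr /fr1 /hinv; rewrite !sum3; ring.
rewrite vole -mulrA [sg * _]mulrCA => /(mulfI e0) <-.
by rewrite mulrA sg2 mul1r.
Qed.

Lemma frame_star_out (Y : 'I_3 -> 'I_3 -> R) G a c :
  (forall k l c, G k l c = - G l k c) ->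
  (forall k c, Y k c = vol * \sum_l \sum_m (hinv (n1 k) l * hinv (n2 k) m) * G l m c) ->
  fr1 Y a c = sg * fr2 G (n1 a) (n2 a) c.
Proof.
move=> hG hY; pose Gf s t := fr2 G s t c.
have Ga s t : Gf s t = - Gf t s by rewrite /Gf fr2_anti.
have Gz s : Gf s s = 0 by have := Ga s s; lra.
have st k : \sum_l \sum_m (hinv (n1 k) l * hinv (n2 k) m) * G l m c =
    \sum_s \sum_t E s (n1 k) * E t (n2 k) * Gf s t.
  rewrite /hinv /Gf /fr2; move: (n1 k) (n2 k) => k1 k2.
  transitivity (\sum_l \sum_m \sum_s \sum_t
     E s k1 * E t k2 * (E s l * E t m * G l m c)).
    apply: eq_bigr => l _; apply: eq_bigr => m _.
    rewrite !mulr_suml; apply: eq_bigr => s _; rewrite mulr_sumr mulr_suml.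
    by apply: eq_bigr => t _; ring.
  under eq_bigr do rewrite exchange_big /=.
  rewrite exchange_big /=; apply: eq_bigr => s _.
  under eq_bigr do rewrite exchange_big /=.
  rewrite exchange_big /=; apply: eq_bigr => t _.
  by rewrite mulr_sumr; apply: eq_bigr => l _; rewrite mulr_sumr.
have Yk k : Y k c = vol * \sum_u (e k u / dete e) * Gf (n1 u) (n2 u).
  rewrite hY st; congr (_ * _).
  under [RHS]eq_bigr do rewrite -Einv_minor.
  rewrite !sum3 !Gz (Ga i1 i0) (Ga i2 i1) (Ga i2 i0) /=.
  rewrite -[n1 i0]/i1 -[n2 i0]/i2 -[n1 i1]/i2 -[n2 i1]/i0 -[n1 i2]/i0 -[n2 i2]/i1.
  by ring.
rewrite /fr1 (eq_bigr _ (fun k _ => congr1 ( *%R (E a k)) (Yk k))) vole.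
transitivity (sg * \sum_u (\sum_k E a k * e k u) * Gf (n1 u) (n2 u)).
  by rewrite !sum3; field.
congr (_ * _); rewrite (bigD1 a) //= [X in _ + X]big1 => [|u ua]; last first.
  by rewrite Einv_l eq_sym (negbTE ua) mul0r.
by rewrite Einv_l eqxx mul1r addr0.
Qed.

End Fixed.
End FrameAlgebra.

(** * The system on a chart *)

Section Fields.
Context {R : realType}.
Implicit Types (x : 'rV[R]_3) (y : R) (k l m a b c : 'I_3) (n p : nat).

(** The components of the fields in a chart, on which the equations are
    scalar: [cA k c] and [cP k c] are the coordinates of A_k and Phi_k in the Lie
    algebra, [cf c] those of phi_y, [cvol] is the volume density of X and
    [cdg k l] stands for the k-th derivative of vol times the (k, l) entry of the
    inverse metric. *)
Record local_fields := LocalFields {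
  cU : set 'rV[R]_3;
  ce : 'I_3 -> 'I_3 -> 'rV[R]_3 -> R;
  cw : 'I_3 -> 'I_3 -> 'rV[R]_3 -> R;
  cvol : 'rV[R]_3 -> R;
  cdg : 'I_3 -> 'I_3 -> 'rV[R]_3 -> R;
  cA : 'I_3 -> 'I_3 -> 'rV[R]_(3 + 1) -> R;
  cP : 'I_3 -> 'I_3 -> 'rV[R]_(3 + 1) -> R;
  cf : 'I_3 -> 'rV[R]_(3 + 1) -> R;
  cdep : nat -> nat;
  ca : nat -> nat -> 'I_3 -> 'I_3 -> 'rV[R]_3 -> R;
  cb : nat -> nat -> 'I_3 -> 'I_3 -> 'rV[R]_3 -> R;
  cg : nat -> nat -> 'I_3 -> 'rV[R]_3 -> R }.

Definition at2 (T : Type) (F : 'I_3 -> 'I_3 -> T -> R) (z : T) k c := F k c z.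
(** The inverse of the metric with matrix e e^T. *)
Definition hup (e : 'I_3 -> 'I_3 -> R) k l := \sum_a Einv e a k * Einv e a l.

(** The volume is only tied to the vierbein up to sign; the sign is decided
    by the equations, in [sg1]. The last three fields are the first
    Kapustin-Witten equation for two directions in X, the same for one
    direction in X and d_y, and the second equation. *)
Record local_kw (K : local_fields) : Prop := LocalKW {
  kU : open (cU K);
  ke : forall k c, smooth_on (cU K) (ce K k c);
  kw : forall k c, smooth_on (cU K) (cw K k c);
  kA : forall k c, smooth_on (cyl (cU K)) (cA K k c);
  kP : forall k c, smooth_on (cyl (cU K)) (cP K k c);
  kf : forall c, smooth_on (cyl (cU K)) (cf K c);
  kca : forall n p k c, smooth_on (cU K) (ca K n p k c);
  kcb : forall n p k c, smooth_on (cU K) (cb K n p k c);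
  kcg : forall n p c, smooth_on (cU K) (cg K n p c);
  kdet : forall x, cU K x -> dete (at2 (ce K) x) != 0;
  kvol : forall x, cU K x -> cvol K x ^+ 2 = dete (at2 (ce K) x) ^+ 2;
  kexpA : forall k c, expansion (cU K) (fun z => cA K k c z - cw K k c (xpart z))
    succn (cdep K) (fun n p => ca K n p k c);
  kexpP : forall k c,
    expansion (cU K) (fun z => cP K k c z - (ypart z)^-1 * ce K k c (xpart z))
    succn (cdep K) (fun n p => cb K n p k c);
  kexpf : forall c, expansion (cU K) (cf K c) succn (cdep K) (fun n p => cg K n p c);
  kK1 : forall x y, cU K x -> 0 < y -> forall q c, let z := xy x y in
    cvol K x * (\sum_k hup (at2 (ce K) x) q k * (partial ydir (cP K k c) z
        - partial (xdir k) (cf K c) z - cr (at2 (cA K) z k) ((cf K)^~ z) c))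
    = partial (xdir (n1 q)) (cA K (n2 q) c) z - partial (xdir (n2 q)) (cA K (n1 q) c) z
      + cr (at2 (cA K) z (n1 q)) (at2 (cA K) z (n2 q)) c
      - cr (at2 (cP K) z (n1 q)) (at2 (cP K) z (n2 q)) c;
  kK2 : forall x y, cU K x -> 0 < y -> forall k c, let z := xy x y in
    partial ydir (cA K k c) z - cr ((cf K)^~ z) (at2 (cP K) z k) c
    = cvol K x * \sum_l \sum_m
        (hup (at2 (ce K) x) (n1 k) l * hup (at2 (ce K) x) (n2 k) m) *
        (partial (xdir l) (cP K m c) z - partial (xdir m) (cP K l c) z
         + (cr (at2 (cA K) z l) (at2 (cP K) z m) c
            - cr (at2 (cA K) z m) (at2 (cP K) z l) c));
  kK3 : forall x y, cU K x -> 0 < y -> forall c, let z := xy x y in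
    \sum_k \sum_l (cdg K k l x * cP K l c z
       + cvol K x * hup (at2 (ce K) x) k l *
         (partial (xdir k) (cP K l c) z + cr (at2 (cA K) z k) (at2 (cP K) z l) c))
    + cvol K x * partial ydir (cf K c) z = 0 }.

Section Point.
Variables (K : local_fields).
Hypothesis hK : local_kw K.

(** ** Series in coordinates *)

Definition coA k c x n : {poly R} :=
  cser (cw K k c x) n + ser1 (cpoly (cdep K) (fun n p => ca K n p k c) x) n.
Definition coP k c x n : {poly R} :=
  cser (ce K k c x) n + ser1 (ser1 (cpoly (cdep K) (fun n p => cb K n p k c) x)) n.
Definition cof c x n : {poly R} := ser1 (cpoly (cdep K) (fun n p => cg K n p c) x) n.
Definition dcoA m k c x n : {poly R} := cser (partial m (cw K k c) x) n +
  ser1 (cpoly (cdep K) (fun n p => partial m (ca K n p k c)) x) n.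
Definition dcoP m k c x n : {poly R} := cser (partial m (ce K k c) x) n +
  ser1 (ser1 (cpoly (cdep K) (fun n p => partial m (cb K n p k c)) x)) n.
Definition dcof m c x n : {poly R} :=
  ser1 (cpoly (cdep K) (fun n p => partial m (cg K n p c)) x) n.

Lemma dr_smooth (U : set 'rV[R]_3) g x m : smooth_on U g -> U x ->
  is_derive x (delta_mx 0 m) g (partial m g x).
Proof. exact: (smooth_dr [::]). Qed.

Lemma dr_smooth4 (U : set 'rV[R]_3) (g : 'rV[R]_(3 + 1) -> R) x y mu :
  smooth_on (cyl U) g -> U x -> 0 < y ->
  is_derive (xy x y) (delta_mx 0 mu) g (partial mu g (xy x y)).
Proof.
move=> sg Ux y0; apply: (smooth_dr [::] mu sg).
by rewrite /cyl /= xpart_xy ypart_xy.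
Qed.

Lemma is_derive_partial (n : nat) (g : 'rV[R]_n -> R) (x0 : 'rV[R]_n) mu (d : R) :
  is_derive x0 (delta_mx 0 mu) g d ->
  is_derive x0 (delta_mx 0 mu) g (partial mu g x0).
Proof. by case=> h _; split. Qed.

Lemma partial_dr (n : nat) (g : 'rV[R]_n -> R) (x0 : 'rV[R]_n) mu (d : R) :
  is_derive x0 (delta_mx 0 mu) g d -> partial mu g x0 = d.
Proof. by case. Qed.

Lemma coef_cpoly dep (c : nat -> nat -> 'rV[R]_3 -> R) x n p :
  (cpoly dep c x n)`_p = if (p < (dep n).+1)%N then c n p x else 0.
Proof. by rewrite /cpoly coef_poly. Qed.

Lemma dr_ser1 (s : 'rV[R]_3 -> nat -> {poly R}) (ds : nat -> {poly R}) x v n p :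
  (forall n p, is_derive x v (fun x => (s x n)`_p) (ds n)`_p) ->
  is_derive x v (fun x => (ser1 (s x) n)`_p) (ser1 ds n)`_p.
Proof.
by case: n => [|n] h; [rewrite /= coef0; exact: dr_cst|exact: h].
Qed.

Lemma dr_cpoly dep (c : nat -> nat -> 'rV[R]_3 -> R) x m n p :
  (forall n p, is_derive x (delta_mx 0 m) (c n p) (partial m (c n p) x)) ->
  is_derive x (delta_mx 0 m) (fun x => (cpoly dep c x n)`_p)
    (cpoly dep (fun n p => partial m (c n p)) x n)`_p.
Proof.
move=> h; rewrite coef_cpoly; case: ifP => pn.
  by apply: dr_ext (h n p) => x'; rewrite coef_cpoly pn.
by apply: dr_ext (dr_cst 0 x _) => x'; rewrite coef_cpoly pn.
Qed.

Lemma dr_cser (g : 'rV[R]_3 -> R) x v (d : R) n p :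
  is_derive x v g d ->
  is_derive x v (fun x => (cser (g x) n)`_p) (cser d n)`_p.
Proof.
rewrite /cser; case: eqP => _ h.
  rewrite coefC; case: eqP => p0.
    by apply: dr_ext h => x'; rewrite coefC p0.
  by apply: dr_ext (dr_cst 0 x v) => x'; rewrite coefC; case: eqP.
by rewrite coef0; exact: dr_cst.
Qed.

Lemma dr_coA m k c x n p : cU K x ->
  is_derive x (delta_mx 0 m) (fun x => (coA k c x n)`_p) (dcoA m k c x n)`_p.
Proof.
move=> Ux; rewrite /dcoA coefD.
apply: (dr_ext (f := fun x => (cser (cw K k c x) n)`_p +
  (ser1 (cpoly (cdep K) (fun n p => ca K n p k c) x) n)`_p)).
  by move=> x'; rewrite coefD.
apply: drD; first exact/dr_cser/(dr_smooth _ (kw hK k c)).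
by apply: dr_ser1 => n' p'; apply: dr_cpoly => *; exact: (dr_smooth _ (kca hK _ _ _ _)).
Qed.

Lemma dr_coP m k c x n p : cU K x ->
  is_derive x (delta_mx 0 m) (fun x => (coP k c x n)`_p) (dcoP m k c x n)`_p.
Proof.
move=> Ux; rewrite /dcoP coefD.
apply: (dr_ext (f := fun x => (cser (ce K k c x) n)`_p +
  (ser1 (ser1 (cpoly (cdep K) (fun n p => cb K n p k c) x)) n)`_p)).
  by move=> x'; rewrite coefD.
apply: drD; first exact/dr_cser/(dr_smooth _ (ke hK k c)).
by apply: dr_ser1 => n' p'; apply: dr_ser1 => n'' p''; apply: dr_cpoly => *;
  exact: (dr_smooth _ (kcb hK _ _ _ _)).
Qed.

Lemma dr_cof m c x n p : cU K x ->
  is_derive x (delta_mx 0 m) (fun x => (cof c x n)`_p) (dcof m c x n)`_p.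
Proof.
move=> Ux; apply: dr_ser1 => n' p'; apply: dr_cpoly => *.
exact: (dr_smooth _ (kcg hK _ _ _)).
Qed.

(** ** The fields at a point, as functions of y *)

Section Asym.
Variable x : 'rV[R]_3.
Hypothesis Ux : cU K x.

Let fA k c (z : 'rV[R]_(3 + 1)) := cA K k c z - cw K k c (xpart z).
Let fP k c (z : 'rV[R]_(3 + 1)) := cP K k c z - (ypart z)^-1 * ce K k c (xpart z).

Let dr_wx k c y m : is_derive (xy x y) (delta_mx 0 (xdir m))
  (fun z => cw K k c (xpart z)) (partial m (cw K k c) x).
Proof. by apply/dr_xpart; apply: dr_smooth (kw hK k c) Ux. Qed.

Let dr_ex k c y m : is_derive (xy x y) (delta_mx 0 (xdir m))
  (fun z => (ypart z)^-1 * ce K k c (xpart z)) (y^-1 * partial m (ce K k c) x).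
Proof.
apply/dr_x; apply: dr_ext (drZ y^-1 (dr_smooth m (ke hK k c) Ux)) => x'.
by rewrite xpart_xy ypart_xy.
Qed.

Let dr_ey k c y : 0 < y -> is_derive (xy x y) (delta_mx 0 ydir)
  (fun z => (ypart z)^-1 * ce K k c (xpart z)) (- y ^- 2 * ce K k c x).
Proof.
move=> y0; apply/dr_y.
have h : is_derive y 1 (fun t : R => t^-1) (- y ^- 2 * 1).
  by apply: drV; rewrite gt_eqF.
have := drZr (ce K k c x) h; rewrite mulr1; apply: dr_ext => t.
by rewrite xpart_xy ypart_xy.
Qed.

Let dr_fAx k c y m : 0 < y -> is_derive (xy x y) (delta_mx 0 (xdir m)) (fA k c)
  (partial (xdir m) (cA K k c) (xy x y) - partial m (cw K k c) x).
Proof. by move=> y0; apply: drB => //; exact: dr_smooth4 (kA hK k c) Ux y0. Qed.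

Let dr_fAy k c y : 0 < y -> is_derive (xy x y) (delta_mx 0 ydir) (fA k c)
  (partial ydir (cA K k c) (xy x y) - 0).
Proof.
by move=> y0; apply: drB; [exact: dr_smooth4 (kA hK k c) Ux y0|exact: dr_xpart_y].
Qed.

Let dr_fPx k c y m : 0 < y -> is_derive (xy x y) (delta_mx 0 (xdir m)) (fP k c)
  (partial (xdir m) (cP K k c) (xy x y) - y^-1 * partial m (ce K k c) x).
Proof. by move=> y0; apply: drB => //; exact: dr_smooth4 (kP hK k c) Ux y0. Qed.

Let dr_fPy k c y : 0 < y -> is_derive (xy x y) (delta_mx 0 ydir) (fP k c)
  (partial ydir (cP K k c) (xy x y) - (- y ^- 2 * ce K k c x)).
Proof. by move=> y0; apply: drB; [exact: dr_smooth4 (kP hK k c) Ux y0|exact: dr_ey]. Qed.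

Lemma split_dir (T : 'I_(3 + 1) -> Prop) :
  (forall m, T (xdir m)) -> T ydir -> forall mu, T mu.
Proof.
move=> h1 h2 mu; rewrite -[mu]splitK; case: (fintype.split mu) => i /=; first exact: h1.
by rewrite (ord1 i); exact: h2.
Qed.

Let dr_fA k c y mu : 0 < y ->
  is_derive (xy x y) (delta_mx 0 mu) (fA k c) (partial mu (fA k c) (xy x y)).
Proof.
move=> y0; move: mu; apply: split_dir => [m|].
  exact: is_derive_partial (dr_fAx k c m y0).
exact: is_derive_partial (dr_fAy k c y0).
Qed.

Let dr_fP k c y mu : 0 < y ->
  is_derive (xy x y) (delta_mx 0 mu) (fP k c) (partial mu (fP k c) (xy x y)).
Proof.
move=> y0; move: mu; apply: split_dir => [m|].
  exact: is_derive_partial (dr_fPx k c m y0).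
exact: is_derive_partial (dr_fPy k c y0).
Qed.

Let dr_f c y mu : 0 < y ->
  is_derive (xy x y) (delta_mx 0 mu) (cf K c) (partial mu (cf K c) (xy x y)).
Proof. by move=> y0; exact: dr_smooth4 (kf hK c) Ux y0. Qed.

Let dra k c n p m := dr_smooth m (kca hK n p k c) Ux.
Let drb k c n p m := dr_smooth m (kcb hK n p k c) Ux.
Let drg c n p m := dr_smooth m (kcg hK n p c) Ux.

Lemma asymA k c : asym (fun y => cA K k c (xy x y)) (coA k c x).
Proof.
have h := asymD (asym_cst (cw K k c x)) (asym_value (kexpA hK k c) Ux).
by apply: asym_gt0 h => y _; rewrite xpart_xy addrC subrK.
Qed.

Lemma asym_dA m k c :
  asym (fun y => partial (xdir m) (cA K k c) (xy x y)) (dcoA m k c x).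
Proof.
have h := asymD (asym_cst (partial m (cw K k c) x))
  (asym_dx (kexpA hK k c) Ux (dr_fA k c) (dra k c) m).
apply: asym_gt0 h => y y0.
by rewrite (partial_dr (dr_fAx k c m y0)) addrC subrK.
Qed.

Lemma asym_yA k c :
  asym (fun y => y * partial ydir (cA K k c) (xy x y)) (theta (coA k c x)).
Proof.
have h := asym_ydy (kexpA hK k c) Ux (dr_fA k c).
apply: asym_gt0 (asym_ext _ h) => [y y0|n].
  by rewrite (partial_dr (dr_fAy k c y0)) subr0.
rewrite /theta /coA /cser; case: n => [|n] /=; last by rewrite add0r.
by rewrite !mulr0n addr0 derivC deriv0.
Qed.

Lemma asymP k c : asym (fun y => y * cP K k c (xy x y)) (coP k c x).
Proof.
have h := asymD (asym_cst (ce K k c x)) (asym_y (asym_value (kexpP hK k c) Ux)).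
apply: asym_gt0 h => y y0; rewrite xpart_xy ypart_xy mulrBr mulVKf ?gt_eqF//.
by rewrite addrC subrK.
Qed.

Lemma asym_dP m k c :
  asym (fun y => y * partial (xdir m) (cP K k c) (xy x y)) (dcoP m k c x).
Proof.
have h := asymD (asym_cst (partial m (ce K k c) x))
  (asym_y (asym_dx (kexpP hK k c) Ux (dr_fP k c) (drb k c) m)).
apply: asym_gt0 h => y y0.
rewrite (partial_dr (dr_fPx k c m y0)) mulrBr mulVKf ?gt_eqF//.
by rewrite addrC subrK.
Qed.

Lemma asym_yP k c : asym (fun y => y ^+ 2 * partial ydir (cP K k c) (xy x y))
  (fun n => theta (coP k c x) n - coP k c x n).
Proof.
have h := asymB (asym_y (asym_ydy (kexpP hK k c) Ux (dr_fP k c)))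
  (asym_cst (ce K k c x)).
apply: asym_gt0 (asym_ext _ h) => [y y0|n].
  rewrite (partial_dr (dr_fPy k c y0)).
  have yn : y != 0 by rewrite gt_eqF.
  by field.
rewrite /theta /coP /cser; case: n => [|n] /=.
  by rewrite mulr0n addr0 derivC !add0r.
by rewrite subr0 !add0r mulrSr; ring.
Qed.

Lemma asymf c : asym (fun y => cf K c (xy x y)) (cof c x).
Proof. exact: asym_value (kexpf hK c) Ux. Qed.

Lemma asym_df m c : asym (fun y => partial (xdir m) (cf K c) (xy x y)) (dcof m c x).
Proof. exact: asym_dx (kexpf hK c) Ux (dr_f c) (drg c) m. Qed.

Lemma asym_yf c :
  asym (fun y => y * partial ydir (cf K c) (xy x y)) (theta (cof c x)).
Proof. exact: asym_ydy (kexpf hK c) Ux (dr_f c). Qed.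

End Asym.

(** ** The equations in the frame of the vierbein *)

Definition frs (e : 'I_3 -> 'I_3 -> R) (S : 'I_3 -> 'I_3 -> nat -> {poly R}) a c n :
  {poly R} := \sum_k Einv e a k *: S k c n.
Definition frs2 (e : 'I_3 -> 'I_3 -> R) (S : 'I_3 -> 'I_3 -> 'I_3 -> nat -> {poly R})
  b a c n : {poly R} := \sum_k \sum_l (Einv e b k * Einv e a l) *: S k l c n.

Lemma asym_fr1 e (u : 'I_3 -> 'I_3 -> R -> R) S a c :
  (forall k c, asym (u k c) (S k c)) ->
  asym (fun y => fr1 e (fun k c => u k c y) a c) (frs e S a c).
Proof. by move=> h; apply: asym_sum => k; apply: asymZ. Qed.

Lemma asym_fr2 e (u : 'I_3 -> 'I_3 -> 'I_3 -> R -> R) S b a c :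
  (forall k l c, asym (u k l c) (S k l c)) ->
  asym (fun y => fr2 e (fun k l c => u k l c y) b a c) (frs2 e S b a c).
Proof. by move=> h; apply: asym_sum => k; apply: asym_sum => l; apply: asymZ. Qed.

Lemma asym_cr (u v : 'I_3 -> R -> R) S T c :
  (forall c, asym (u c) (S c)) -> (forall c, asym (v c) (T c)) ->
  asym (fun y => cr (u^~ y) (v^~ y) c) (crs S T c).
Proof. by move=> hu hv; apply: asymB; apply: asymM. Qed.

Lemma theta_frs e (S : 'I_3 -> 'I_3 -> nat -> {poly R}) a c n :
  frs e (fun k c => theta (S k c)) a c n = theta (frs e S a c) n.
Proof.
rewrite /theta /frs !sum3 !derivD !derivZ !mulrnDl !scalerDr -!scalerMnr.
have add6 (p p' q q' r r' : {poly R}) :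
  p + p' + (q + q') + (r + r') = p + q + r + (p' + q' + r') by ring.
exact: add6.
Qed.

(** The first-order coefficient (1 / vol) d_k (vol g^(kl)) of the
    codifferential, in the frame. *)
Definition kap x a : R :=
  \sum_k \sum_l cdg K k l x / cvol K x * ce K l a x.

(** The derivatives are those of the coordinate components, contracted with
    the frame afterwards, so that the frame is not differentiated. *)
Definition Fr x : frame_series := let e := at2 (ce K) x in FrameSeries
  (frs e (fun k c => coA k c x)) (frs e (fun k c => coP k c x)) (cof^~ x)
  (frs2 e (fun m k c => dcoA m k c x)) (frs2 e (fun m k c => dcoP m k c x))
  (fun b c n => \sum_k Einv e b k *: dcof k c x n).

Section FrameEquations.
Variable x : 'rV[R]_3.
Hypothesis Ux : cU K x.
Local Notation e := (at2 (ce K) x).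
Let e0 := kdet hK Ux.
Let sg := cvol K x / dete e.

Lemma sg_sq : sg * sg = 1.
Proof.
by rewrite /sg mulf_div -!expr2 kvol// divff// expf_neq0.
Qed.

Lemma vol_sg : cvol K x = sg * dete e.
Proof. by rewrite /sg divfK. Qed.

Lemma vol_neq0 : cvol K x != 0.
Proof. by rewrite -sqrf_eq0 kvol// sqrf_eq0. Qed.

Let hP a d := asym_fr1 e a d (asymP Ux).
Let hA a d := asym_fr1 e a d (asymA Ux).
Let hdP b a d := asym_fr2 e b a d (asym_dP Ux).
Let hdA b a d := asym_fr2 e b a d (asym_dA Ux).

(** Both sides are expansions of the same function of y; the function
    identity is the equation on the chart read in the frame by
    [frame_star_out]. *)
Lemma frame_eqA n a c : theta (sA (Fr x) a c) n = crs (sf (Fr x)) (sPsi (Fr x) a) c n +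
    sg *: (dsPsi (Fr x) (n1 a) (n2 a) c n - dsPsi (Fr x) (n2 a) (n1 a) c n +
           (crs (sA (Fr x) (n1 a)) (sPsi (Fr x) (n2 a)) c n
            - crs (sA (Fr x) (n2 a)) (sPsi (Fr x) (n1 a)) c n)).
Proof.
rewrite /Fr /= -theta_frs.
have L := asym_fr1 e a c (asym_yA Ux).
have Q := asymD (asym_cr c (asymf Ux) (hP a)) (asymZ sg (asymD
    (asymB (hdP (n1 a) (n2 a) c) (hdP (n2 a) (n1 a) c))
    (asymB (asym_cr c (hA (n1 a)) (hP (n2 a))) (asym_cr c (hA (n2 a)) (hP (n1 a)))))).
move: n; apply: (asym_eq L Q) => y y0; set z := xy x y.
pose G l m c := partial (xdir l) (cP K m c) z - partial (xdir m) (cP K l c) z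
  + (cr (at2 (cA K) z l) (at2 (cP K) z m) c - cr (at2 (cA K) z m) (at2 (cP K) z l) c).
have hG l m d : G l m d = - G m l d by rewrite /G; ring.
have := frame_star_out e0 vol_sg a c hG (kK2 hK Ux y0).
rewrite (fr1_flowA e (fun k c => partial ydir (cA K k c) z) (at2 (cP K) z)).
rewrite (fr2_curl e (fun k l c => partial (xdir k) (cP K l c) z) (at2 (cA K) z)
  (at2 (cP K) z)) => /(canRL (subrK _)) h.
by rewrite fr1Z h /cr !fr2Z !fr1Z /at2; ring.
Qed.

Lemma frame_eqPsi n a c : theta (sPsi (Fr x) a c) n - sPsi (Fr x) a c n =
  shift2 (fun j => dsf (Fr x) a c j + crs (sA (Fr x) a) (sf (Fr x)) c j) n +
  sg *: (shift2 (fun j => dsA (Fr x) (n1 a) (n2 a) c j - dsA (Fr x) (n2 a) (n1 a) c j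
                          + crs (sA (Fr x) (n1 a)) (sA (Fr x) (n2 a)) c j) n
         - crs (sPsi (Fr x) (n1 a)) (sPsi (Fr x) (n2 a)) c n).
Proof.
rewrite /Fr /= -theta_frs.
have L := asym_fr1 e a c (asym_yP Ux).
have Q := asymD
  (asym_y2 (asymD (asym_fr1 e a c (fun k c => asym_df Ux k c)) (asym_cr c (hA a) (asymf Ux))))
  (asymZ sg (asymB
    (asym_y2 (asymD (asymB (hdA (n1 a) (n2 a) c) (hdA (n2 a) (n1 a) c))
                    (asym_cr c (hA (n1 a)) (hA (n2 a)))))
    (asym_cr c (hP (n1 a)) (hP (n2 a))))).
have -> : frs e (fun k c => theta (coP k c x)) a c n - frs e (fun k c => coP k c x) a c n
    = frs e (fun k c n => theta (coP k c x) n - coP k c x n) a c n.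
  by rewrite /frs -sumrB; apply: eq_bigr => k _; rewrite scalerBr.
move: n; apply: (asym_eq L Q) => y y0; set z := xy x y.
pose G l m c := partial (xdir l) (cA K m c) z - partial (xdir m) (cA K l c) z
  + cr (at2 (cA K) z l) (at2 (cA K) z m) c - cr (at2 (cP K) z l) (at2 (cP K) z m) c.
have hG l m d : G l m d = - G m l d by rewrite /G /cr; ring.
have := frame_star_in e0 sg_sq vol_sg a c hG (kK1 hK Ux y0).
rewrite (fr1_flowP e (fun k c => partial ydir (cP K k c) z)
  (fun k c => partial (xdir k) (cf K c) z) (at2 (cA K) z)).
rewrite (fr2_curv e (fun k l c => partial (xdir k) (cA K l c) z) (at2 (cA K) z)
  (at2 (cP K) z)) => /(canRL (subrK _)) /(canRL (subrK _)) h.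
by rewrite fr1Z h /cr !fr1Z /at2; ring.
Qed.

Lemma frame_eqf n c : theta (sf (Fr x) c) n =
  - \sum_a (dsPsi (Fr x) a a c n + crs (sA (Fr x) a) (sPsi (Fr x) a) c n
            + kap x a *: sPsi (Fr x) a c n).
Proof.
rewrite /Fr /=.
have Q := asymN (asym_sum (fun a => asymD (asymD (hdP a a c)
  (asym_cr c (hA a) (hP a))) (asymZ (kap x a) (hP a c)))).
move: n; apply: (asym_eq (asym_yf Ux c) Q) => y y0; set z := xy x y.
have v0 := vol_neq0.
have e1 : \sum_a kap x a * fr1 e (at2 (cP K) z) a c =
    \sum_k \sum_l cdg K k l x / cvol K x * cP K l c z.
  transitivity (\sum_a \sum_k \sum_l cdg K k l x / cvol K x *
      (ce K l a x * fr1 e (at2 (cP K) z) a c)).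
    apply: eq_bigr => a _; rewrite /kap mulr_suml; apply: eq_bigr => k _.
    by rewrite mulr_suml; apply: eq_bigr => l _; rewrite mulrA.
  rewrite exchange_big; apply: eq_bigr => k _.
  rewrite exchange_big; apply: eq_bigr => l _.
  by rewrite -mulr_sumr (fr1K e0 (at2 (cP K) z) l c).
have e2 := fr2_trace e (fun k l c => partial (xdir k) (cP K l c) z
  + cr (at2 (cA K) z k) (at2 (cP K) z l) c) c.
have := kK3 hK Ux y0 c; rewrite -/z /=.
have -> : \sum_k \sum_l (cdg K k l x * cP K l c z + cvol K x * hup e k l *
     (partial (xdir k) (cP K l c) z + cr (at2 (cA K) z k) (at2 (cP K) z l) c)) =
   cvol K x * (\sum_a kap x a * fr1 e (at2 (cP K) z) a c +
     \sum_a fr2 e (fun k l c => partial (xdir k) (cP K l c) z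
       + cr (at2 (cA K) z k) (at2 (cP K) z l) c) a a c).
  rewrite e1 e2 -big_split mulr_sumr; apply: eq_bigr => k _.
  rewrite -big_split mulr_sumr; apply: eq_bigr => l _.
  by rewrite -/(hup e k l) /=; field.
rewrite -mulrDr => /eqP; rewrite mulf_eq0 (negbTE v0) /= addrC addr_eq0 => /eqP ->.
rewrite -big_split mulrN mulr_sumr; congr (- _); apply: eq_bigr => a _.
rewrite (fr2_cov e (fun k l c => partial (xdir k) (cP K l c) z) (at2 (cA K) z)
  (at2 (cP K) z)).
by rewrite !fr2Z /cr !fr1Z /at2 /=; ring.
Qed.

Lemma frame_eqs_Fr : frame_eqs sg (kap x) (Fr x).
Proof. by split=> *; [exact: frame_eqA|exact: frame_eqPsi|exact: frame_eqf]. Qed.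

Definition wF b c := fr1 e (at2 (cw K) x) b c.
Definition dwF b a c := fr2 e (fun m k c => partial m (cw K k c) x) b a c.
Definition deF b a c := fr2 e (fun m k c => partial m (ce K k c) x) b a c.

Lemma frame_init_Fr : frame_init wF dwF deF (Fr x).
Proof.
split => /=.
- move=> a c; rewrite /frs /wF /fr1 rmorph_sum; apply: eq_bigr => k _.
  by rewrite /coA /= addr0 -mul_polyC -polyCM.
- move=> a c; rewrite (polyC_natb (a == c)) -(Einv_l e0) rmorph_sum; apply: eq_bigr => k _.
  by rewrite /coP /= addr0 -mul_polyC -polyCM.
- by [].
- move=> b a c; rewrite /frs2 /dwF /fr2 rmorph_sum; apply: eq_bigr => k _.
  rewrite rmorph_sum; apply: eq_bigr => l _.
  by rewrite /dcoA /= addr0 -mul_polyC -polyCM.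
- move=> b a c; rewrite /frs2 /deF /fr2 rmorph_sum; apply: eq_bigr => k _.
  rewrite rmorph_sum; apply: eq_bigr => l _.
  by rewrite /dcoP /= addr0 -mul_polyC -polyCM.
- by move=> b c; rewrite big1// => k _; rewrite /dcof /= scaler0.
Qed.

Lemma sg1 : sg = 1.
Proof. exact: orientation frame_eqs_Fr frame_init_Fr. Qed.

End FrameEquations.

End Point.
End Fields.

(** * The recursion on a chart *)

Section Recursion.
Context {R : realType}.
Variables (K : @local_fields R).
Hypothesis hK : local_kw K.
Implicit Types (x : 'rV[R]_3) (k l m a b c : 'I_3) (n p : nat).
Local Notation U := (cU K).
Local Notation e x := (at2 (ce K) x).

Lemma dr_eq0 (g : 'rV[R]_3 -> R) x v (d : R) : U x ->
  (forall x', U x' -> g x' = 0) -> is_derive x v g d -> d = 0.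
Proof.
move=> Ux g0 h; apply: (dr_unique h); apply: dr_near (dr_cst 0 x v).
by apply: filterS (open_nbhs_nbhs (conj (kU hK) Ux)) => x' /g0 ->.
Qed.

Lemma dr_const (g : 'rV[R]_3 -> R) (r : R) x v (d : R) : U x ->
  (forall x', U x' -> g x' = r) -> is_derive x v g d -> d = 0.
Proof.
move=> Ux gr h; apply: (@dr_eq0 (fun x => g x - r) x v) => //.
  by move=> x' /gr ->; rewrite subrr.
by have := drB h (dr_cst r x v); rewrite subr0.
Qed.

(** A coefficient that vanishes on an open set has vanishing derivatives. *)
Lemma good_dr D n (s : 'rV[R]_3 -> {poly R}) (ds : {poly R}) x v : U x ->
  (forall x', U x' -> good D n (s x')) ->
  (forall p, is_derive x v (fun x => (s x)`_p) ds`_p) -> good D n ds.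
Proof.
move=> Ux hs hd; split=> [on|].
  apply/polyP => p; rewrite coef0; apply: dr_eq0 Ux _ (hd p) => x' Ux'.
  by have [/(_ on) -> _] := hs x' Ux'; rewrite coef0.
apply/leq_sizeP => p pn; apply: dr_eq0 Ux _ (hd p) => x' Ux'.
by have [_ sx] := hs x' Ux'; exact: (leq_sizeP _ _ sx).
Qed.

Lemma good_frs D n (E : 'I_3 -> 'I_3 -> R) S a c :
  (forall k c, good D n (S k c n)) -> good D n (frs E S a c n).
Proof. by move=> h; apply: good_sum => k; apply: goodZ. Qed.

Lemma good_frs2 D n (E : 'I_3 -> 'I_3 -> R) S b a c :
  (forall m k c, good D n (S m k c n)) -> good D n (frs2 E S b a c n).
Proof. by move=> h; apply: good_sum => k; apply: good_sum => l; apply: goodZ. Qed.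

Lemma coef_frs (E : 'I_3 -> 'I_3 -> R) S a c n p :
  (frs E S a c n)`_p = fr1 E (fun k c => (S k c n)`_p) a c.
Proof. by rewrite coef_sum; apply: eq_bigr => k _; rewrite coefZ. Qed.

Lemma coef_frs2 (E : 'I_3 -> 'I_3 -> R) S b a c n p :
  (frs2 E S b a c n)`_p = fr2 E (fun m k c => (S m k c n)`_p) b a c.
Proof.
rewrite coef_sum; apply: eq_bigr => k _.
by rewrite coef_sum; apply: eq_bigr => l _; rewrite coefZ.
Qed.

Lemma frsK (E : 'I_3 -> 'I_3 -> R) (S : 'I_3 -> 'I_3 -> nat -> {poly R}) k c n :
  dete E != 0 -> S k c n = \sum_a E k a *: frs E S a c n.
Proof.
move=> E0; apply/polyP => p; rewrite coef_sum.
under eq_bigr do rewrite coefZ coef_frs.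
by rewrite (fr1K E0 (fun k c => (S k c n)`_p)).
Qed.

Lemma good_unframe D n (E : 'I_3 -> 'I_3 -> R) (S : 'I_3 -> 'I_3 -> nat -> {poly R}) :
  dete E != 0 -> (forall a c, good D n (frs E S a c n)) ->
  forall k c, good D n (S k c n).
Proof.
by move=> E0 h k c; rewrite (frsK S k c n E0); apply: good_sum => a; apply: goodZ.
Qed.

(** The recursion runs on the whole chart at once, because the sources at
    order n contain x-derivatives of lower orders. *)
Record good_all (D : nat -> nat) n : Prop := GoodAll {
  gaA : forall x k c, U x -> good D n (coA K k c x n);
  gaP : forall x k c, U x -> good D n (coP K k c x n);
  gaf : forall x c, U x -> good D n (cof K c x n) }.

Section Induction.
Variable D : nat -> nat.
Hypothesis DD : forall j k : nat, (D j + D k <= D (j + k))%N.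

Let eqs x (Ux : U x) : frame_eqs 1 (kap K x) (Fr K x).
Proof. by have := frame_eqs_Fr hK Ux; rewrite (sg1 hK Ux). Qed.

Lemma good_all_upto n x : U x -> (forall j, (j < n)%N -> good_all D j) ->
  good_upto D n (Fr K x).
Proof.
move=> Ux ih; split=> /=.
- by move=> a c j /ih[h _ _]; apply: good_frs => *; exact: h.
- by move=> a c j /ih[_ h _]; apply: good_frs => *; exact: h.
- by move=> c j /ih[_ _ h]; exact: h.
- move=> b a c j /ih[h _ _]; apply: good_frs2 => m k d.
  by apply: good_dr Ux (fun x' => @h x' k d) (fun p => dr_coA hK m k d j p Ux).
- move=> b c j /ih[_ _ h]; apply: good_sum => k; apply: goodZ.
  by apply: good_dr Ux (fun x' => @h x' c) (fun p => dr_cof hK k c j p Ux).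
Qed.

Lemma good_all0 : good_all D 0.
Proof.
by split=> *; rewrite ?/coA ?/coP /= ?addr0; split=> //;
  rewrite ?size_poly0// /cser /= (leq_trans (size_polyC_leq1 _)).
Qed.

Hypothesis D1 : D 1 = 0%N.
Hypothesis order2 : good_all D 1 -> forall x, U x ->
  (forall a c, good D 2 (sPsi (Fr K x) a c 2)) /\
  trace_const (wF K x) (deF K x) (fun a c => (sPsi (Fr K x) a c 2)`_(D 2))
    (fun b a c => (dsPsi (Fr K x) b a c 2)`_(D 2)).

(** Within one order, Psi is found first, then A and phi_y, whose sources
    contain the derivatives of Psi at the same order. *)
Lemma good_all_ind n : good_all D n.
Proof.
elim/ltn_ind: n => n ih; case: (posnP n) => [->|n0]; first exact: good_all0.
have hup x (Ux : U x) := good_all_upto Ux ih.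
have hpsi x (Ux : U x) a c : good D n (sPsi (Fr K x) a c n).
  have [n2|n2] := eqVneq n 2%N; last first.
    have q := stepPsi DD (eqs Ux) (frame_init_Fr hK Ux) n0 n2 (hup x Ux).
    exact: q.
  have h1 : good_all D 1 by apply: ih; rewrite n2.
  by have [h _] := order2 h1 Ux; rewrite n2; exact: h.
have hcoP x k c (Ux : U x) : good D n (coP K k c x n).
  by apply: (good_unframe (kdet hK Ux) (S := fun k c => coP K k c x)); exact: hpsi.
have hdpsi x (Ux : U x) b a c : good D n (dsPsi (Fr K x) b a c n).
  apply: good_frs2 => m k d.
  by apply: good_dr Ux (fun x' => @hcoP x' k d) (fun p => dr_coP hK m k d n p Ux).
have hAf x (Ux : U x) : (forall a c, good D n (sA (Fr K x) a c n)) /\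
    forall c, good D n (sf (Fr K x) c n).
  apply: (stepA DD (eqs Ux) (frame_init_Fr hK Ux) n0 (hup x Ux)).
  - by move=> a c; exact: hpsi.
  - by move=> b a c; exact: hdpsi.
  - move=> n2; split=> // p ->; have h1 : good_all D 1 by apply: ih; rewrite n2.
    by have [_ h] := order2 h1 Ux.
split=> [x k c Ux|x k c Ux|x c Ux].
- apply: (good_unframe (kdet hK Ux) (S := fun k c => coA K k c x)).
  by have [h _] := hAf x Ux; exact: h.
- exact: hcoP.
- by have [_ h] := hAf x Ux; exact: h.
Qed.

End Induction.

(** ** Derivatives of the inverse vierbein and of the trace *)

Lemma dr_cr (u v : 'I_3 -> 'rV[R]_3 -> R) (du dv : 'I_3 -> R) x w c :
  (forall c, is_derive x w (u c) (du c)) -> (forall c, is_derive x w (v c) (dv c)) ->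
  is_derive x w (fun x => cr (u^~ x) (v^~ x) c)
    (cr du (v^~ x) c + cr (u^~ x) dv c).
Proof.
move=> hu hv; have := drB (drM (hu (n1 c)) (hv (n2 c))) (drM (hu (n2 c)) (hv (n1 c))).
by rewrite /cr; congr is_derive; ring.
Qed.

Lemma dr_Einv (E : 'I_3 -> 'I_3 -> 'rV[R]_3 -> R) (dE : 'I_3 -> 'I_3 -> R) x w a k :
  (forall k c, is_derive x w (E k c) (dE k c)) -> dete (at2 E x) != 0 ->
  exists d, is_derive x w (fun x => Einv (at2 E x) a k) d.
Proof.
move=> hE E0.
have hd := dr_sum (fun c => drM (hE i0 c) (dr_cr c (hE i1) (hE i2))).
by eexists; apply: drM (dr_cr a (hE (n1 k)) (hE (n2 k))) (drV E0 hd).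
Qed.

Lemma sum_dotl (E v : 'I_3 -> R) (B : 'I_3 -> 'I_3 -> R) :
  \sum_k E k * (\sum_d B k d * v d) = \sum_d (\sum_k E k * B k d) * v d.
Proof. by rewrite !sum3; ring. Qed.

Lemma sum_dotr (E v : 'I_3 -> R) (B : 'I_3 -> 'I_3 -> R) :
  \sum_k E k * (\sum_d v d * B k d) = \sum_d v d * (\sum_k E k * B k d).
Proof. by rewrite !sum3; ring. Qed.

Lemma fr2_fr1 (E : 'I_3 -> 'I_3 -> R) X b a c :
  fr2 E X b a c = \sum_m Einv E b m * fr1 E (X m) a c.
Proof.
rewrite /fr2 /fr1; apply: eq_bigr => m _; rewrite mulr_sumr.
by apply: eq_bigr => l _; rewrite mulrA.
Qed.

Lemma sum_trace (E D B d : 'I_3 -> 'I_3 -> R) :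
  \sum_a \sum_k ((- \sum_c D a c * E c k) * B k a + E a k * d k a) =
  \sum_a (\sum_k E a k * d k a) - \sum_a \sum_c D a c * (\sum_k E c k * B k a).
Proof. by rewrite !sum3; ring. Qed.

Lemma sum_trace2 (w : 'I_3 -> R) (T V : 'I_3 -> 'I_3 -> 'I_3 -> R)
    (W : 'I_3 -> 'I_3 -> R) :
  \sum_m w m * (\sum_a T m a a - \sum_a \sum_c V m a c * W c a) =
  \sum_c (\sum_m w m * T m c c) - \sum_c \sum_d (\sum_m w m * V m c d) * W d c.
Proof. by rewrite !sum3; ring. Qed.

Lemma sum_cr (w : 'I_3 -> R) (B : 'I_3 -> 'I_3 -> R) :
  \sum_c cr w (B c) c = \sum_c \sum_d cr w (delta c) d * B d c.
Proof. by rewrite !sum3 /cr /delta /=; ring. Qed.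

(** Symmetry in the frame means that be_kc e_lc is symmetric in k and l; this
    relation and the constancy of the trace are differentiated in the
    coordinates and then contracted with the frame. *)
Lemma trace_const_of (be : 'I_3 -> 'I_3 -> 'rV[R]_3 -> R)
    (dbe : 'I_3 -> 'I_3 -> 'I_3 -> R) (tau : R) x : U x ->
  (forall m k c, is_derive x (delta_mx 0 m) (be k c) (dbe m k c)) ->
  (forall x, U x -> forall a c,
     fr1 (e x) (at2 be x) a c = fr1 (e x) (at2 be x) c a) ->
  (forall x, U x -> \sum_a fr1 (e x) (at2 be x) a a = tau) ->
  trace_const (wF K x) (deF K x) (fr1 (e x) (at2 be x)) (fr2 (e x) dbe).
Proof.
move=> Ux hbe hsym htr; have e0 := kdet hK Ux.
have he m k c : is_derive x (delta_mx 0 m) (ce K k c) (partial m (ce K k c) x).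
  exact: dr_smooth (ke hK k c) Ux.
pose de m k c := partial m (ce K k c) x.
have Ddef b a c : deF K x b a c = fr2 (e x) de b a c by [].
have crw b (v : 'I_3 -> R) c :
    cr (wF K x b) v c + \sum_d v d * cr (wF K x b) (delta c) d = 0.
  by rewrite sum3 /cr /delta; move: c; apply: ord3P => /=; ring.
have sym2 x' (Ux' : U x') k l : \sum_c be k c x' * ce K l c x' =
    \sum_c be l c x' * ce K k c x'.
  have e0' := kdet hK Ux'.
  have h i j : \sum_c be i c x' * ce K j c x' =
      \sum_a \sum_c ce K i a x' * ce K j c x' * fr1 (e x') (at2 be x') a c.
    rewrite exchange_big; apply: eq_bigr => c _.
    rewrite -[be i c x'](fr1K e0' (at2 be x') i c) mulr_suml; apply: eq_bigr => a _.
    by rewrite /at2; ring.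
  rewrite !h exchange_big; apply: eq_bigr => c _; apply: eq_bigr => a _.
  by rewrite hsym//; ring.
have dsym m k l : \sum_c (dbe m k c * ce K l c x + be k c x * de m l c) =
    \sum_c (dbe m l c * ce K k c x + be l c x * de m k c).
  have h i j := dr_sum (fun c => drM (hbe m i c) (he m j c)).
  apply/eqP; rewrite -subr_eq0; apply/eqP.
  by apply: dr_eq0 Ux _ (drB (h k l) (h l k)) => x' Ux'; rewrite sym2// subrr.
have ctr b a c : fr2 (e x) dbe b a c + \sum_d fr1 (e x) (at2 be x) a d * fr2 (e x) de b c d =
    \sum_m Einv (e x) b m * \sum_k Einv (e x) a k * \sum_l Einv (e x) c l *
      \sum_d (dbe m k d * ce K l d x + be k d x * de m l d).
  have h m k : \sum_l Einv (e x) c l * \sum_d (dbe m k d * ce K l d x + be k d x * de m l d)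
      = dbe m k c + \sum_l Einv (e x) c l * \sum_d be k d x * de m l d.
    rewrite -{1}(contract_e e0 (dbe m k) c) -big_split /=; apply: eq_bigr => l _.
    by rewrite -mulrDr -big_split.
  under [RHS]eq_bigr do under eq_bigr do rewrite h.
  rewrite (fr2_fr1 (e x) dbe) (eq_bigr _ (fun d _ => congr1 ( *%R _) (fr2_fr1 (e x) de b c d))).
  rewrite -(sum_dotr (Einv (e x) b) (fr1 (e x) (at2 be x) a)
    (fun m d => fr1 (e x) (de m) c d)) -big_split /=.
  apply: eq_bigr => m _.
  rewrite -mulrDr; congr (_ * _).
  rewrite /fr1 -(sum_dotl (Einv (e x) a)
    (fun d => \sum_l Einv (e x) c l * de m l d) (at2 be x)) -big_split /=; apply: eq_bigr => k _.
  by rewrite -mulrDr -(sum_dotr (Einv (e x) c) (be k ^~ x) (de m)).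
split.
- by move=> a c; exact: hsym.
- move=> b a c; rewrite /gam.
  have s u v : \sum_d fr1 (e x) (at2 be x) u d * (deF K x b v d + cr (wF K x b) (delta v) d)
    = \sum_d fr1 (e x) (at2 be x) u d * fr2 (e x) de b v d
      + \sum_d fr1 (e x) (at2 be x) u d * cr (wF K x b) (delta v) d.
    by rewrite -big_split /=; apply: eq_bigr => d _; rewrite mulrDr.
  rewrite !s.
  have r u v : fr2 (e x) dbe b u v + cr (wF K x b) (fr1 (e x) (at2 be x) u) v +
     (\sum_d fr1 (e x) (at2 be x) u d * fr2 (e x) de b v d +
      \sum_d fr1 (e x) (at2 be x) u d * cr (wF K x b) (delta v) d) =
     fr2 (e x) dbe b u v + \sum_d fr1 (e x) (at2 be x) u d * fr2 (e x) de b v d.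
    by rewrite addrACA crw addr0.
  rewrite !r !ctr; apply: eq_bigr => m _; congr (_ * _).
  transitivity (\sum_k \sum_l Einv (e x) a k * (Einv (e x) c l *
      \sum_d (dbe m k d * ce K l d x + be k d x * de m l d))).
    by apply: eq_bigr => k _; rewrite mulr_sumr.
  rewrite exchange_big; apply: eq_bigr => l _; rewrite mulr_sumr.
  by apply: eq_bigr => k _; rewrite dsym mulrCA.
- move=> b; rewrite /gam.
  have [dE hdE] : exists dE : 'I_3 -> 'I_3 -> 'I_3 -> R, forall m a k,
      is_derive x (delta_mx 0 m) (fun x => Einv (e x) a k) (dE m a k).
    have h m a k := dr_Einv a k (he m) e0.
    exists (fun m a k => partial m (fun x => Einv (e x) a k) x) => m a k.
    by have [d hd] := h m a k; exact: is_derive_partial hd.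
  have inv m a c : \sum_k (dE m a k * ce K k c x + Einv (e x) a k * de m k c) = 0.
    apply: (@dr_const (fun x => \sum_k Einv (e x) a k * ce K k c x) (a == c)%:R
      x (delta_mx 0 m)) => //.
      by move=> x' Ux'; rewrite -(Einv_l (kdet hK Ux')).
    by apply: dr_sum => k; apply: drM.
  have dEE m a k : dE m a k = - \sum_c fr1 (e x) (de m) a c * Einv (e x) c k.
    have h2 : \sum_c (\sum_j dE m a j * ce K j c x) * Einv (e x) c k = dE m a k.
      under eq_bigr do rewrite mulr_suml.
      rewrite exchange_big /= (bigD1 k) //= [X in _ + X]big1 => [|j jk].
        under eq_bigr do rewrite -mulrA.
        by rewrite -mulr_sumr (Einv_r e0) eqxx mulr1 addr0.
      under eq_bigr do rewrite -mulrA.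
      by rewrite -mulr_sumr (Einv_r e0) (negbTE jk) mulr0.
    apply/eqP; rewrite -addr_eq0 -{1}h2 -big_split big1 // => c _ /=.
    by rewrite -mulrDl -big_split /= inv mul0r.
  have tr m : \sum_a \sum_k (dE m a k * be k a x + Einv (e x) a k * dbe m k a) = 0.
    apply: (@dr_const (fun x => \sum_a \sum_k Einv (e x) a k * be k a x) tau
      x (delta_mx 0 m)) => //.
    by apply: dr_sum => a; apply: dr_sum => k; apply: drM.
  have trb : \sum_c fr2 (e x) dbe b c c = \sum_c \sum_d fr2 (e x) de b c d
      * fr1 (e x) (at2 be x) d c.
    have : \sum_m Einv (e x) b m * \sum_a \sum_k
       (dE m a k * be k a x + Einv (e x) a k * dbe m k a) = 0.
      by apply: big1 => m _; rewrite tr mulr0.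
    have tm m : \sum_a \sum_k (dE m a k * be k a x + Einv (e x) a k * dbe m k a) =
        \sum_a fr1 (e x) (dbe m) a a
        - \sum_a \sum_c fr1 (e x) (de m) a c * fr1 (e x) (at2 be x) c a.
      rewrite -(sum_trace (Einv (e x)) (fr1 (e x) (de m)) (at2 be x) (dbe m)).
      by apply: eq_bigr => a _; apply: eq_bigr => k _; rewrite dEE.
    rewrite (eq_bigr _ (fun m _ => congr1 ( *%R _) (tm m))).
    rewrite (sum_trace2 (Einv (e x) b) (fun m => fr1 (e x) (dbe m))
      (fun m => fr1 (e x) (de m)) (fr1 (e x) (at2 be x))) => /eqP.
    rewrite subr_eq0 => /eqP h.
    rewrite (eq_bigr _ (fun c _ => fr2_fr1 (e x) dbe b c c)) h.
    by apply: eq_bigr => c _; apply: eq_bigr => d _; rewrite (fr2_fr1 (e x) de).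
  rewrite big_split /= trb (sum_cr (wF K x b)) -big_split; apply: eq_bigr => c _ /=.
  by rewrite -big_split; apply: eq_bigr => d _ /=; rewrite -mulrDl.
Qed.

(** ** The two gradings *)

Let Fr_eqs x (Ux : U x) : frame_eqs 1 (kap K x) (Fr K x).
Proof. by have := frame_eqs_Fr hK Ux; rewrite (sg1 hK Ux). Qed.

Let psi1 D x (Ux : U x) : good_all D 1 -> forall a c, sPsi (Fr K x) a c 1%N = 0.
Proof.
move=> h a c; apply: big1 => k _.
by have [/(_ isT) -> _] := gaP h k c Ux; rewrite scaler0.
Qed.

Lemma trace_const_coef p tau x : U x ->
  (forall x, U x -> forall a c,
     (sPsi (Fr K x) a c 2)`_p = (sPsi (Fr K x) c a 2)`_p) ->
  (forall x, U x -> (sPsi (Fr K x) i0 i0 2)`_p + (sPsi (Fr K x) i1 i1 2)`_p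
     + (sPsi (Fr K x) i2 i2 2)`_p = tau) ->
  trace_const (wF K x) (deF K x) (fun a c => (sPsi (Fr K x) a c 2)`_p)
    (fun b a c => (dsPsi (Fr K x) b a c 2)`_p).
Proof.
move=> Ux hs ht.
have E x' a c : (sPsi (Fr K x') a c 2)`_p =
    fr1 (e x') (at2 (fun k c x => (coP K k c x 2)`_p) x') a c.
  by rewrite coef_frs.
have dE b a c : (dsPsi (Fr K x) b a c 2)`_p =
    fr2 (e x) (fun m k c => (dcoP K m k c x 2)`_p) b a c by rewrite coef_frs2.
have -> : (fun a c => (sPsi (Fr K x) a c 2)`_p) =
    fr1 (e x) (at2 (fun k c x => (coP K k c x 2)`_p) x).
  by apply/funext => a; apply/funext => c.
have -> : (fun b a c => (dsPsi (Fr K x) b a c 2)`_p) =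
    fr2 (e x) (fun m k c => (dcoP K m k c x 2)`_p).
  by apply/funext => b; apply/funext => a; apply/funext => c.
apply: (@trace_const_of _ _ tau) => //.
- by move=> m k c; exact: dr_coP.
- by move=> x' Ux' a c; rewrite -!E hs.
- by move=> x' Ux'; rewrite -(ht x' Ux') sum3 !E.
Qed.

(** The grading n / 2 leaves room for one logarithm at n = 2 and for its
    powers in products; no other order is resonant. *)
Lemma chart_expansion n : good_all half n.
Proof.
apply: good_all_ind => //.
  by move=> j k; lia.
move=> h1 x Ux; split.
  move=> a c; split=> //.
  by have [h _ _] := order2_log (Fr_eqs Ux) (frame_init_Fr hK Ux) (psi1 Ux h1); exact: h.
apply: (@trace_const_coef 1 0) => // x' Ux'.
  by have [_ h _] := order2_log (Fr_eqs Ux') (frame_init_Fr hK Ux') (psi1 Ux' h1).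
by have [_ _ h] := order2_log (Fr_eqs Ux') (frame_init_Fr hK Ux') (psi1 Ux' h1).
Qed.

(** With an isotropic curvature no logarithm arises at n = 2, the only
    resonant order, so none arises at all. *)
Lemma chart_expansion_einstein mu :
  (forall x a c, U x -> curvF (wF K x) (dwF K x) a c = if a == c then mu else 0) ->
  forall n, good_all (fun=> 0%N) n.
Proof.
move=> hmu n; apply: good_all_ind => // h1 x Ux; split.
  move=> a c; split=> //.
  by have [h _ _] := order2_einstein (Fr_eqs Ux) (frame_init_Fr hK Ux) (psi1 Ux h1)
    (fun a c => hmu x a c Ux); exact: h.
apply: (@trace_const_coef 0 mu) => // x' Ux'.
  by have [_ h _] := order2_einstein (Fr_eqs Ux') (frame_init_Fr hK Ux') (psi1 Ux' h1)
    (fun a c => hmu x' a c Ux').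
by have [_ _ h] := order2_einstein (Fr_eqs Ux') (frame_init_Fr hK Ux') (psi1 Ux' h1)
  (fun a c => hmu x' a c Ux').
Qed.

(** ** The coefficients that vanish *)

Section Vanish.
Variable D : nat -> nat.
Hypothesis hD : forall n, good_all D n.

Lemma ca_vanish n p k c x : U x -> (p <= cdep K n)%N ->
  odd n.+1 || (D n.+1 < p)%N -> ca K n p k c x = 0.
Proof.
move=> Ux pn h; have [h1 h2] := gaA (hD n.+1) k c Ux.
have <- : (coA K k c x n.+1)`_p = ca K n p k c x.
  by rewrite /coA /= add0r coef_cpoly ltnS pn.
case/orP: h => [/h1 ->|h]; first by rewrite coef0.
exact: (leq_sizeP _ _ h2).
Qed.

Lemma cb_vanish n p k c x : U x -> (p <= cdep K n)%N ->
  odd n.+2 || (D n.+2 < p)%N -> cb K n p k c x = 0.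
Proof.
move=> Ux pn h; have [h1 h2] := gaP (hD n.+2) k c Ux.
have <- : (coP K k c x n.+2)`_p = cb K n p k c x.
  by rewrite /coP /= add0r coef_cpoly ltnS pn.
case/orP: h => [/h1 ->|h]; first by rewrite coef0.
exact: (leq_sizeP _ _ h2).
Qed.

Lemma cg_vanish n p c x : U x -> (p <= cdep K n)%N ->
  odd n.+1 || (D n.+1 < p)%N -> cg K n p c x = 0.
Proof.
move=> Ux pn h; have [h1 h2] := gaf (hD n.+1) c Ux.
have <- : (cof K c x n.+1)`_p = cg K n p c x.
  by rewrite /cof /= coef_cpoly ltnS pn.
case/orP: h => [/h1 ->|h]; first by rewrite coef0.
exact: (leq_sizeP _ _ h2).
Qed.

End Vanish.

End Recursion.

(** * The Levi-Civita connection and the Ricci tensor *)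

(** Pk, Pl are the first derivatives of the vierbein and D2 the second one;
    covariantly differentiating twice in both orders and subtracting
    eliminates D2 and leaves the curvature on one side and the Riemann tensor
    on the other. *)
Lemma curvature_algebra (R : realType) (wk wl dwl dwk D2 : 'I_3 -> R)
    (E Gk Gl Pk Pl : 'I_3 -> 'I_3 -> R) (dGl dGk : 'I_3 -> R) (m c : 'I_3) :
  (forall i d, Pk i d = \sum_p Gk p i * E p d - cr wk (E i) d) ->
  (forall i d, Pl i d = \sum_p Gl p i * E p d - cr wl (E i) d) ->
  D2 c + (cr dwl (E m) c + cr wl (Pk m) c) =
    \sum_n (dGl n * E n c + Gl n m * Pk n c) ->
  D2 c + (cr dwk (E m) c + cr wk (Pl m) c) =
    \sum_n (dGk n * E n c + Gk n m * Pl n c) ->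
  cr (fun d => dwl d - dwk d + cr wk wl d) (E m) c =
  \sum_n (dGl n - dGk n + \sum_p (Gk n p * Gl p m - Gl n p * Gk p m)) * E n c.
Proof.
move=> hPk hPl h1 h2.
have H (a b a' b' z : R) : a = b -> a' = b' -> z = (a - b) - (a' - b') -> z = 0.
  by move=> -> -> ->; rewrite !subrr.
apply/eqP; rewrite -subr_eq0; apply/eqP; apply: (H _ _ _ _ _ h1 h2).
rewrite /cr !sum3 !hPk !hPl /cr !sum3.
by move: c {h1 h2}; apply: ord3P => /=; ring.
Qed.

Lemma invmx_frame (R : realType) (h : 'M[R]_3) (e : 'I_3 -> 'I_3 -> R) : dete e != 0 ->
  (forall k l, h k l = \sum_c e k c * e l c) ->
  forall k l, invmx h k l = hup e k l.
Proof.
move=> e0 hh; pose E : 'M[R]_3 := \matrix_(k, c) e k c.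
pose F : 'M[R]_3 := \matrix_(k, c) Einv e c k.
have EF : E *m F^T = 1%:M.
  apply/matrixP => k l; rewrite !mxE -(Einv_r e0); apply: eq_bigr => c _.
  by rewrite !mxE.
have hE : h = E *m E^T.
  by apply/matrixP => k l; rewrite hh mxE; apply: eq_bigr => c _; rewrite !mxE.
have EF' : E^T *m F = 1%:M by rewrite -[F]trmxK -trmx_mul (mulmx1C EF) trmx1.
have hX : h *m (F *m F^T) = 1%:M by rewrite hE -mulmxA (mulmxA E^T) EF' mul1mx.
have [uh _] := mulmx1_unit hX.
move=> k l; rewrite -[invmx h]mulmx1 -hX mulKmx// mxE.
by apply: eq_bigr => a _; rewrite !mxE.
Qed.

Section LeviCivita.
Context {R : realType}.
Variables (K : @local_fields R) (h : 'rV[R]_3 -> 'M[R]_3).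
Hypothesis hK : local_kw K.
Local Notation U := (cU K).
Local Notation e x := (at2 (ce K) x).
Local Notation w x := (at2 (cw K) x).
Hypothesis hmet : forall x, U x -> forall k l, h x k l = \sum_a ce K k a x * ce K l a x.
Implicit Types (x : 'rV[R]_3) (k l m i j a b c : 'I_3).

Lemma invmx_hup x k l : U x -> invmx (h x) k l = hup (e x) k l.
Proof. by move=> Ux; apply: (invmx_frame (kdet hK Ux)) => *; rewrite hmet. Qed.

Let he m k c x (Ux : U x) : is_derive x (delta_mx 0 m) (ce K k c) (partial m (ce K k c) x).
Proof. exact: dr_smooth (ke hK k c) Ux. Qed.

Let hw m k c x (Ux : U x) : is_derive x (delta_mx 0 m) (cw K k c) (partial m (cw K k c) x).
Proof. exact: dr_smooth (kw hK k c) Ux. Qed.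

Definition covE k l c x := partial k (ce K l c) x + cr (w x k) (e x l) c.

(** The torsion-freeness of [torsion_free], in coordinates. *)
Lemma covE_sym k l c x : U x -> covE k l c x = covE l k c x.
Proof.
move=> Ux; have e0 := kdet hK Ux.
have hT := torsion_free (frame_eqs_Fr hK Ux) (frame_init_Fr hK Ux) _ _ _ (sg1 hK Ux).
have gE b a d : gam (wF K x) (deF K x) b a d = fr2 (e x) (fun k l c => covE k l c x) b a d.
  rewrite /covE (fr2_cov (e x) (fun k l c => partial k (ce K l c) x) (w x) (e x)).
  by rewrite /gam; congr (_ + _); rewrite /cr !fr1_e.
rewrite -(fr2K e0 (fun k l c => covE k l c x) k l c).
rewrite -(fr2K e0 (fun k l c => covE k l c x) l k c).
transitivity (\sum_b \sum_a e x k b * (e x l a * fr2 (e x) (fun k l c => covE k l c x) b a c)).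
  by apply: eq_bigr => b _; rewrite mulr_sumr.
rewrite exchange_big; apply: eq_bigr => a _; rewrite mulr_sumr.
by apply: eq_bigr => b _; rewrite -!gE hT mulrCA.
Qed.

Let T k l p x := \sum_d covE k l d x * ce K p d x.

Let dmet k l m x : U x -> partial k (fun x => h x l m) x = T k l m x + T k m l x.
Proof.
move=> Ux.
have d1 := dr_sum (fun c => drM (he k l c Ux) (he k m c Ux)).
have d2 : is_derive x (delta_mx 0 k) (fun x => h x l m)
    (\sum_c (partial k (ce K l c) x * ce K m c x + ce K l c x * partial k (ce K m c) x)).
  apply: dr_near d1; apply: filterS (open_nbhs_nbhs (conj (kU hK) Ux)) => x' Ux'.
  by rewrite hmet.
by rewrite (partial_dr d2) /T /covE /cr !sum3 /at2 /=; ring.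
Qed.

(** Torsion-freeness and compatibility with the metric determine the
    connection. *)
Lemma levi_civita k l c x : U x ->
  covE k l c x = \sum_m christoffel h m k l x * ce K m c x.
Proof.
move=> Ux; have e0 := kdet hK Ux.
have Ts a b p : T a b p x = T b a p x.
  by apply: eq_bigr => d _; rewrite covE_sym.
have chr m : christoffel h m k l x = \sum_p hup (e x) m p * T k l p x.
  rewrite /christoffel mulr_sumr; apply: eq_bigr => p _.
  by rewrite invmx_hup// !dmet// (Ts k p l) (Ts l k p) (Ts l p k); field.
rewrite -(contract_e e0 (fun d => covE k l d x) c).
transitivity (\sum_m \sum_a \sum_p (Einv (e x) a m * ce K m c x) *
    (Einv (e x) a p * T k l p x)); last first.
  apply: eq_bigr => m _; rewrite chr /hup mulr_suml exchange_big.
  apply: eq_bigr => p _; rewrite !mulr_suml; apply: eq_bigr => a _; ring.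
symmetry; rewrite exchange_big /= (bigD1 c) //= [X in _ + X]big1 => [|a ac]; last first.
  under eq_bigr do rewrite -mulr_sumr.
  by rewrite -mulr_suml (Einv_l e0) (negbTE ac) mul0r.
under eq_bigr do rewrite -mulr_sumr.
by rewrite -mulr_suml (Einv_l e0) eqxx mul1r addr0.
Qed.

Lemma christoffel_covE m k l x : U x ->
  christoffel h m k l x = \sum_c covE k l c x * Einv (e x) c m.
Proof.
move=> Ux; have e0 := kdet hK Ux.
under eq_bigr do rewrite levi_civita// mulr_suml.
rewrite exchange_big /= (bigD1 m) //= [X in _ + X]big1 => [|n nm].
  under eq_bigr do rewrite -mulrA.
  by rewrite -mulr_sumr (Einv_r e0) eqxx mulr1 addr0.
under eq_bigr do rewrite -mulrA.
by rewrite -mulr_sumr (Einv_r e0) (negbTE nm) mulr0.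
Qed.

Let dcovE i l m c x (Ux : U x) : is_derive x (delta_mx 0 i) (covE l m c)
  (partial i (partial l (ce K m c)) x + (cr (fun d => partial i (cw K l d) x) (e x m) c
     + cr (w x l) (fun d => partial i (ce K m d) x) c)).
Proof.
apply: drD; first exact: (smooth_dr [:: l] i (ke hK m c) Ux).
by apply: dr_cr => d; [exact: hw|exact: he].
Qed.

Let dchr i m k l x : U x -> is_derive x (delta_mx 0 i) (christoffel h m k l)
  (partial i (christoffel h m k l) x).
Proof.
move=> Ux; have dE c := dr_Einv c m (fun k c => he i k c Ux) (kdet hK Ux).
have d1 := dr_sum (fun c => drM (dcovE i k l c Ux)
  (is_derive_partial (proj2_sig (cid (dE c))))).
apply: (@is_derive_partial _ _ _ _ i); apply: dr_near d1.
apply: filterS (open_nbhs_nbhs (conj (kU hK) Ux)) => x' Ux'.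
by rewrite christoffel_covE.
Qed.

Definition curvW k l c x := partial k (cw K l c) x - partial l (cw K k c) x
  + cr (w x k) (w x l) c.

Definition riemann n m k l x := partial k (christoffel h n l m) x
  - partial l (christoffel h n k m) x
  + \sum_p (christoffel h n k p x * christoffel h p l m x
            - christoffel h n l p x * christoffel h p k m x).

(** The curvature of the connection acts on the vierbein as the Riemann
    tensor. *)
Lemma curvature_riemann k l m c x : U x ->
  cr (fun d => curvW k l d x) (e x m) c = \sum_n riemann n m k l x * ce K n c x.
Proof.
move=> Ux.
have S i j := schwarz i j (kU hK) Ux (ke hK m c).
have I i j : partial i (partial j (ce K m c)) x
    + (cr (fun d => partial i (cw K j d) x) (e x m) c
       + cr (w x j) (fun d => partial i (ce K m d) x) c) =
    \sum_n (partial i (christoffel h n j m) x * ce K n c x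
            + christoffel h n j m x * partial i (ce K n c) x).
  apply: dr_unique (dcovE i j m c Ux) _.
  have d1 := dr_sum (fun n => drM (dchr i n j m Ux) (he i n c Ux)).
  apply: dr_near d1; apply: filterS (open_nbhs_nbhs (conj (kU hK) Ux)) => x' Ux'.
  by rewrite levi_civita.
have P i j d : partial i (ce K j d) x =
    \sum_p christoffel h p i j x * ce K p d x - cr (w x i) (e x j) d.
  by rewrite -levi_civita// /covE addrK.
apply: (curvature_algebra (D2 := fun c => partial k (partial l (ce K m c)) x)
  (Pk := fun i d => partial k (ce K i d) x) (Pl := fun i d => partial l (ce K i d) x)
  (wk := w x k) (wl := w x l) (Gk := fun n m => christoffel h n k m x)
  (Gl := fun n m => christoffel h n l m x)).
- by move=> i d; exact: P.
- by move=> i d; exact: P.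
- exact: I.
- by rewrite /= -(S k l); exact: I.
Qed.

Lemma ricci_riemann j k x : ricci h x j k = \sum_i riemann i j i k x.
Proof. by rewrite /ricci mxE. Qed.

Lemma ricci_contract (E : 'I_3 -> 'I_3 -> R) (F : 'I_3 -> 'I_3 -> 'I_3 -> R)
    (v : 'I_3 -> 'I_3 -> R) (a b c : 'I_3) :
  \sum_j \sum_k \sum_i E a j * E b k * (E c i * cr (F i k) (v j) c) =
  cr (fun d => \sum_i \sum_k E c i * E b k * F i k d)
     (fun d => \sum_j E a j * v j d) c.
Proof. by rewrite !sum3 /cr !sum3; ring. Qed.

Lemma ricci_frame a b x : U x ->
  \sum_j \sum_k Einv (e x) a j * Einv (e x) b k * ricci h x j k =
  \sum_c cr (fr2 (e x) (fun k l c => curvW k l c x) c b) (delta a) c.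
Proof.
move=> Ux; have e0 := kdet hK Ux.
have unE (v : 'I_3 -> R) i : \sum_c Einv (e x) c i * (\sum_n v n * ce K n c x) = v i.
  rewrite (sum_dotr (fun c => Einv (e x) c i) v (fun c n => ce K n c x)).
  rewrite (bigD1 i) //= [X in _ + X]big1 => [|n ni].
    under eq_bigr do rewrite mulrC.
    by rewrite (Einv_r e0) eqxx mulr1 addr0.
  under eq_bigr do rewrite mulrC.
  by rewrite (Einv_r e0) (negbTE ni) mulr0.
have Q j k : ricci h x j k =
    \sum_c \sum_i Einv (e x) c i * cr (fun d => curvW i k d x) (e x j) c.
  rewrite ricci_riemann [RHS]exchange_big; apply: eq_bigr => i _ /=.
  under eq_bigr do rewrite curvature_riemann//.
  by rewrite (unE (fun n => riemann n j i k x)).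
transitivity (\sum_c \sum_j \sum_k \sum_i Einv (e x) a j * Einv (e x) b k *
    (Einv (e x) c i * cr (fun d => curvW i k d x) (e x j) c)).
  rewrite [RHS]exchange_big; apply: eq_bigr => j _ /=.
  rewrite [RHS]exchange_big; apply: eq_bigr => k _ /=.
  rewrite Q mulr_sumr; apply: eq_bigr => c _.
  by rewrite mulr_sumr.
apply: eq_bigr => c _; rewrite (ricci_contract (Einv (e x))
  (fun i k d => curvW i k d x)).
by congr (cr _ _ c); apply/funext => d; exact: (fr1_e e0).
Qed.

Lemma curvF_curvW a c x : U x ->
  curvF (wF K x) (dwF K x) a c =
  fr2 (e x) (fun k l c => curvW k l c x) (n1 a) (n2 a) c.
Proof.
move=> Ux; rewrite /curvF /dwF /curvW /wF.
have := fr2_curv (e x) (fun m k c => partial m (cw K k c) x) (w x) (fun _ _ => 0)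
  (n1 a) (n2 a) c.
have z : cr (fr1 (e x) (fun _ _ => 0) (n1 a)) (fr1 (e x) (fun _ _ => 0) (n2 a)) c = 0.
  by rewrite /cr /fr1 !sum3 !mulr0 !addr0 mulr0 subrr.
rewrite z subr0 => <-.
apply: eq_bigr => k _; apply: eq_bigr => l _; congr (_ * _).
by rewrite /cr; ring.
Qed.

(** In dimension three the Ricci tensor determines the curvature: the dual
    of the curvature, as a matrix S in the frame, satisfies
    Ric = S - tr(S). *)
Lemma einstein_curvature lam a c x : U x -> ricci h x = lam *: h x ->
  curvF (wF K x) (dwF K x) a c = if a == c then - lam / 2 else 0.
Proof.
move=> Ux hr; have e0 := kdet hK Ux.
pose F b a c := fr2 (e x) (fun k l c => curvW k l c x) b a c.
have Fa b d f : F b d f = - F d b f.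
  by apply: fr2_anti => k l g; rewrite /curvW /cr; ring.
have Fz b f : F b b f = 0 by have := Fa b b f; lra.
have H u v : \sum_c cr (F c v) (delta u) c = lam * (u == v)%:R.
  rewrite -ricci_frame// hr.
  transitivity (\sum_j \sum_k lam * (Einv (e x) u j * Einv (e x) v k *
      \sum_b ce K j b x * ce K k b x)).
    apply: eq_bigr => j _; apply: eq_bigr => k _.
    by rewrite mxE hmet// mulrCA.
  under eq_bigr do rewrite -mulr_sumr.
  rewrite -mulr_sumr; congr (_ * _).
  transitivity (\sum_b (\sum_j Einv (e x) u j * ce K j b x) *
      (\sum_k Einv (e x) v k * ce K k b x)); first by rewrite !sum3; ring.
  rewrite (bigD1 u) //= [X in _ + X]big1 => [|b bu].
    by rewrite !(Einv_l e0) eqxx mul1r addr0 eq_sym.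
  by rewrite (Einv_l e0) eq_sym (negbTE bu) mul0r.
rewrite curvF_curvW//.
have := (H i0 i0, H i0 i1, H i0 i2, H i1 i0, H i1 i1, H i1 i2, H i2 i0, H i2 i1, H i2 i2).
rewrite !sum3 /cr /delta /n1 /n2 /= !Fz !(Fa i1 i0) !(Fa i2 i0) !(Fa i2 i1) /=.
rewrite -/(F (n1 a) (n2 a) c).
move: a c; apply: ord3P; apply: ord3P; rewrite /n1 /n2 /= ?(Fa i2 i0);
  by move=> [[[[[[[[h1 h2] h3] h4] h5] h6] h7] h8] h9]; lra.
Qed.

End LeviCivita.

(** * Locality and scaling *)

Section Local.
Context {R : realType}.

(** For a nonzero factor this holds without differentiability, because both
    sides then take the same default value. *)
Lemma partialZ n (mu : 'I_n) (f : 'rV[R]_n -> R) (r : R) : r != 0 ->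
  partial mu (fun z => r * f z) = (fun z => r * partial mu f z).
Proof.
move=> r0; apply/funext => z; rewrite /partial.
have [df|ndf] := pselect (derivable f z (delta_mx 0 mu)).
  by apply: derive_val; apply: drZ; split.
have ndf' : ~ derivable (fun z => r * f z) z (delta_mx 0 mu).
  move=> d; apply: ndf.
  have h : is_derive z (delta_mx 0 mu) (fun z => r * f z)
      ('D_(delta_mx 0 mu) (fun z => r * f z) z) by split.
  have [d' _] := drZ r^-1 h.
  suff <- : (fun x => r^-1 * (r * f x)) = f by [].
  by apply/funext => x; rewrite mulKf.
have e1 : 'D_(delta_mx 0 mu) f z = 0 := dvgP ndf.
have e2 : 'D_(delta_mx 0 mu) (fun z => r * f z) z = 0 := dvgP ndf'.
by rewrite e1 e2 mulr0.
Qed.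

Lemma partialsZ n (s : seq 'I_n) (f : 'rV[R]_n -> R) (r : R) : r != 0 ->
  partials s (fun z => r * f z) = (fun z => r * partials s f z).
Proof. by move=> r0; elim: s => //= mu s ->; rewrite partialZ. Qed.

Lemma bderivZ j ks (f : 'rV[R]_(3 + 1) -> R) (r : R) : r != 0 ->
  bderiv j ks (fun z => r * f z) = (fun z => r * bderiv j ks f z).
Proof.
move=> r0; rewrite /bderiv partialsZ//; elim: j => //= j ->.
by apply/funext => z; rewrite /ydy partialZ// mulrCA.
Qed.

Lemma smooth_onZ n (U : set 'rV[R]_n) (f : 'rV[R]_n -> R) (r : R) : r != 0 ->
  smooth_on U f -> smooth_on U (fun z => r * f z).
Proof.
move=> r0 sf s x Ux; have [c d] := sf s x Ux; rewrite (partialsZ s f r0); split.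
  exact: (cvgM (cvg_cst r) c).
move=> mu; have h : is_derive x (delta_mx 0 mu) (partials s f)
  ('D_(delta_mx 0 mu) (partials s f) x) by split.
by have [] := drZ r h.
Qed.

Lemma smooth_cst0 n (U : set 'rV[R]_n) : smooth_on U (fun=> 0).
Proof.
move=> s x Ux; have -> : partials s (fun=> 0 : R) = fun=> 0.
  by elim: s => //= mu s ->; apply/funext => z; exact: derive_cst.
split; first exact: cst_continuous.
by move=> mu; have [] := dr_cst (0 : R) x (delta_mx 0 mu).
Qed.

Lemma expansionZ (U : set 'rV[R]_3) f gam dep c (r : R) : r != 0 ->
  expansion U f gam dep c ->
  expansion U (fun z => r * f z) gam dep (fun n p x => r * c n p x).
Proof.
move=> r0 h N j ks x0 Ux; have [q [C [d [d0 hx]]]] := h N j ks x0 Ux.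
exists q, (`|r| * C), d; split => //.
have -> : (fun z => r * f z - psum gam dep (fun n p x => r * c n p x) N z) =
    (fun z => r * (f z - psum gam dep c N z)).
  apply/funext => z; rewrite mulrBr; congr (_ - _); rewrite /psum mulr_sumr.
  apply: eq_bigr => n _; rewrite mulr_sumr; apply: eq_bigr => p _.
  by rewrite !mulrA.
apply: filterS hx => x hx y yd; rewrite bderivZ// normrM -!mulrA ler_wpM2l//.
by rewrite mulrA hx.
Qed.

Lemma partials_local n (U : set 'rV[R]_n) (s : seq 'I_n) (f g : 'rV[R]_n -> R) :
  open U -> (forall x, U x -> f x = g x) -> forall x, U x -> partials s f x = partials s g x.
Proof.
move=> oU fg; elim: s => //= mu s ih x Ux; apply: near_eq_derive.
by apply: filterS (open_nbhs_nbhs (conj oU Ux)) => x' /ih.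
Qed.

Lemma xy_near (U : set 'rV[R]_3) z : open U -> cyl U z -> \forall z' \near z, cyl U z'.
Proof.
move=> oU [Uz z0]; have /nbhs_ballP[d /= d0 hd] := open_nbhs_nbhs (conj oU Uz).
apply/nbhs_ballP; exists (Num.min d (ypart z)); first by rewrite /= lt_min d0.
move=> z' [_ hz']; split.
  apply: hd; split=> // i j; have := hz' i (lshift 1 j).
  rewrite /xpart !mxE -!ball_normE /= => /lt_le_trans; apply.
  by rewrite ge_min lexx.
have := hz' 0 (rshift 3 0); rewrite -ball_normE /=.
move: z0; rewrite /ypart !mxE => z0; rewrite lt_min => /andP[_].
by rewrite ltr_distlC subrr => /andP[].
Qed.

Lemma cyl_open (U : set 'rV[R]_3) : open U -> open (cyl U).
Proof. by move=> oU; rewrite openE => z /(xy_near oU). Qed.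

(** The derivatives used in expansions depend on a function only near the
    point, so a function may be replaced by one equal to it on the chart. *)
Lemma bderiv_local (U : set 'rV[R]_3) (f g : 'rV[R]_(3 + 1) -> R) j ks : open U ->
  (forall z, cyl U z -> f z = g z) ->
  forall z, cyl U z -> bderiv j ks f z = bderiv j ks g z.
Proof.
move=> oU fg; rewrite /bderiv; elim: j => [|j ih] z Uz /=.
  exact: (partials_local _ (cyl_open oU)).
rewrite /ydy; congr (_ * _); apply: near_eq_derive.
by apply: filterS (xy_near oU Uz) => z' /ih.
Qed.

(** Forms on X are declared smooth through their lifts to X x R^+; the slice
    y = 1 gives back the form. *)
Lemma smooth_base (U : set 'rV[R]_3) (g : 'rV[R]_3 -> R) : open U ->
  smooth_on (cyl U) (fun z => g (xpart z)) -> smooth_on U g.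
Proof.
move=> oU sg.
have cylxy x : U x -> cyl U (xy x 1) by move=> Ux; rewrite /cyl /= xpart_xy ypart_xy ltr01.
have E s : (forall z, cyl U z ->
      partials (map xdir s) (fun z => g (xpart z)) z = partials s g (xpart z)) /\
    forall x mu, U x -> derivable (partials s g) x (delta_mx 0 mu).
  have D s' : (forall z, cyl U z ->
        partials (map xdir s') (fun z => g (xpart z)) z = partials s' g (xpart z)) ->
      forall x mu, U x -> forall y, 0 < y ->
      is_derive x (delta_mx 0 mu) (partials s' g)
        (partials (map xdir (mu :: s')) (fun z => g (xpart z)) (xy x y)).
    move=> h x mu Ux y y0; apply/(dr_xpart _ _ y).
    have Uz : cyl U (xy x y) by rewrite /cyl /= xpart_xy ypart_xy.
    apply: dr_near (smooth_dr (map xdir s') (xdir mu) sg Uz).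
    by apply: filterS (xy_near oU Uz) => z' /h.
  elim: s => [|mu s [ih1 ih2]].
    split => // x mu Ux; have [+ _] := D [::] (fun _ _ => erefl) x mu Ux 1 ltr01.
    exact.
  have h z : cyl U z -> partials (map xdir (mu :: s)) (fun z => g (xpart z)) z =
      partials (mu :: s) g (xpart z).
    move=> [Uz z0]; have [_] := D s ih1 (xpart z) mu Uz (ypart z) z0.
    by rewrite -xy_parts => /esym.
  split => // x nu Ux; have [+ _] := D _ h x nu Ux 1 ltr01.
  exact.
move=> s x Ux; have [E1 E2] := E s; split; last by move=> mu; exact: E2.
have [c _] := sg (map xdir s) (xy x 1) (cylxy x Ux).
have cxy : {for x, continuous (fun x' : 'rV[R]_3 => xy x' 1)}.
  move=> S /nbhs_ballP[d /= d0 hS]; apply/nbhs_ballP; exists d => // x' [_ hx'].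
  apply: hS; split=> // i j.
  rewrite /xy -[j]splitK; case: (fintype.split j) => k /=.
    by rewrite !row_mxEl; exact: hx'.
  by rewrite !row_mxEr; exact: ballxx.
have h : partials (map xdir s) (fun z => g (xpart z)) (xy x' 1) @[x' --> x]
    --> partials (map xdir s) (fun z => g (xpart z)) (xy x 1).
  exact: continuous_comp cxy c.
rewrite (E1 _ (cylxy x Ux)) xpart_xy in h.
have hn : {near x, (fun x' => partials (map xdir s) (fun z => g (xpart z)) (xy x' 1))
    =1 partials s g}.
  apply: filterS (open_nbhs_nbhs (conj oU Ux)) => x' Ux' /=.
  by rewrite (E1 _ (cylxy x' Ux')) xpart_xy.
exact: cvg_trans (near_eq_cvg hn) h.
Qed.

End Local.

(** * The equations in Lie algebra coordinates *)

Section Coordinates.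
Context {R : realType} {G : gauge_group}.
Implicit Types (M N : 'M[R]_(gdim G)).

Lemma bracket0l N : bracket 0 N = 0.
Proof. by rewrite /bracket mul0mx mulmx0 subrr. Qed.

Lemma bracketZr M N (r : R) : bracket M (r *: N) = r *: bracket M N.
Proof. by rewrite /bracket -scalemxAr -scalemxAl scalerBr. Qed.

Lemma bracket_sumr n M (F : 'I_n -> 'M[R]_(gdim G)) :
  bracket M (\sum_i F i) = \sum_i bracket M (F i).
Proof. by rewrite /bracket mulmx_sumr mulmx_suml -sumrB. Qed.

Lemma coscale_neq0 : coscale G != 0 :> R.
Proof. by case: G => /=; rewrite ?oner_eq0 ?pnatr_eq0. Qed.

Lemma co_partial_mx n (mu : 'I_n) (F : 'rV[R]_n -> 'M[R]_(gdim G)) z c :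
  co (partial_mx mu F z) c = partial mu (fun w => co (F w) c) z.
Proof. by rewrite /co (partialZ mu _ coscale_neq0) mxE. Qed.

Variables (U : set 'rV[R]_3) (h : 'rV[R]_3 -> 'M[R]_3).
Variables (A Phi : 'I_(3 + 1) -> 'rV[R]_(3 + 1) -> 'M[R]_(gdim G)).
Let h4 z : 'M[R]_(3 + 1) := block_mx (h (xpart z)) 0 0 1%:M.
Hypothesis oU : open U.
Hypothesis hU : forall x, U x -> h x \in unitmx.
Hypothesis lA : forall mu z, cyl U z -> lie_carrier (A mu z).
Hypothesis lP : forall mu z, cyl U z -> lie_carrier (Phi mu z).
Hypothesis Ay : forall z, cyl U z -> A ydir z = 0.

Lemma vol_product z : vol h4 z = vol h (xpart z).
Proof. by rewrite /vol /h4 det_ublock det1 mulr1. Qed.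

(** The metric of X x R^+ is block diagonal. *)
Lemma invmx_product z : U (xpart z) ->
  invmx (h4 z) = block_mx (invmx (h (xpart z))) 0 0 1%:M.
Proof.
move=> Uz; set X := block_mx _ _ _ _.
have hX : h4 z *m X = 1%:M.
  rewrite mulmx_block !mul0mx !mulmx0 !mul1mx !addr0 !add0r mulmxV ?hU//.
  by rewrite -scalar_mx_block.
have [uh _] := mulmx1_unit hX.
by rewrite -[LHS]mulmx1 -hX mulKmx.
Qed.

Lemma invmx_xx z k l : U (xpart z) ->
  invmx (h4 z) (xdir k) (xdir l) = invmx (h (xpart z)) k l.
Proof. by move=> Uz; rewrite invmx_product// block_mxEul. Qed.
Lemma invmx_xy z k : U (xpart z) -> invmx (h4 z) (xdir k) ydir = 0.
Proof. by move=> Uz; rewrite invmx_product// block_mxEur mxE. Qed.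
Lemma invmx_yx z k : U (xpart z) -> invmx (h4 z) ydir (xdir k) = 0.
Proof. by move=> Uz; rewrite invmx_product// block_mxEdl mxE. Qed.
Lemma invmx_yy z : U (xpart z) -> invmx (h4 z) ydir ydir = 1.
Proof. by move=> Uz; rewrite invmx_product// block_mxEdr mxE. Qed.

Let a mu c z := co (A mu z) c.
Let p mu c z := co (Phi mu z) c.

Lemma co_dA mu nu z c : cyl U z -> co (dA A Phi mu nu z) c =
  partial mu (p nu c) z - partial nu (p mu c) z
  + (cr (a mu ^~ z) (p nu ^~ z) c - cr (a nu ^~ z) (p mu ^~ z) c).
Proof.
move=> Uz; rewrite /dA /covD coB !(coD (partial_mx _ _ _)) !co_partial_mx !co_bracket; try by auto.
rewrite -/(p nu c) -/(p mu c).
set u := partial _ _ _; set v := partial _ _ _; set s := cr _ _ _; set t := cr _ _ _.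
by rewrite opprD addrACA.
Qed.

Let cay c z : cyl U z -> a ydir c z = 0.
Proof. by move=> Uz; rewrite /a Ay// co0. Qed.

Let pay mu c z : cyl U z -> partial mu (a ydir c) z = 0.
Proof.
move=> Uz; transitivity (partial mu (fun=> 0 : R) z); last exact: derive_cst.
by apply: (partials_local [:: mu] (cyl_open oU)) Uz => z'; exact: cay.
Qed.

Let cr0l c z (v : 'I_3 -> R) : cyl U z -> cr (a ydir ^~ z) v c = 0.
Proof. by move=> Uz; rewrite /cr !cay// !mul0r subrr. Qed.

Lemma co_hodge (mu nu : 'I_4) z c : cyl U z ->
  co (hodge2 h4 (dA A Phi) mu nu z) c = 2^-1 * vol h (xpart z) *
  \sum_(s < 4) \sum_(s' < 4) \sum_(t < 4) \sum_(t' < 4)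
    (invmx (h4 z) s t * invmx (h4 z) s' t' * levi [tuple s; s'; mu; nu])
    * co (dA A Phi t t' z) c.
Proof.
move=> Uz; rewrite /hodge2 coZ vol_product; congr (_ * _).
rewrite co_sum; apply: eq_bigr => s _; rewrite co_sum; apply: eq_bigr => s' _.
rewrite co_sum; apply: eq_bigr => t _; rewrite co_sum; apply: eq_bigr => t' _.
by rewrite coZ.
Qed.

Lemma co_dA_anti mu nu z c : co (dA A Phi mu nu z) c = - co (dA A Phi nu mu z) c.
Proof. by rewrite /dA !coB opprB. Qed.

Lemma co_hodge_xx q z c : cyl U z ->
  co (hodge2 h4 (dA A Phi) (xdir (n1 q)) (xdir (n2 q)) z) c = - (vol h (xpart z) *
   \sum_k invmx (h (xpart z)) q k * co (dA A Phi ydir (xdir k) z) c).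
Proof.
move=> Uz; have [Ux _] := Uz; rewrite co_hodge//.
have [hs _] := @hodge_scalar _ (invmx (h4 z)) (invmx (h (xpart z)))
  (fun mu nu => co (dA A Phi mu nu z) c) (fun mu nu => co_dA_anti mu nu z c)
  (fun k l => invmx_xx k l Ux) (fun k => invmx_xy k Ux) (fun k => invmx_yx k Ux)
  (invmx_yy Ux).
rewrite (hs q).
set S := \sum_p _; set v := vol _ _; by field.
Qed.

Lemma co_hodge_yx k z c : cyl U z ->
  co (hodge2 h4 (dA A Phi) ydir (xdir k) z) c = - (vol h (xpart z) *
   \sum_l \sum_m (invmx (h (xpart z)) (n1 k) l * invmx (h (xpart z)) (n2 k) m)
     * co (dA A Phi (xdir l) (xdir m) z) c).
Proof.
move=> Uz; have [Ux _] := Uz; rewrite co_hodge//.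
have [_ hs] := @hodge_scalar _ (invmx (h4 z)) (invmx (h (xpart z)))
  (fun mu nu => co (dA A Phi mu nu z) c) (fun mu nu => co_dA_anti mu nu z c)
  (fun k l => invmx_xx k l Ux) (fun k => invmx_xy k Ux) (fun k => invmx_yx k Ux)
  (invmx_yy Ux).
rewrite (hs k).
set S := \sum_c _; set v := vol _ _; by field.
Qed.

Section KW.
Variable z : 'rV[R]_(3 + 1).
Hypothesis Uz : cyl U z.
Hypothesis kw : forall mu nu : 'I_(3 + 1),
  curvature A mu nu z - wedge_sq Phi mu nu z + hodge2 h4 (dA A Phi) mu nu z = 0.

Let kwc mu nu c : partial mu (a nu c) z - partial nu (a mu c) z
  + cr (a mu ^~ z) (a nu ^~ z) c - cr (p mu ^~ z) (p nu ^~ z) c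
  + co (hodge2 h4 (dA A Phi) mu nu z) c = 0.
Proof.
have := congr1 (fun M => co M c) (kw mu nu).
rewrite co0 /curvature /wedge_sq coD coB coD coB !co_partial_mx !co_bracket//; auto.
Qed.

(** For two indices on X the star of d_A Phi only involves its mixed
    components; temporal gauge removes A_y. *)
Lemma kw_xx q c : vol h (xpart z) *
    \sum_k invmx (h (xpart z)) q k * (partial ydir (p (xdir k) c) z
       - partial (xdir k) (p ydir c) z - cr (a (xdir k) ^~ z) (p ydir ^~ z) c)
  = partial (xdir (n1 q)) (a (xdir (n2 q)) c) z - partial (xdir (n2 q)) (a (xdir (n1 q)) c) z
    + cr (a (xdir (n1 q)) ^~ z) (a (xdir (n2 q)) ^~ z) c
    - cr (p (xdir (n1 q)) ^~ z) (p (xdir (n2 q)) ^~ z) c.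
Proof.
have := kwc (xdir (n1 q)) (xdir (n2 q)) c; rewrite co_hodge_xx// => /subr0_eq ->.
congr (_ * _); apply: eq_bigr => k _; congr (_ * _).
by rewrite co_dA// cr0l// add0r.
Qed.

(** For one index along y it only involves the spatial components. *)
Lemma kw_yx k c : partial ydir (a (xdir k) c) z - cr (p ydir ^~ z) (p (xdir k) ^~ z) c =
  vol h (xpart z) * \sum_l \sum_m
    (invmx (h (xpart z)) (n1 k) l * invmx (h (xpart z)) (n2 k) m)
    * (partial (xdir l) (p (xdir m) c) z - partial (xdir m) (p (xdir l) c) z
       + (cr (a (xdir l) ^~ z) (p (xdir m) ^~ z) c
          - cr (a (xdir m) ^~ z) (p (xdir l) ^~ z) c)).
Proof.
have := kwc ydir (xdir k) c; rewrite co_hodge_yx// cr0l// pay// subr0 addr0.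
move=> /subr0_eq ->.
by congr (_ * _); apply: eq_bigr => l _; apply: eq_bigr => m _; rewrite co_dA.
Qed.

End KW.

Hypothesis sP : forall mu c, smooth_on (cyl U) (p mu c).
Hypothesis sh : forall x k m l, U x -> is_derive x (delta_mx 0 k)
  (fun x => vol h x * invmx (h x) m l) (partial k (fun x => vol h x * invmx (h x) m l) x).
Hypothesis v0 : forall x, U x -> vol h x != 0.

Let sum31 (V : nmodType) (F : 'I_(3 + 1) -> V) :
  \sum_mu F mu = \sum_k F (xdir k) + F ydir.
Proof. by rewrite big_split_ord big_ord1. Qed.

Let flux_x k z c : cyl U z -> co (flux h4 Phi (xdir k) z) c =
  \sum_l (vol h (xpart z) * invmx (h (xpart z)) k l) * p (xdir l) c z.
Proof.
move=> Uz; have [Ux _] := Uz; rewrite /flux coZ vol_product co_sum sum31.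
rewrite coZ invmx_xy// mul0r addr0 mulr_sumr; apply: eq_bigr => l _.
by rewrite coZ invmx_xx// mulrA.
Qed.

Let flux_y z c : cyl U z -> co (flux h4 Phi ydir z) c = vol h (xpart z) * p ydir c z.
Proof.
move=> Uz; have [Ux _] := Uz; rewrite /flux coZ vol_product co_sum sum31.
rewrite coZ invmx_yy// mul1r big1 ?add0r// => l _.
by rewrite coZ invmx_yx// mul0r.
Qed.

Let bracket_flux k z c : cyl U z -> co (bracket (A (xdir k) z) (flux h4 Phi (xdir k) z)) c =
  \sum_l vol h (xpart z) * invmx (h (xpart z)) k l * cr (a (xdir k) ^~ z) (p (xdir l) ^~ z) c.
Proof.
move=> Uz; have [Ux _] := Uz; rewrite /flux bracketZr bracket_sumr coZ vol_product co_sum sum31.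
rewrite bracketZr coZ invmx_xy// mul0r addr0 mulr_sumr; apply: eq_bigr => l _.
by rewrite bracketZr coZ invmx_xx// co_bracket ?mulrA//; auto.
Qed.

(** The Leibniz rule isolates the derivative of vol times the inverse metric,
    the coefficient of [kap]. *)
Lemma kw_div x y c : U x -> 0 < y -> let z := xy x y in
  codiff h4 A Phi z = 0 ->
  \sum_k \sum_l (partial k (fun x => vol h x * invmx (h x) k l) x * p (xdir l) c z
       + vol h x * invmx (h x) k l *
         (partial (xdir k) (p (xdir l) c) z + cr (a (xdir k) ^~ z) (p (xdir l) ^~ z) c))
  + vol h x * partial ydir (p ydir c) z = 0.
Proof.
move=> Ux y0 z; have Uz : cyl U z by rewrite /cyl /= xpart_xy ypart_xy.
have nz : \forall z' \near z, cyl U z' := xy_near oU Uz.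
have vz : vol h4 z != 0 by rewrite vol_product xpart_xy v0.
move=> /(congr1 (fun M => co M c)); rewrite /codiff coZ co0 => /eqP.
rewrite mulf_eq0 oppr_eq0 invr_eq0 (negbTE vz) /= => /eqP.
rewrite co_sum sum31 /covD => h0; rewrite -[RHS]h0; congr (_ + _).
  apply: eq_bigr => k _; rewrite coD co_partial_mx bracket_flux// xpart_xy.
  have d (l : 'I_3) := drM (proj2 (dr_xpart _ _ y _ _) (sh k k l Ux))
    (dr_smooth4 (xdir k) (sP (xdir l) c) Ux y0).
  have D := dr_sum d.
  rewrite (partial_dr (dr_near _ D)); last first.
    by apply: filterS nz => z' Uz'; rewrite flux_x.
  rewrite -big_split; apply: eq_bigr => l _ /=; rewrite xpart_xy -/z.
  by rewrite mulrDr addrA.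
rewrite Ay// bracket0l addr0 co_partial_mx.
symmetry; apply: partial_dr.
have D := drM (dr_xpart_y (fun x => vol h x) x y) (dr_smooth4 ydir (sP ydir c) Ux y0).
rewrite mul0r add0r xpart_xy in D.
by apply: dr_near D; apply: filterS nz => z' Uz'; rewrite flux_y.
Qed.

End Coordinates.

(** * The metric of a vierbein *)

Section Vierbein.
Context {R : realType}.
Implicit Types (e : 'I_3 -> 'I_3 -> R) (a b c k l : 'I_3).

Lemma det_dete e : \det (\matrix_(k < 3, c < 3) e k c) = dete e.
Proof.
pose o (n : nat) := nth i0 [:: i0; i1; i2] n.
rewrite (_ : \matrix_(k, c) _ = \matrix_(k < 3, c < 3) e (o k) (o c)).
  by rewrite (det3E (fun m n => e (o m) (o n))) /dete sum3 /cr /d3 /o /=; ring.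
by apply/matrixP; apply: ord3P; apply: ord3P; rewrite !mxE.
Qed.

Let dot (u v : 'I_3 -> R) := \sum_c u c * v c.

(** Three nonzero vectors, each the cross product of the two others, are
    orthonormal: they are orthogonal, of equal length by the cyclic symmetry of
    the triple product, and the squared length is its own square. *)
Lemma cross_orthonormal (t : 'I_3 -> 'I_3 -> R) :
  (forall a c, cr (t (n1 a)) (t (n2 a)) c = t a c) -> (exists c, t i0 c != 0) ->
  forall a b, dot (t a) (t b) = (a == b)%:R.
Proof.
move=> ht [c0 hc0].
have E0 c : t i0 c = cr (t i1) (t i2) c by rewrite -(ht i0).
have E1 c : t i1 c = cr (t i2) (t i0) c by rewrite -(ht i1).
have E2 c : t i2 c = cr (t i0) (t i1) c by rewrite -(ht i2).
have orth u v : dot u (cr u v) = 0 by rewrite /dot sum3 /cr /=; ring.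
have orthr u v : dot v (cr u v) = 0 by rewrite /dot sum3 /cr /=; ring.
have C u v : dot u v = dot v u by rewrite /dot !sum3; ring.
have F u v v' : v =1 v' -> dot u v = dot u v' by move=> /funext ->.
have t01 : dot (t i0) (t i1) = 0 by rewrite (F _ _ _ E1) orthr.
have t02 : dot (t i0) (t i2) = 0 by rewrite (F _ _ _ E2) orth.
have t12 : dot (t i1) (t i2) = 0 by rewrite (F _ _ _ E2) orthr.
have d1 : dot (t i1) (t i1) = dot (t i0) (t i0).
  by rewrite (F _ _ _ E1) (F (t i0) _ _ E0) /dot !sum3 /cr /=; ring.
have d2' : dot (t i2) (t i2) = dot (t i0) (t i0).
  by rewrite (F _ _ _ E2) (F (t i0) _ _ E0) /dot !sum3 /cr /=; ring.
have L : dot (cr (t i0) (t i1)) (cr (t i0) (t i1)) =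
    dot (t i0) (t i0) * dot (t i1) (t i1) - dot (t i0) (t i1) * dot (t i0) (t i1).
  by rewrite /dot !sum3 /cr /=; ring.
have dd : dot (t i0) (t i0) = dot (t i0) (t i0) * dot (t i0) (t i0).
  transitivity (dot (cr (t i0) (t i1)) (cr (t i0) (t i1))).
    by rewrite -d2'; congr dot; apply/funext.
  by rewrite L t01 d1 mulr0 subr0.
have dn : dot (t i0) (t i0) != 0.
  apply: contra hc0 => /eqP; rewrite /dot sum3 => h.
  have h' : forall c, t i0 c = 0.
    have := sqr_ge0 (t i0 i0); have := sqr_ge0 (t i0 i1); have := sqr_ge0 (t i0 i2).
    rewrite !expr2 => h2 h1 h0.
    by apply: ord3P; apply/eqP; rewrite -[_ == _]orbb -mulf_eq0; apply/eqP; lra.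
  by rewrite h'.
have {dd dn} dd : dot (t i0) (t i0) = 1 by apply: (mulfI dn); rewrite -dd mulr1.
apply: ord3P; apply: ord3P => /=; rewrite ?d1 ?d2' ?dd ?t01 ?t02 ?t12 //.
- by rewrite C t01.
- by rewrite C t02.
- by rewrite C t12.
Qed.

(** Write e = Th^T T with Th the coframe and T the matrix of the t_a. The
    brackets force T to be orthogonal, so e e^T = Th^T Th, which is the
    metric because Th is orthonormal for the inverse metric. *)
Lemma vierbein_metric (h : 'M[R]_3) (th t : 'I_3 -> 'I_3 -> R) :
  (forall a b, \sum_k \sum_l invmx h k l * th a k * th b l = (a == b)%:R) ->
  (forall a b c, cr (t a) (t b) c = \sum_(d < 3) levi [tuple a; b; d] * t d c) ->
  (exists c, t i0 c != 0) ->
  let e k c := \sum_a th a k * t a c in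
  (forall k l, h k l = \sum_c e k c * e l c) /\ dete e != 0.
Proof.
move=> hth ht t0 e.
have ho : forall a b, dot (t a) (t b) = (a == b)%:R.
  apply: cross_orthonormal t0 => a c; rewrite ht sum3 !levi3E.
  by move: a; apply: ord3P; rewrite /d3 /=; ring.
pose T : 'M[R]_3 := \matrix_(a, c) t a c.
pose Th : 'M[R]_3 := \matrix_(a, k) th a k.
have TT : T *m T^T = 1%:M.
  apply/matrixP => a b; rewrite !mxE -ho; apply: eq_bigr => c _; by rewrite !mxE.
have HH : Th *m (invmx h *m Th^T) = 1%:M.
  apply/matrixP => a b; rewrite !mxE -hth; apply: eq_bigr => k _; rewrite !mxE mulr_sumr.
  by apply: eq_bigr => l _; rewrite !mxE; ring.
have [uTh uI] := mulmx1_unit HH.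
have uTht : Th^T \in unitmx by rewrite unitmx_tr.
have uh : h \in unitmx by rewrite -unitmx_inv; move: uI; rewrite unitmx_mul uTht andbT.
have hE : h = Th^T *m Th.
  have : invmx h *m Th^T *m Th = 1%:M by apply: mulmx1C.
  by move=> /(congr1 (mulmx h)); rewrite -mulmxA mulKVmx// mulmx1 => <-.
pose E : 'M[R]_3 := \matrix_(k, c) e k c.
have EE : E = Th^T *m T.
  by apply/matrixP => k c; rewrite !mxE; apply: eq_bigr => a _; rewrite !mxE.
have uE : E \in unitmx by rewrite EE unitmx_mul uTht; have [] := mulmx1_unit TT.
split; last by rewrite -det_dete -unitfE -unitmxE.
move=> k l.
have -> : h = E *m E^T.
  by rewrite EE trmx_mul trmxK -mulmxA (mulmxA T) TT mul1mx.
rewrite mxE; by apply: eq_bigr => c _; rewrite !mxE.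
Qed.

Lemma metric_det (h : 'M[R]_3) e :
  (forall k l, h k l = \sum_c e k c * e l c) -> \det h = dete e ^+ 2.
Proof.
move=> hh; pose E : 'M[R]_3 := \matrix_(k, c) e k c.
rewrite (_ : h = E *m E^T) ?det_mulmx ?det_tr ?det_dete//.
by apply/matrixP => k l; rewrite hh mxE; apply: eq_bigr => c _; rewrite !mxE.
Qed.

Lemma invmx_Einv (h : 'M[R]_3) : \det h != 0 ->
  forall k l, invmx h k l = Einv (fun m n => h m n) k l.
Proof.
move=> h0 k l; pose F : 'M[R]_3 := \matrix_(m, n) Einv (fun m n => h m n) m n.
have d0 : dete (fun m n => h m n) != 0.
  rewrite -det_dete (_ : \matrix_(_, _) _ = h)//.
  by apply/matrixP => m n; rewrite mxE.
have Fh : F *m h = 1%:M.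
  apply/matrixP => m n; rewrite mxE [RHS]mxE -(Einv_l d0).
  by apply: eq_bigr => p _; rewrite mxE.
have uh : h \in unitmx by rewrite unitmxE unitfE.
have /matrixP/(_ k l) <- : F = invmx h by rewrite -[invmx h]mul1mx -Fh mulmxK.
by rewrite mxE.
Qed.

Lemma dr_sqrt (V : normedModType R) (f : V -> R) x v (r : R) : 0 < f x ->
  is_derive x v f r ->
  is_derive x v (fun u => Num.sqrt (f u)) ((2 * Num.sqrt (f x))^-1 * r).
Proof.
move=> f0 hf; pose phi (s : R) := s *: v + x.
have hphi (s : R) : phi (s *: 1 + 0) = s *: v + phi 0.
  by rewrite /phi scale0r add0r addr0 scaler1.
have p0 : phi 0 = x by rewrite /phi scale0r add0r.
have hf' : is_derive (phi 0) v f r by rewrite p0.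
have h1 : is_derive (0 : R) (1 : R) (fun s : R => f (phi s)) r := proj1 (dr_affine _ _ hphi) hf'.
have h2 : is_derive (f (phi 0)) (1 : R) (fun u : R => Num.sqrt u) (2 * Num.sqrt (f (phi 0)))^-1.
  by apply: is_derive1_sqrt; rewrite p0.
have := proj2 (dr_affine (fun u => Num.sqrt (f u)) _ hphi) (is_derive1_comp h2 h1).
by rewrite p0.
Qed.

(** The volume is the square root of a positive polynomial in the metric, and
    the inverse metric is rational in it by [invmx_Einv]. *)
Lemma dr_vol_metric (h : 'rV[R]_3 -> 'M[R]_3) x (v : 'rV[R]_3) (dh : 'I_3 -> 'I_3 -> R) k l :
  (forall m n, is_derive x v (fun x => h x m n) (dh m n)) ->
  (\forall x' \near x, 0 < \det (h x')) ->
  exists d, is_derive x v (fun x => vol h x * invmx (h x) k l) d.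
Proof.
move=> hd hpos; have h0 := nbhs_singleton hpos.
pose H m n x := h x m n.
have dE x' : dete (at2 H x') = \det (h x').
  by rewrite -det_dete; congr (\det _); apply/matrixP => m n; rewrite mxE.
have [de hde] : exists d, is_derive x v (fun x => dete (at2 H x)) d.
  by eexists; apply: dr_sum => c; apply: drM (hd i0 c) (dr_cr c (hd i1) (hd i2)).
have [di hdi] : exists d, is_derive x v (fun x => Einv (at2 H x) k l) d.
  by apply: dr_Einv hd _; rewrite dE gt_eqF.
have p0 : 0 < dete (at2 H x) by rewrite dE.
eexists; apply: dr_near (drM (dr_sqrt p0 hde) hdi).
apply: filterS hpos => x' hx'; rewrite /vol -dE invmx_Einv ?gt_eqF//.
Qed.

End Vierbein.

(** * Charts of the manifold *)

Section Solution.
Context {R : realType} {G : gauge_group} {X : manifold3 R}.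
Variables (g : riemannian X) (P : bundle X G) (A Phi : form4 X G) (e w : formX X G).
Variables (dep : nat -> nat) (a b : nat -> nat -> formX X G)
  (f : nat -> nat -> secX X G).

Lemma cod_open (i : idx X) : open (cod i).
Proof. by case: X i. Qed.

Lemma metric_smooth i : smooth_mx (cod i) (metric g i).
Proof. by case: g. Qed.

Lemma lift1_xdir (al : formX X G) i k z : lift1 al i (xdir k) z = al i k (xpart z).
Proof. by rewrite /lift1 /xdir (unsplitK (inl k)). Qed.

Lemma cyl_xy (U : set 'rV[R]_3) x (y : R) : U x -> 0 < y -> cyl U (xy x y).
Proof. by move=> Ux y0; rewrite /cyl /= xpart_xy ypart_xy. Qed.

Lemma smooth_co n (U : set 'rV[R]_n) (F : 'rV[R]_n -> 'M[R]_(gdim G)) c :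
  smooth_mx U F -> smooth_on U (fun x => co (F x) c).
Proof. by move=> s; apply: smooth_onZ; [exact: coscale_neq0|exact: s]. Qed.

(** Coordinates in the Lie algebra are entries up to a nonzero factor, and
    [smooth_base] descends from X x R^+ to X. *)
Lemma smooth_co_lift1 (al : formX X G) i k c :
  smooth_mx (cyl (cod i)) (lift1 al i (xdir k)) ->
  smooth_on (cod i) (fun x => co (al i k x) c).
Proof.
move=> /(smooth_co c) s; apply: smooth_base; first exact: cod_open.
rewrite (_ : (fun z => _) = (fun z => co (lift1 al i (xdir k) z) c)) //.
by apply/funext => z; rewrite lift1_xdir.
Qed.

Lemma lie_lift1 (al : formX X G) i k x :
  (forall mu z, cyl (cod i) z -> lie_carrier (lift1 al i mu z)) ->
  cod i x -> lie_carrier (al i k x).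
Proof.
move=> l Ux; have := l (xdir k) _ (cyl_xy Ux ltr01).
by rewrite lift1_xdir xpart_xy.
Qed.

Definition chart_of (i : idx X) : local_fields := LocalFields (cod i)
  (fun k c x => co (e i k x) c) (fun k c x => co (w i k x) c)
  (vol (metric g i))
  (fun k l x => partial k (fun x => vol (metric g i) x * invmx (metric g i x) k l) x)
  (fun k c z => co (A i (xdir k) z) c) (fun k c z => co (Phi i (xdir k) z) c)
  (fun c z => co (Phi i ydir z) c) dep
  (fun n p k c x => co (a n p i k x) c) (fun n p k c x => co (b n p i k x) c)
  (fun n p c x => co (f n p i x) c).

Hypothesis hA : is_connection P A.
Hypothesis hPhi : is_form1 P Phi.
Hypothesis hKW : kapustin_witten g A Phi.
Hypothesis hgauge : temporal_gauge A.
Hypothesis hpole : nahm_pole g A Phi e.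
Hypothesis hw : is_connection P (lift1 w).
Hypothesis he : is_form1 P (lift1 e).
Hypothesis ha : expands1 P (minus_lead A w) succn dep a.
Hypothesis hb : expands1 P (minus_pole Phi e) succn dep b.
Hypothesis hf : expands0 P (dy_part Phi) succn dep f.

Lemma metric_vierbein i x : cod i x ->
  (forall k l, metric g i x k l = \sum_c co (e i k x) c * co (e i l x) c) /\
  dete (at2 (fun k c x => co (e i k x) c) x) != 0.
Proof.
move=> Ux; have [U [th [t [[_ [U0x _]] [_ [_ ht]]]]]] := hpole.1 i x Ux.
have [h1 h2 h3 h4] := ht x U0x.
have ee k : co (e i k x) = (fun c => \sum_a th a k x * co (t a x) c).
  apply/funext => c; rewrite h4 co_sum.
  by apply: eq_bigr => d _; rewrite coZ.
have [|||q1 q2] := @vierbein_metric R (metric g i x) (fun a k => th a k x)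
  (fun d c => co (t d x) c).
- exact: h1.
- move=> d d' c; rewrite -co_bracket ?h3 ?co_sum; first by apply: eq_bigr => ? _; rewrite coZ.
    by have [] := h2 d.
  by have [] := h2 d'.
- have [l0 n0] := h2 i0; apply: contrapT => hn; move/negP: n0; apply; apply/eqP.
  apply: lie_eq0 => // c; apply/eqP; apply: contrapT => hc.
  by apply: hn; exists c; apply/negP.
- split; first by move=> k l; rewrite q1 (ee k) (ee l).
  rewrite (_ : at2 _ x = (fun k c => \sum_a th a k x * co (t a x) c))//.
  by apply/funext => k; exact: ee.
Qed.

Lemma chart_of_kw i : local_kw (chart_of i).
Proof.
have oU : open (cod i) := @cod_open i.
have V x (Ux : cod i x) := metric_vierbein Ux.
have [hA1 [hA2 _]] := hA; have [hP1 [hP2 _]] := hPhi.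
have [hw1 _] := hw; have [he1 _] := he.
have [ha1 ha3] := ha; have [hb1 hb3] := hb; have [hf1 hf3] := hf.
have detE x (Ux : cod i x) := metric_det (V x Ux).1.
have det0 x : cod i x -> 0 < \det (metric g i x).
  by move=> Ux; rewrite (detE _ Ux) exprn_even_gt0//= (V x Ux).2.
have hU x : cod i x -> metric g i x \in unitmx.
  by move=> Ux; rewrite unitmxE unitfE gt_eqF// det0.
have Ay z : cyl (cod i) z -> A i ydir z = 0 by exact: hgauge.
have sP mu c := smooth_co c (hP1 i mu).
have inv x (Ux : cod i x) k l := invmx_frame (V x Ux).2 (V x Ux).1 k l.
have KW z (Uz : cyl (cod i) z) := hKW Uz.
split=> /=.
- exact: oU.
- by move=> k c; apply: smooth_co_lift1; exact: he1.
- by move=> k c; apply: smooth_co_lift1; exact: hw1.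
- by move=> k c; apply: smooth_co; exact: hA1.
- by move=> k c; exact: sP.
- by move=> c; exact: sP.
- by move=> n p k c; apply: smooth_co_lift1; exact: (ha1 n p).1.
- by move=> n p k c; apply: smooth_co_lift1; exact: (hb1 n p).1.
- move=> n p c; apply: smooth_base; first exact: oU.
  exact: (smooth_co c ((hf1 n p).1 i)).
- by move=> x Ux; exact: (V x Ux).2.
- by move=> x Ux; rewrite -detE// /vol sqr_sqrtr// ltW// det0.
- move=> k c; have := expansionZ (coscale_neq0 (G := G)) (ha3 i k (corow G c) (cocol G c)).
  congr expansion; apply/funext => z.
  by rewrite /minus_lead lift1_xdir /co !mxE mulrBr.
- move=> k c; have := expansionZ (coscale_neq0 (G := G)) (hb3 i k (corow G c) (cocol G c)).
  congr expansion; apply/funext => z.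
  by rewrite /minus_pole lift1_xdir /co !mxE mulrBr; congr (_ - _); rewrite mulrCA.
- move=> c; exact: expansionZ (coscale_neq0 (G := G)) (hf3 i (corow G c) (cocol G c)).
- move=> x y Ux y0 q c; have Uz := cyl_xy Ux y0.
  have [K1 _] := KW _ Uz.
  have := kw_xx hU (hA2 i) (hP2 i) Ay Uz K1 q c; rewrite xpart_xy => <-.
  by congr (_ * _); apply: eq_bigr => k _; rewrite inv.
- move=> x y Ux y0 k c; have Uz := cyl_xy Ux y0.
  have [K1 _] := KW _ Uz.
  have := kw_yx oU hU (hA2 i) (hP2 i) Ay Uz K1 k c; rewrite xpart_xy => ->.
  congr (_ * _); apply: eq_bigr => l _; apply: eq_bigr => m _.
  by rewrite !inv.
- move=> x y Ux y0 c; have Uz := cyl_xy Ux y0.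
  have [_ K3] := KW _ Uz.
  have v0 x' : cod i x' -> vol (metric g i) x' != 0.
    by move=> Ux'; rewrite /vol gt_eqF// sqrtr_gt0 det0.
  have dv x' k m l : cod i x' -> is_derive x' (delta_mx 0 k)
      (fun x => vol (metric g i) x * invmx (metric g i x) m l)
      (partial k (fun x => vol (metric g i) x * invmx (metric g i x) m l) x').
    move=> Ux'; have [||d hd] := @dr_vol_metric R (metric g i) x' (delta_mx 0 k)
      (fun m n => partial k (fun x => metric g i x m n) x') m l.
    - by move=> r s; exact: (dr_smooth k (@metric_smooth i r s) Ux').
    - by apply: filterS (open_nbhs_nbhs (conj oU Ux')) => u; exact: det0.
    exact: is_derive_partial hd.
  have K4 := kw_div oU hU (hA2 i) (hP2 i) Ay sP dv v0 c Ux y0 K3; rewrite -[RHS]K4.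
  congr (_ + _); apply: eq_bigr => k _; apply: eq_bigr => l _.
  by rewrite inv.
Qed.

End Solution.

(** * Reindexing the expansions *)

Section Reindex.
Context {R : realType}.
Implicit Types (U : set 'rV[R]_3).

Lemma sum_parity (s : bool) (T : nat -> R) N : (forall n, odd (n + s) -> T n = 0) ->
  \sum_(n < 2 * N + s) T n = \sum_(n < N) T (2 * n + s)%N.
Proof.
move=> hT; elim: N => [|N ih].
  rewrite muln0 add0n big_ord0; case: s hT => hT; last by rewrite big_ord0.
  by rewrite [LHS](big_ord1 _ (fun i : 'I_1 => T i)) hT.
rewrite (_ : (2 * N.+1 + s)%N = (2 * N + s).+2); last by lia.
rewrite 2!big_ord_recr [RHS]big_ord_recr /= ih [X in _ + X]hT ?addr0//.
by lia.
Qed.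

Lemma sum_truncate (d d' : nat) (T : nat -> R) :
  (forall p, (p <= d)%N -> (d' < p)%N -> T p = 0) ->
  \sum_(p < d.+1) T p = \sum_(p < d'.+1) if (p <= d)%N then T p else 0.
Proof.
move=> hT; rewrite (big_ord_widen (maxn d.+1 d'.+1) T) ?leq_maxl//.
rewrite (big_ord_widen (maxn d.+1 d'.+1) (fun p => if (p <= d)%N then T p else 0)) ?leq_maxr//.
rewrite big_mkcond [RHS]big_mkcond; apply: eq_bigr => p _; rewrite !ltnS.
by case: leqP => // pd; case: leqP => // d'p; rewrite hT.
Qed.

(** When the coefficients of one parity vanish the remaining ones can be
    renumbered; a truncation of the new expansion is a truncation of the old
    one with the same order of error. *)
Lemma expansion_reindex (s : bool) U F (dep gam' dep' : nat -> nat) c : open U ->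
  (forall n, gam' n = (2 * n + s).+1) ->
  (forall n p x, U x -> (p <= dep n)%N -> odd (n + s) -> c n p x = 0) ->
  (forall n p x, U x -> (p <= dep (2 * n + s))%N -> (dep' n < p)%N ->
     c (2 * n + s)%N p x = 0) ->
  expansion U F succn dep c ->
  expansion U F gam' dep'
    (fun n p x => if (p <= dep (2 * n + s))%N then c (2 * n + s)%N p x else 0).
Proof.
move=> oU hg h1 h2 hF N j ks x0 Ux0.
have [q [C [d [d0 hx]]]] := hF (2 * N + s)%N j ks x0 Ux0.
exists q, C, d; split => //.
set c' := (X in psum _ _ X).
have E z : cyl U z -> psum gam' dep' c' N z = psum succn dep c (2 * N + s) z.
  case=> Uz _; rewrite /psum; symmetry.
  rewrite (@sum_parity s (fun n => \sum_(p < (dep n).+1)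
    c n p (xpart z) * ypart z ^+ n.+1 * ln (ypart z) ^+ p)); last first.
    move=> n on; rewrite big1// => p _.
    by rewrite h1 ?mul0r// -ltnS.
  apply: eq_bigr => n _; rewrite (@sum_truncate _ (dep' n)
    (fun p => c (2 * n + s)%N p (xpart z) * ypart z ^+ (2 * n + s).+1 * ln (ypart z) ^+ p)).
    apply: eq_bigr => p _; rewrite /c' hg; case: ifP => // _.
    by rewrite !mul0r.
  by move=> p pd dp; rewrite h2 ?mul0r.
apply: filterS2 hx (open_nbhs_nbhs (conj oU Ux0)) => x hx Ux y yd.
have y0 : 0 < y by case/andP: yd.
rewrite hg (@bderiv_local R U (fun z => F z - psum gam' dep' c' N z)
   (fun z => F z - psum succn dep c (2 * N + s) z) j ks oU)//; first exact: hx.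
  by move=> z Uz; rewrite E.
by rewrite /cyl /= xpart_xy ypart_xy.
Qed.

End Reindex.

(** * The expansions *)

Section Solution.
Context {R : realType} {G : gauge_group} {X : manifold3 R}.
Variables (g : riemannian X) (P : bundle X G) (A Phi : form4 X G) (e w : formX X G).
Variables (dep : nat -> nat) (a b : nat -> nat -> formX X G)
  (f : nat -> nat -> secX X G).
Hypothesis hA : is_connection P A.
Hypothesis hPhi : is_form1 P Phi.
Hypothesis hKW : kapustin_witten g A Phi.
Hypothesis hgauge : temporal_gauge A.
Hypothesis hpole : nahm_pole g A Phi e.
Hypothesis hw : is_connection P (lift1 w).
Hypothesis he : is_form1 P (lift1 e).
Hypothesis ha : expands1 P (minus_lead A w) succn dep a.
Hypothesis hb : expands1 P (minus_pole Phi e) succn dep b.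
Hypothesis hf : expands0 P (dy_part Phi) succn dep f.
Let K i := chart_of g A Phi e w dep a b f i.
Let hK i : local_kw (K i) := chart_of_kw hA hPhi hKW hgauge hpole hw he ha hb hf i.

Lemma form0 : is_form1 P (lift1 (fun _ _ _ => 0)).
Proof.
have E i mu : @lift1 _ X G (fun _ _ _ => 0) i mu = fun=> 0.
  by apply/funext => z; rewrite /lift1; case: (fintype.split mu).
split=> [i mu r t|].
  by rewrite E; under eq_fun do rewrite mxE; exact: smooth_cst0.
split=> [i mu z _|i j mu z _]; first by rewrite E; exact: lie_carrier0.
rewrite E mulmx0 mul0mx big1// => nu _; by rewrite E scaler0.
Qed.

Lemma section0 : is_section P (@Defs.lift0 R X G (fun _ _ => 0)).
Proof.
split=> [i r t|].
  by rewrite /Defs.lift0; under eq_fun do rewrite mxE; exact: smooth_cst0.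
split=> [i z _|i j z _]; first exact: lie_carrier0.
by rewrite /Defs.lift0 mulmx0 mul0mx.
Qed.

Section Grading.
Variable D : nat -> nat.
Hypothesis hD : forall i n, good_all (K i) D n.

Let a0 n p i k x : cod i x -> (p <= dep n)%N -> odd n.+1 || (D n.+1 < p)%N ->
  a n p i k x = 0.
Proof.
move=> Ux pn h; apply: lie_eq0; first exact: (lie_lift1 k ((ha.1 n p).2.1 i) Ux).
by move=> c; exact: (@ca_vanish _ (K i) D (hD i) n p k c x Ux pn h).
Qed.

Let b0 n p i k x : cod i x -> (p <= dep n)%N -> odd n.+2 || (D n.+2 < p)%N ->
  b n p i k x = 0.
Proof.
move=> Ux pn h; apply: lie_eq0; first exact: (lie_lift1 k ((hb.1 n p).2.1 i) Ux).
by move=> c; exact: (@cb_vanish _ (K i) D (hD i) n p k c x Ux pn h).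
Qed.

Let f0 n p i x : cod i x -> (p <= dep n)%N -> odd n.+1 || (D n.+1 < p)%N ->
  f n p i x = 0.
Proof.
move=> Ux pn h; apply: lie_eq0.
  by have := (hf.1 n p).2.1 i _ (cyl_xy Ux ltr01); rewrite /Defs.lift0 xpart_xy.
by move=> c; exact: (@cg_vanish _ (K i) D (hD i) n p c x Ux pn h).
Qed.

(** The old coefficient of index n multiplies y^(n + 1), so the even powers
    of A and phi_y have odd index and the odd powers of b have even index.
    Coefficients beyond the old range of p are set to 0, since nothing is
    known about them. *)
Lemma solution_expansion (dep' : nat -> nat) : (forall n, D (2 * n.+1)%N = dep' n) ->
  exists (a' b' : nat -> nat -> formX X G) (f' : nat -> nat -> secX X G),
  [/\ expands1 P (minus_lead A w) (fun n => (2 * n.+1)%N) dep' a',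
      expands1 P (minus_pole Phi e) (fun n => (2 * n.+1 - 1)%N) dep' b' &
      expands0 P (dy_part Phi) (fun n => (2 * n.+1)%N) dep' f'].
Proof.
move=> hd.
exists (fun n p => if (p <= dep (2 * n + true))%N then a (2 * n + true)%N p else fun _ _ _ => 0).
exists (fun n p => if (p <= dep (2 * n + false))%N then b (2 * n + false)%N p else fun _ _ _ => 0).
exists (fun n p => if (p <= dep (2 * n + true))%N then f (2 * n + true)%N p else fun _ _ => 0).
have D1 n : D (2 * n + true).+1 = dep' n by rewrite -hd; congr D; lia.
have D2 n : D (2 * n + false).+2 = dep' n by rewrite -hd; congr D; lia.
split; split.
- by move=> n p; case: ifP => _; [exact: ha.1|exact: form0].
- move=> i k r t.
  have := @expansion_reindex _ true (cod i) _ dep (fun n => (2 * n.+1)%N) dep' _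
    (@cod_open R X i) _ _ _ (ha.2 i k r t).
  rewrite (_ : (fun n p x => if _ then _ else _) = (fun n p x =>
    (if (p <= dep (2 * n + true))%N then a (2 * n + true)%N p
     else fun _ _ _ => 0) i k x r t)).
    apply.
    + by move=> n; lia.
    + move=> n p x Ux pn on; rewrite a0 ?mxE// (_ : odd n.+1)//.
      by move: on; rewrite addn1.
    + by move=> n p x Ux pn dp; rewrite a0 ?mxE// D1 dp orbT.
  apply/funext => n; apply/funext => p; apply/funext => x.
  by case: ifP => // _; rewrite mxE.
- by move=> n p; case: ifP => _; [exact: hb.1|exact: form0].
- move=> i k r t.
  have := @expansion_reindex _ false (cod i) _ dep (fun n => (2 * n.+1 - 1)%N) dep' _
    (@cod_open R X i) _ _ _ (hb.2 i k r t).
  rewrite (_ : (fun n p x => if _ then _ else _) = (fun n p x =>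
    (if (p <= dep (2 * n + false))%N then b (2 * n + false)%N p
     else fun _ _ _ => 0) i k x r t)).
    apply.
    + by move=> n; lia.
    + move=> n p x Ux pn on; rewrite b0 ?mxE// (_ : odd n.+2)//.
      by move: on; rewrite addn0 /= negbK.
    + by move=> n p x Ux pn dp; rewrite b0 ?mxE// D2 dp orbT.
  apply/funext => n; apply/funext => p; apply/funext => x.
  by case: ifP => // _; rewrite mxE.
- by move=> n p; case: ifP => _; [exact: hf.1|exact: section0].
- move=> i r t.
  have := @expansion_reindex _ true (cod i) _ dep (fun n => (2 * n.+1)%N) dep' _
    (@cod_open R X i) _ _ _ (hf.2 i r t).
  rewrite (_ : (fun n p x => if _ then _ else _) = (fun n p x =>
    (if (p <= dep (2 * n + true))%N then f (2 * n + true)%N p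
     else fun _ _ => 0) i x r t)).
    apply.
    + by move=> n; lia.
    + move=> n p x Ux pn on; rewrite f0 ?mxE// (_ : odd n.+1)//.
      by move: on; rewrite addn1.
    + by move=> n p x Ux pn dp; rewrite f0 ?mxE// D1 dp orbT.
  apply/funext => n; apply/funext => p; apply/funext => x.
  by case: ifP => // _; rewrite mxE.
Qed.

End Grading.

Let hmet i x : cod i x -> forall k l,
  metric g i x k l = \sum_c ce (K i) k c x * ce (K i) l c x.
Proof. by move=> Ux k l; have [-> _] := metric_vierbein hpole Ux. Qed.

(** By the Leibniz rule the derivative of e(W) is e(dW) plus W contracted
    with the covariant derivative of the vierbein, which [levi_civita]
    expresses by Christoffel symbols. *)
Lemma solution_levi_civita : pullback_is_levi_civita g e w.
Proof.
move=> i W sW k x Ux; apply/matrixP => r s.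
have [kap [c hc]] := hat_entry (R := R) r s.
have le l u : cod i u -> lie_carrier (e i l u) by exact: (lie_lift1 l (he.2.1 i)).
have eE l u : cod i u -> e i l u r s = kap * co (e i l u) c.
  by move=> Uu; rewrite {1}(lie_hat (le l u Uu)).
have lw : lie_carrier (w i k x) by exact: (lie_lift1 k (hw.2.1 i)).
have oU : open (cod i) := @cod_open R X i.
have dW l : is_derive x (delta_mx 0 k) (fun u => W u 0 l) (partial k (fun u => W u 0 l) x).
  exact: (dr_smooth k (sW 0 l) Ux).
have de l := dr_smooth k (ke (hK i) l c) Ux.
have dS := drZ kap (dr_sum (fun l => drM (dW l) (de l))).
have -> : covD (w i) k (fun u => \sum_l W u 0 l *: e i l u) x r s =
    kap * (\sum_l (partial k (fun u => W u 0 l) x * ce (K i) l c x +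
       W x 0 l * partial k (ce (K i) l c) x)) +
    kap * \sum_l W x 0 l * cr (co (w i k x)) (co (e i l x)) c.
  rewrite /covD bracket_sumr !mxE summxE; congr (_ + _).
    apply: partial_dr; apply: dr_near dS.
    apply: filterS (open_nbhs_nbhs (conj oU Ux)) => u Uu.
    by rewrite summxE mulr_sumr; apply: eq_bigr => l _; rewrite mxE eE// mulrCA.
  rewrite mulr_sumr; apply: eq_bigr => l _.
  by rewrite bracketZr mxE (bracket_hat lw (le l x Ux)) hc mulrCA.
rewrite summxE -mulrDr -big_split /=.
transitivity (kap * \sum_l (partial k (fun u => W u 0 l) x * ce (K i) l c x +
    W x 0 l * \sum_m christoffel (metric g i) m k l x * ce (K i) m c x)).
  congr (_ * _); apply: eq_bigr => l _; rewrite -addrA -mulrDr.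
  by rewrite -(levi_civita (hK i) (@hmet i) k l c Ux).
rewrite big_split /= mulrDr.
transitivity (\sum_l (kap * (partial k (fun u => W u 0 l) x * ce (K i) l c x) +
   kap * ((\sum_m christoffel (metric g i) l k m x * W x 0 m) * ce (K i) l c x))).
  rewrite big_split /= -!mulr_sumr; congr (_ + _ * _).
  under eq_bigr do rewrite mulr_sumr.
  rewrite exchange_big /=; apply: eq_bigr => l _; rewrite mulr_suml.
  by apply: eq_bigr => m _; rewrite mulrCA mulrA.
apply: eq_bigr => l _; rewrite !mxE eE//= -mulrDr -mulrDl mulrCA.
by [].
Qed.

Lemma solution_grading i n : good_all (K i) half n.
Proof. exact: chart_expansion (hK i) n. Qed.

Lemma solution_grading_einstein : einstein g -> forall i n, good_all (K i) (fun=> 0%N) n.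
Proof.
move=> [lam hlam] i n; apply: (chart_expansion_einstein (hK i) (mu := - lam / 2)).
move=> x c d Ux; exact: (einstein_curvature (hK i) (@hmet i) c d Ux (hlam i x Ux)).
Qed.

End Solution.

Theorem theorem1p4 (R : realType) (G : gauge_group) (X : manifold3 R)
    (g : riemannian X) (P : bundle X G) (A Phi : form4 X G) (e w : formX X G)
    (hA : is_connection P A) (hPhi : is_form1 P Phi)
    (hKW : kapustin_witten g A Phi)
    (hgauge : temporal_gauge A)
    (hpole : nahm_pole g A Phi e)
    (hphg : polyhomogeneous P A Phi e w) :
  ((exists (a b : nat -> nat -> formX X G) (f : nat -> nat -> secX X G),
      [/\ expands1 P (minus_lead A w) (fun n => (2 * n.+1)%N) (fun n => n.+1) a,
          expands1 P (minus_pole Phi e) (fun n => (2 * n.+1 - 1)%N)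
            (fun n => n.+1) b &
          expands0 P (dy_part Phi) (fun n => (2 * n.+1)%N) (fun n => n.+1) f])
   /\ pullback_is_levi_civita g e w)
  /\
  (einstein g ->
   exists (a b : nat -> nat -> formX X G) (f : nat -> nat -> secX X G),
     [/\ expands1 P (minus_lead A w) (fun n => (2 * n.+1)%N) (fun n => 0%N) a,
         expands1 P (minus_pole Phi e) (fun n => (2 * n.+1 - 1)%N)
           (fun n => 0%N) b &
         expands0 P (dy_part Phi) (fun n => (2 * n.+1)%N) (fun n => 0%N) f]).
Proof.
have [hw [he [_ [dep [a [b [f [ha hb hf]]]]]]]] := hphg.
have half_even n : half (2 * n.+1)%N = n.+1 by lia.
split; first split.
- exact: (solution_expansion ha hb hf
    (solution_grading hA hPhi hKW hgauge hpole hw he ha hb hf) half_even).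
- exact: (solution_levi_civita hA hPhi hKW hgauge hpole hw he ha hb hf).
move=> hein; exact: (solution_expansion ha hb hf
  (solution_grading_einstein hA hPhi hKW hgauge hpole hw he ha hb hf hein)
  (fun _ => erefl)).
Qed.
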